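(* For every integer $N\ge 1$, the map $$\chi_N=(I_1,\dots,I_N,L_1,\dots,L_N;\varphi_1,\dots,\varphi_N,\theta_1,\dots,\theta_N)$$ is a diffeomorphism from $\mathcal M(N)_{\rm gen}$ onto $\Omega_N\times\mathbb T^{2N}$, where $$\Omega_N=\{(I_1,\dots,I_N,L_1,\dots,L_N)\in\mathbb R^{2N}:\ I_1>L_1>I_2>L_2>\dots>I_N>L_N>0\},$$ and it is symplectic in the sense that $$\chi_{N*}\omega=\sum_{j=1}^N dI_j\wedge d\varphi_j+\sum_{m=1}^N dL_m\wedge d\theta_m .$$
   Context: $L^2_+$ is the Hardy space of the circle: functions $u=\sum_{k\ge0}\hat u(k)e^{ik\theta}$ with $\sum_k|\hat u(k)|^2<\infty$, identified with holomorphic functions $u(z)=\sum_{k\ge0}\hat u(k)z^k$ on the unit disc; $(u|v)=\int_0^{2\pi}u\bar v\,\frac{d\theta}{2\pi}$; $H^s_+=H^s(\mathbb S^1)\cap L^2_+$. $\Pi$ is the Szegő projector (orthogonal projection of $L^2(\mathbb S^1)$ onto $L^2_+$). For $u\in H^{1/2}_+$, the Hankel operator is the antilinear operator $H_u(h)=\Pi(u\bar h)$ on $L^2_+$; $T_z$ denotes multiplication by $z$ on $L^2_+$ and $K_u=H_uT_z$. The operators $H_u^2$ and $K_u^2=H_u^2-(\cdot|u)u$ are $\mathbb C$-linear, positive, self-adjoint and trace class. $L^2_+$ carries the symplectic form $\omega(u,v)=4\,\mathrm{Im}(u|v)$. $\mathcal M(N)$ is the set of rational functions $u=A/B$ with $A\in\mathbb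 C_{N-1}[z]$, $B\in\mathbb C_N[z]$, $B(0)=1$, $\deg A=N-1$ or $\deg B=N$, $A,B$ coprime, $B(z)\ne0$ for $|z|\le1$ (equivalently, $H_u$ has rank $N$); it is a $2N$-dimensional complex submanifold of $L^2_+$, symplectic for (the restriction of) $\omega$. $\mathcal M(N)_{\rm gen}$ is the set of $u\in\mathcal M(N)$ such that $1\notin\mathrm{Ran}\,H_u$ and $H_u^{2k}(1)$, $k=1,\dots,N$, are linearly independent; equivalently, $H_u^2$ has $N$ simple positive eigenvalues $\lambda_1^2>\dots>\lambda_N^2$ ($\lambda_j>0$) and, with $P_j$ the orthogonal projector on the eigenspace of $\lambda_j^2$ and $\nu_j:=\|P_j(1)\|$, one has $\nu_j>0$ for all $j$ and $\sum_j\nu_j^2<1$. For $u\in\mathcal M(N)_{\rm gen}$: $(e_1,\dots,e_N)$ is an orthonormal basis of $\mathrm{Ran}\,H_u$ with $H_u(e_j)=\lambda_je_j$ (unique up to signs), and $\varphi_j:=\arg\,(1|e_j)^2$. The operator $K_u^2$ has exactly $N$ positive eigenvalues, all simple, $\mu_1^2>\dots>\mu_N^2$ ($\mu_m>0$), with $\mathrm{Ran}\,K_u=\mathrm{Ran}\,H_u$; $(f_1,\dots,f_N)$ is an orthonormal basis of $\mathrm{Ran}\,K_u$ with $K_u(f_m)=\mu_mf_m$ (unique up to signs), and $\theta_m:=\arg\,(u|f_m)^2$. Finally $I_j:=2\lambda_j^2$, $L_m:=2\mu_m^2$. *)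

(* Defs.v *)
(* (mathcomp-analysis + real-closed complex numbers R[i]). *)
From HB Require Import structures.
From mathcomp Require Import all_boot all_order all_algebra.
From mathcomp Require Import all_classical all_reals all_analysis.
From mathcomp Require Import complex.
From Stdlib Require Import ClassicalEpsilon.
Set Implicit Arguments. Unset Strict Implicit. Unset Printing Implicit Defensive.
Import Order.TTheory GRing.Theory Num.Theory.
Import numFieldTopology.Exports numFieldNormedType.Exports.
Local Open Scope ring_scope.

Section HankelDefs.
Variable R : realType.
Local Notation C := (R[i]).

(* Elements of L^2_+ are represented by their Fourier (= Taylor) coefficient
   sequences  u = (hat u(k))_{k >= 0}. *)
Definition seqC := nat -> C.

(* real and complex infinite sums (limits of partial sums) *)
Definition rsum (u : nat -> R) : R := limn (series u : R^nat).
Definition csum (f : nat -> C) : C :=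
  Complex (rsum (fun n => complex.Re (f n))) (rsum (fun n => complex.Im (f n))).

(* membership in L^2_+ : sum_k |hat h(k)|^2 < oo *)
Definition hk_l2 (h : seqC) : Prop :=
  cvgn (series (fun n => complex.Re (h n) ^+ 2 + complex.Im (h n) ^+ 2) : R^nat).

(* (u|v) = int u conj(v) dtheta/2pi = sum_k hat u(k) conj(hat v(k)) *)
Definition hk_inner (h g : seqC) : C := csum (fun n => h n * (g n)^*).

(* the constant function 1 *)
Definition hk_one : seqC := fun n => if n == 0%N then 1 else 0.

(* Hankel operator H_u h = Pi(u conj h):  hat(H_u h)(n) = sum_k hat u(n+k) conj(hat h(k)) *)
Definition hankel (c h : seqC) : seqC :=
  fun n => csum (fun k => c (n + k)%N * (h k)^*).

(* T_z = multiplication by z *)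
Definition Tz (h : seqC) : seqC := fun n => if n is m.+1 then h m else 0.

(* K_u = H_u T_z *)
Definition Kop (c h : seqC) : seqC := hankel c (Tz h).

Definition hk_scale (s : R) (h : seqC) : seqC := fun n => real_complex R s * h n.

(* --- the manifold M(N), parametrized by the coefficients of A and B --- *)
(* real coordinates p : 'M_(4,N):  row 0/1 = Re/Im of a_j (coefficient of z^j in A,
   j = 0..N-1), row 2/3 = Re/Im of b_{j+1} (coefficient of z^(j+1) in B). *)
Definition r0 : 'I_4 := @Ordinal 4 0 isT.
Definition r1 : 'I_4 := @Ordinal 4 1 isT.
Definition r2 : 'I_4 := @Ordinal 4 2 isT.
Definition r3 : 'I_4 := @Ordinal 4 3 isT.

Definition polyA (N : nat) (p : 'M[R]_(4, N)) : {poly C} :=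
  \sum_(j < N) (Complex (p r0 j) (p r1 j))%:P * 'X^j.
Definition polyB (N : nat) (p : 'M[R]_(4, N)) : {poly C} :=
  1 + \sum_(j < N) (Complex (p r2 j) (p r3 j))%:P * 'X^(j.+1).

(* the defining conditions of M(N): deg A = N-1 or deg B = N, A and B coprime,
   B(z) <> 0 for |z| <= 1  (A in C_{N-1}[z], B in C_N[z], B(0)=1 hold by construction) *)
Definition chartMN (N : nat) (p : 'M[R]_(4, N)) : Prop :=
  (size (polyA p) = N \/ size (polyB p) = N.+1) /\
  coprimep (polyA p) (polyB p) /\
  (forall z : C, `|z| <= 1 -> (polyB p).[z] != 0).

(* Taylor coefficients of A/B (B(0) = 1): B * u = A as power series *)
Fixpoint taylor_seq (A B : {poly C}) (n : nat) : seq C :=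
  if n is m.+1 then
    let l := taylor_seq A B m in
    rcons l (A`_n - \sum_(1 <= k < n.+1) B`_k * nth 0 l (n - k))
  else [:: A`_0].

Definition ucoef (N : nat) (p : 'M[R]_(4, N)) : seqC :=
  fun n => nth 0 (taylor_seq (polyA p) (polyB p) n) n.

Definition inMN (N : nat) (c : seqC) : Prop :=
  exists p : 'M[R]_(4, N), chartMN p /\ c = ucoef p.

(* M(N)_gen : 1 notin Ran H_u and H_u^{2k}(1), k = 1..N, linearly independent *)
Definition inMNgen (N : nat) (c : seqC) : Prop :=
  inMN N c /\
  ~ (exists h, hk_l2 h /\ hankel c h = hk_one) /\
  (forall alpha : 'I_N -> C,
     (forall n, \sum_(k < N) alpha k * iter (2 * k.+1) (hankel c) hk_one n = 0) ->
     forall k, alpha k = 0).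

(* s is an eigenvalue of the (C-linear) operator T on L^2_+ *)
Definition is_eigenvalue (T : seqC -> seqC) (s : R) : Prop :=
  exists h, hk_l2 h /\ h <> (fun _ => 0) /\ T h = hk_scale s h.

(* e is an orthonormal basis of Ran T *)
Definition ONB_of_range (N : nat) (T : seqC -> seqC) (e : 'I_N -> seqC) : Prop :=
  (forall j, hk_l2 (e j)) /\
  (forall i j, hk_inner (e i) (e j) = (i == j)%:R) /\
  (forall j, exists h, hk_l2 h /\ T h = e j) /\
  (forall h, hk_l2 h -> exists a : 'I_N -> C, T h = fun n => \sum_(j < N) a j * e j n).

(* unit complex number e^{i arg w} *)
Definition phase (w : C) : C := w / `|w|.

(* the action-angle data of u, with angles phi_j, theta_m represented by
   the points e^{i phi_j}, e^{i theta_m} of the unit circle *)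
Definition chi_spec (N : nat) (c : seqC)
    (d : ('I_N -> R) * ('I_N -> R) * ('I_N -> C) * ('I_N -> C)) : Prop :=
  let: (Iv, Lv, Phi, Theta) := d in
  exists (lam mu : 'I_N -> R) (e f : 'I_N -> seqC),
    (* lambda_1^2 > ... > lambda_N^2 > 0 : the positive eigenvalues of H_u^2 *)
    (forall j, 0 < lam j) /\ (forall i j : 'I_N, (i < j)%N -> lam j < lam i) /\
    (forall s, 0 < s ->
       (is_eigenvalue (fun h => hankel c (hankel c h)) s <-> exists j, s = lam j ^+ 2)) /\
    ONB_of_range (hankel c) e /\ (forall j, hankel c (e j) = hk_scale (lam j) (e j)) /\
    (* mu_1^2 > ... > mu_N^2 > 0 : the positive eigenvalues of K_u^2 *)
    (forall m, 0 < mu m) /\ (forall i j : 'I_N, (i < j)%N -> mu j < mu i) /\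
    (forall s, 0 < s ->
       (is_eigenvalue (fun h => Kop c (Kop c h)) s <-> exists m, s = mu m ^+ 2)) /\
    ONB_of_range (Kop c) f /\ (forall m, Kop c (f m) = hk_scale (mu m) (f m)) /\
    (* I_j = 2 lambda_j^2, L_m = 2 mu_m^2, phi_j = arg (1|e_j)^2, theta_m = arg (u|f_m)^2 *)
    (forall j, Iv j = 2 * lam j ^+ 2) /\ (forall m, Lv m = 2 * mu m ^+ 2) /\
    (forall j, Phi j = phase (hk_inner hk_one (e j) ^+ 2)) /\
    (forall m, Theta m = phase (hk_inner c (f m) ^+ 2)).

Definition chi (N : nat) (c : seqC) :
    ('I_N -> R) * ('I_N -> R) * ('I_N -> C) * ('I_N -> C) :=
  epsilon (inhabits ((fun _ => 0), (fun _ => 0), (fun _ => 0), (fun _ => 0)))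
          (@chi_spec N c).

(* Omega_N : I_1 > L_1 > I_2 > ... > I_N > L_N > 0 *)
Definition OmegaN (N : nat) (I L : 'I_N -> R) : Prop :=
  (forall j, L j < I j) /\
  (forall j k : 'I_N, k = j.+1 :> nat -> I k < L j) /\
  (forall j : 'I_N, j.+1 = N -> 0 < L j).

(* e^{it} *)
Definition expi (t : R) : C := Complex (cos t) (sin t).

(* iterated directional derivatives; C^oo on U *)
Fixpoint iterD (V : normedModType R) (vs : seq V) (f : V -> R) : V -> R :=
  if vs is v :: vs' then (fun x => 'D_v (iterD vs' f) x) else f.

Definition smooth_on (V : normedModType R) (U : set V) (f : V -> R) : Prop :=
  forall (vs : seq V) (x : V), U x ->
    {for x, continuous (iterD vs f)} /\ (forall v : V, derivable (iterD vs f) x v).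

(* pull-back of omega(u,v) = 4 Im (u|v) by a map F from 'M_(4,N) into L^2_+,
   at x, on tangent vectors v, w (differentials computed coefficientwise) *)
Definition omega_pull (N : nat) (F : 'M[R]_(4, N) -> seqC) (x v w : 'M[R]_(4, N)) : R :=
  4 * rsum (fun n =>
    'D_v (fun y => complex.Im (F y n)) x * 'D_w (fun y => complex.Re (F y n)) x
  - 'D_v (fun y => complex.Re (F y n)) x * 'D_w (fun y => complex.Im (F y n)) x).

End HankelDefs.

(* Main.v *)
Require Import Defs.
From HB Require Import structures.
From mathcomp Require Import all_boot all_order all_algebra.
From mathcomp Require Import all_classical all_reals all_analysis.
From mathcomp Require Import complex.
From mathcomp Require Import zify ring lra.
From mathcomp Require Import mxtens.
Set Implicit Arguments. Unset Strict Implicit. Unset Printing Implicit Defensive.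
Import Order.TTheory GRing.Theory Num.Theory.
Import numFieldTopology.Exports numFieldNormedType.Exports.
Local Open Scope ring_scope.

(* The Hankel operator of [u = A/B] has finite rank, so [H_u] and [K_u] act on an
   [N]-dimensional space: [hat u(n + k) = Y_n Lam Y_k^T] and
   [hat u(n + k + 1) = Z_n Mu Z_k^T], where the columns of [Y] and [Z = Y U] are
   the orthonormal eigenbases [e_j], [f_m] and [U] is unitary.  The identity
   [K_u^2 = H_u^2 - (.|u) u] makes [U] a Cauchy matrix,
   [U_jm (lam_j^2 - mu_m^2) = s_j k_m], which forces the interlacing, determines
   [|s_j|] and [|k_m|] from [lam], [mu], and leaves exactly the [2N] phases free.
   Since [Y_(n+1) = Y_n U Mu U^T Lam^-1], this is an explicit formula for the
   inverse map.

   Along an angle direction the variation of [hat u(n)] is a sum of Cauchy squares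
   of the columns of [Y] and [Z]; pairing it with an arbitrary variation of
   [Y Lam Y^T] leaves only the derivatives of [lam] and [mu], because [Y^* dY] is
   antihermitian.  So the contraction of [omega] with an angle field is constant,
   and, [omega] being closed, its coefficients on pairs of action directions are
   independent of the angles; they vanish at angles zero, where [u] is real.

   Smoothness is carried by a class of elementary functions closed under
   derivatives.  Sums over the coefficient index are [a (1 - M)^-1 b] for a stable
   matrix [M], hence elementary; the eigenvalues are simple roots of a polynomial
   with elementary coefficients, and the phases come from the Lagrange projectors
   on the eigenvectors. *)

(** * Geometrically decaying sequences and their sums *)

Section ComplexSequences.
Variable R : realType.
Local Notation C := (R[i]).
Implicit Types (f g : nat -> C) (z w : C).

(** Three obstacles shape the development. [chi] is an [epsilon] choice among bases unique only up
    to signs, so it is computed by exhibiting one Takagi form of [u] and one of the shifted symbol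
    (whose Hankel operator is [K_u]) and by showing that every admissible choice gives the same
    squares. The inverse formula takes half-phases, whose signs are arbitrary as well; conjugating
    the transfer matrix by a diagonal matrix shows that only their squares matter, which yields
    injectivity and allows half angles on the lift [R^2N]. Finally, derivability is known only
    direction by direction: linearity in the direction and symmetry of second derivatives, both
    behind the closedness argument, are proved by induction over elementary functions, which on the
    side of [Omega_N] are built from coordinates alone. On the side of [M(N)_gen] the eigenvalues
    are adjoined as generators, and openness of the stability condition is read off a power of the
    companion matrix rather than off its roots. *)

Definition cabs z : R := complex.Re `|z|.

Lemma cabsE z : `|z| = (cabs z)%:C%C.
Proof. by rewrite /cabs normc_def. Qed.

Lemma cabs_ge0 z : 0 <= cabs z.
Proof. by have := normr_ge0 z; rewrite cabsE ler0c. Qed.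

Lemma cabsM z w : cabs (z * w) = cabs z * cabs w.
Proof. by apply: (@complexI R); rewrite rmorphM /= -!cabsE normrM. Qed.

Lemma cabsD z w : cabs (z + w) <= cabs z + cabs w.
Proof. by rewrite -lecR rmorphD /= -!cabsE ler_normD. Qed.

Lemma cabs0 : cabs 0 = 0. Proof. by rewrite /cabs normr0. Qed.

Lemma cabsX z n : cabs (z ^+ n) = cabs z ^+ n.
Proof. by apply: (@complexI R); rewrite rmorphXn /= -!cabsE normrX. Qed.

Lemma cabs_conj z : cabs z^* = cabs z.
Proof. by rewrite /cabs norm_conjC. Qed.

Lemma cabs_real (x : R) : cabs x%:C%C = `|x|.
Proof. by rewrite /cabs normc_def /= expr0n /= addr0 sqrtr_sqr. Qed.

Lemma cRe_conj z : complex.Re z^* = complex.Re z. Proof. by case: z. Qed.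
Lemma cIm_conj z : complex.Im z^* = - complex.Im z. Proof. by case: z. Qed.

Lemma cReD z w : complex.Re (z + w) = complex.Re z + complex.Re w.
Proof. by case: z w => [a b] [c d]. Qed.
Lemma cImD z w : complex.Im (z + w) = complex.Im z + complex.Im w.
Proof. by case: z w => [a b] [c d]. Qed.
Lemma cReM z w : complex.Re (z * w) =
  complex.Re z * complex.Re w - complex.Im z * complex.Im w.
Proof. by case: z w => [a b] [c d]. Qed.
Lemma cImM z w : complex.Im (z * w) =
  complex.Re z * complex.Im w + complex.Im z * complex.Re w.
Proof. by case: z w => [a b] [c d]. Qed.
Lemma complex_eq z w :
  complex.Re z = complex.Re w -> complex.Im z = complex.Im w -> z = w.
Proof. by case: z w => [a b] [c d] /= -> ->. Qed.

Lemma cRe_sum I (r : seq I) (P : pred I) (F : I -> C) :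
  complex.Re (\sum_(i <- r | P i) F i) = \sum_(i <- r | P i) complex.Re (F i).
Proof. by elim/big_rec2: _ => [//|i x y _ <-]; rewrite cReD. Qed.
Lemma cIm_sum I (r : seq I) (P : pred I) (F : I -> C) :
  complex.Im (\sum_(i <- r | P i) F i) = \sum_(i <- r | P i) complex.Im (F i).
Proof. by elim/big_rec2: _ => [//|i x y _ <-]; rewrite cImD. Qed.

Lemma le_Re_cabs z : `|complex.Re z| <= cabs z.
Proof.
rewrite /cabs normc_def /= -[leLHS]sqrtr_sqr ler_wsqrtr //.
by rewrite lerDl sqr_ge0.
Qed.

Lemma le_Im_cabs z : `|complex.Im z| <= cabs z.
Proof.
rewrite /cabs normc_def /= -[leLHS]sqrtr_sqr ler_wsqrtr //.
by rewrite lerDr sqr_ge0.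
Qed.

Lemma cabs_sqr z : cabs z ^+ 2 = complex.Re z ^+ 2 + complex.Im z ^+ 2.
Proof. by rewrite /cabs normc_def /= sqr_sqrtr // addr_ge0 ?sqr_ge0. Qed.

Lemma cabs_sum I (r : seq I) (P : pred I) (F : I -> C) :
  cabs (\sum_(i <- r | P i) F i) <= \sum_(i <- r | P i) cabs (F i).
Proof.
elim/big_rec2: _ => [|i x y _ h]; first by rewrite cabs0.
by apply: le_trans (cabsD _ _) _; rewrite lerD2l.
Qed.

Lemma cabs_eq0 z : cabs z = 0 -> z = 0.
Proof. by move=> h; apply/eqP; rewrite -normr_eq0 cabsE h. Qed.

(** This class is stable under products, shifts, Cauchy products and stable recurrences, and every
    sequence in it is summable; it carries all exchanges of sums in the proof. *)
Definition geo f := exists K r : R,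
  [/\ 0 <= K, 0 <= r, r < 1 & forall n, cabs (f n) <= K * r ^+ n].

Lemma eq_geo f g : f =1 g -> geo f -> geo g.
Proof. by move=> e; have -> : g = f by apply/funext => n; rewrite e. Qed.

Lemma geo0 : geo (fun=> 0).
Proof.
by exists 0, 0; split => // n; rewrite ?ltr01 // cabs0 mul0r.
Qed.

Lemma geoD f g : geo f -> geo g -> geo (fun n => f n + g n).
Proof.
move=> [K [r [K0 r0 r1 hf]]] [L [s [L0 s0 s1 hg]]].
exists (K + L), (Num.max r s); split; rewrite ?addr_ge0 ?le_max ?r0 ?gt_max ?r1 //.
move=> n; apply: le_trans (cabsD _ _) _; rewrite mulrDl.
apply: lerD; [apply: le_trans (hf n) _|apply: le_trans (hg n) _];
  by rewrite ler_wpM2l // lerXn2r ?nnegrE ?le_max ?r0 ?lexx ?orbT.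
Qed.

Lemma geoMb f g (B : R) : geo f -> (forall n, cabs (g n) <= B) ->
  geo (fun n => f n * g n).
Proof.
move=> [K [r [K0 r0 r1 hf]]] hB.
have B0 : 0 <= B by apply: le_trans (hB 0%N); rewrite cabs_ge0.
exists (K * B), r; split; rewrite ?mulr_ge0 // => n.
by rewrite cabsM mulrAC ler_pM ?cabs_ge0.
Qed.

Lemma geo_bounded f : geo f -> exists B, forall n, cabs (f n) <= B.
Proof.
move=> [K [r [K0 r0 r1 hf]]]; exists K => n; apply: le_trans (hf n) _.
by rewrite ler_piMr // exprn_ile1 // ltW.
Qed.

Lemma geoM f g : geo f -> geo g -> geo (fun n => f n * g n).
Proof. by move=> hf /geo_bounded [B hB]; apply: geoMb hB. Qed.

Lemma geoZ a f : geo f -> geo (fun n => a * f n).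
Proof.
move=> hf; apply: eq_geo (geoMb (g := fun=> a) hf (fun=> lexx _)) => n.
by rewrite mulrC.
Qed.

Lemma geo_conj f : geo f -> geo (fun n => (f n)^*).
Proof.
move=> [K [r [K0 r0 r1 hf]]]; exists K, r; split => // n.
by rewrite cabs_conj.
Qed.

Lemma geo_sum I (r : seq I) (P : pred I) (F : I -> nat -> C) :
  (forall i, P i -> geo (F i)) -> geo (fun n => \sum_(i <- r | P i) F i n).
Proof.
move=> h; elim: r => [|i r ih].
  by apply: eq_geo geo0 => n; rewrite big_nil.
case Pi: (P i).
  by apply: eq_geo (geoD (h i Pi) ih) => n; rewrite big_cons Pi.
by apply: eq_geo ih => n; rewrite big_cons Pi.
Qed.

Lemma geo_shift f k : geo f -> geo (fun n => f (n + k)%N).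
Proof.
move=> [K [r [K0 r0 r1 hf]]]; exists K, r; split => // n.
apply: le_trans (hf _) _; rewrite ler_wpM2l // exprD ler_piMr ?exprn_ge0 //.
by rewrite exprn_ile1 // ltW.
Qed.

Lemma geo_unshift f : geo (fun n => f n.+1) -> geo f.
Proof.
move=> [K [r [K0 r0 r1 hf]]].
(* Keeping the ratio [t] at least [1 / 2] gives [K r^n <= 2 K t^(n+1)], even when [r] is zero. *)
exists (cabs (f 0%N) + 2 * K), (Num.max r (1 / 2)).
have hr : r <= Num.max r (1 / 2) by rewrite le_max lexx.
have hh : 1 / 2 <= Num.max r (1 / 2) by rewrite le_max lexx orbT.
have h2 : (0 : R) < 2 by [].
have h0 : 0 <= Num.max r (1 / 2) by apply: le_trans hr.
split => //.
- by rewrite addr_ge0 ?cabs_ge0 ?mulr_ge0.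
- by rewrite gt_max r1 ltr_pdivrMr // mul1r (ltr_nat _ 1 2).
- case=> [|n]; first by rewrite expr0 mulr1 lerDl mulr_ge0.
  apply: le_trans (hf n) _; rewrite exprS mulrDl -[leLHS]add0r lerD //.
    by rewrite !mulr_ge0 ?cabs_ge0 ?exprn_ge0.
  rewrite [2 * K]mulrC -mulrA ler_wpM2l // mulrA -[leLHS]mul1r.
  rewrite ler_pM ?exprn_ge0 //; last by rewrite lerXn2r ?nnegrE.
  by move: hh; rewrite ler_pdivrMr // mulrC.
Qed.

Lemma geo_expr z : `|z| < 1 -> geo (fun n => z ^+ n).
Proof.
rewrite cabsE -[1]/(1%:C%C) ltcR => h; exists 1, (cabs z).
by split; rewrite ?cabs_ge0 // => n; rewrite cabsX mul1r.
Qed.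

(* Writing r = q^2, n r^n = (n q^n) q^n and n q^n <= sum_(k < n) q^k <= 1/(1-q). *)
Lemma natmul_expr_le (q : R) n : 0 <= q -> q < 1 -> n%:R * q ^+ n <= (1 - q)^-1.
Proof.
move=> q0 q1; have d0 : 0 < 1 - q by rewrite subr_gt0.
rewrite -[leRHS]mul1r ler_pdivlMr //.
apply: le_trans (_ : (\sum_(k < n) q ^+ k) * (1 - q) <= 1).
  apply: ler_wpM2r; first exact: ltW.
  rewrite mulr_natl -[n in _ *+ n]card_ord -sumr_const.
  by apply: ler_sum => k _; rewrite ler_wiXn2l // ?(ltW q1) // ltnW.
by rewrite mulrC -opprB mulNr -subrX1 opprB lerBlDr lerDl exprn_ge0.
Qed.

Lemma geo_conv f g : geo f -> geo g ->
  geo (fun n => \sum_(k < n.+1) f k * g (n - k)%N).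
Proof.
move=> [K [r [K0 r0 r1 hf]]] [L [s [L0 s0 s1 hg]]].
pose t := Num.max r s.
have rt : r <= t by rewrite le_max lexx.
have st : s <= t by rewrite le_max lexx orbT.
have t0 : 0 <= t by apply: le_trans rt.
have t1 : t < 1 by rewrite gt_max r1.
(* The [n + 1] terms of the convolution cost a linear factor, absorbed by giving up half of the
   decay: [t^n = q^n q^n] and [(n + 1) q^n] is bounded. *)
pose q := Num.sqrt t.
have q2 : q ^+ 2 = t by rewrite sqr_sqrtr.
have q0 : 0 <= q by rewrite sqrtr_ge0.
have q1 : q < 1 by rewrite -sqrtr1 ltr_sqrt.
have d0 : 0 < 1 - q by rewrite subr_gt0.
exists (K * L * (1 + (1 - q)^-1)), q; split => //.
  by rewrite !mulr_ge0 // addr_ge0 // invr_ge0 ltW.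
move=> n; apply: le_trans (cabs_sum _ _ _) _.
apply: le_trans (_ : \sum_(k < n.+1) K * L * t ^+ n <= _).
  apply: ler_sum => k _; rewrite cabsM.
  have -> : t ^+ n = t ^+ k * t ^+ (n - k) by rewrite -exprD subnKC // -ltnS.
  rewrite mulrACA ler_pM ?cabs_ge0 //.
    by apply: le_trans (hf _) _; rewrite ler_wpM2l // lerXn2r ?nnegrE.
  by apply: le_trans (hg _) _; rewrite ler_wpM2l // lerXn2r ?nnegrE.
rewrite sumr_const card_ord -mulr_natr -!mulrA ler_wpM2l // ler_wpM2l //.
rewrite -q2 exprAC expr2 -mulrA mulrC ler_wpM2r ?exprn_ge0 //.
rewrite -natr1 mulrDr mulr1 addrC lerD //.
  by rewrite exprn_ile1 // ltW.
by rewrite mulrC natmul_expr_le.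
Qed.

(** Variation of constants: [f] is a power of [z] plus the convolution of [g] with the powers of
    [z]. *)
Lemma geo_recur z f g : `|z| < 1 -> geo g ->
  (forall n, f n.+1 = z * f n + g n) -> geo f.
Proof.
move=> hz hg hf.
have e n : f n.+1 = z ^+ n.+1 * f 0%N + \sum_(k < n.+1) g k * z ^+ (n - k).
  elim: n => [|n ih]; first by rewrite hf big_ord1 mulr1.
  rewrite hf ih [in RHS]big_ord_recr /= subnn mulr1 mulrDr mulrA -exprS -addrA.
  congr (_ + (_ + _)); rewrite mulr_sumr; apply: eq_bigr => k _.
  by rewrite mulrCA -exprS subSn // -ltnS.
apply: geo_unshift; apply: eq_geo (fun n => esym (e n)) _; apply: geoD.
  apply: eq_geo (geoZ (z * f 0%N) (geo_expr hz)) => n.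
  by rewrite exprS mulrAC.
by apply: geo_conv => //; apply: geo_expr.
Qed.

(** Convergence by real and imaginary parts matches [csum], which sums the two parts separately. *)
Definition ccvg (s : nat -> C) (l : C) : Prop :=
  ((fun n => complex.Re (s n)) @ \oo --> complex.Re l)%classic /\
  ((fun n => complex.Im (s n)) @ \oo --> complex.Im l)%classic.

Lemma eq_ccvg s t l : s =1 t -> ccvg s l -> ccvg t l.
Proof. by move=> e; have -> : t = s by apply/funext => n; rewrite e. Qed.

Lemma ccvg_cst l : ccvg (fun=> l) l.
Proof. by split; apply: cvg_cst. Qed.

Lemma ccvgD s t l m : ccvg s l -> ccvg t m -> ccvg (fun n => s n + t n) (l + m).
Proof.
move=> [s1 s2] [t1 t2]; split.
  rewrite cReD; under eq_fun do rewrite cReD; exact: cvgD.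
rewrite cImD; under eq_fun do rewrite cImD; exact: cvgD.
Qed.

Lemma ccvgM s t l m : ccvg s l -> ccvg t m -> ccvg (fun n => s n * t n) (l * m).
Proof.
move=> [s1 s2] [t1 t2]; split.
  rewrite cReM; under eq_fun do rewrite cReM; apply: cvgB; exact: cvgM.
rewrite cImM; under eq_fun do rewrite cImM; apply: cvgD; exact: cvgM.
Qed.

Lemma ccvgN s l : ccvg s l -> ccvg (fun n => - s n) (- l).
Proof.
move=> h; rewrite -mulN1r; apply: eq_ccvg (ccvgM (ccvg_cst (-1)) h) => n.
by rewrite mulN1r.
Qed.

Lemma ccvgB s t l m : ccvg s l -> ccvg t m -> ccvg (fun n => s n - t n) (l - m).
Proof. by move=> h1 h2; apply: ccvgD => //; apply: ccvgN. Qed.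

Lemma ccvg_conj s l : ccvg s l -> ccvg (fun n => (s n)^*) l^*.
Proof.
move=> [s1 s2]; split.
  rewrite cRe_conj; under eq_fun do rewrite cRe_conj; exact: s1.
rewrite cIm_conj; under eq_fun do rewrite cIm_conj; exact: cvgN.
Qed.

Lemma ccvg_sum I (r : seq I) (P : pred I) (F : I -> nat -> C) (L : I -> C) :
  (forall i, P i -> ccvg (F i) (L i)) ->
  ccvg (fun n => \sum_(i <- r | P i) F i n) (\sum_(i <- r | P i) L i).
Proof.
move=> h; elim: r => [|i r ih].
  rewrite big_nil; apply: eq_ccvg (ccvg_cst 0) => n; by rewrite big_nil.
rewrite big_cons; case Pi: (P i).
  by apply: eq_ccvg (ccvgD (h i Pi) ih) => n; rewrite big_cons Pi.
by apply: eq_ccvg ih => n; rewrite big_cons Pi.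
Qed.

Lemma ccvg_unique s l m : ccvg s l -> ccvg s m -> l = m.
Proof.
by move=> [a b] [c d]; apply: complex_eq; [apply: cvg_unique a c|apply: cvg_unique b d].
Qed.

Lemma ccvg_shift s l : ccvg s l -> ccvg (fun n => s n.+1) l.
Proof.
move=> [a b]; split.
  by have := a; rewrite -(cvg_shiftS (fun n => complex.Re (s n))).
by have := b; rewrite -(cvg_shiftS (fun n => complex.Im (s n))).
Qed.

Lemma geo_ccvg0 f : geo f -> ccvg f 0.
Proof.
move=> [K [r [K0 r0 r1 hf]]].
have hr : `|r| < 1 by rewrite ger0_norm.
have c0 := cvg_geometric K hr.
have main (u : nat -> R) : (forall n, `|u n| <= cabs (f n)) ->
    (u @ \oo --> (0 : R))%classic.
  move=> hu; apply: (@squeeze_cvgr _ _ _ _ (fun n => - geometric K r n) (geometric K r)) => //.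
    near=> n; rewrite -ler_norml; apply: le_trans (hu n) (hf n).
  by rewrite -oppr0; apply: cvgN.
split; apply: main => n; [exact: le_Re_cabs|exact: le_Im_cabs].
Unshelve. all: end_near.
Qed.

Lemma csumP f l : ccvg (fun n => \sum_(k < n) f k) l -> csum f = l.
Proof.
move=> [a b]; rewrite /csum /rsum; apply: complex_eq => /=.
  apply/cvg_lim => //; rewrite [X in (X @ _ --> _)%classic](_ : _ = (fun n => complex.Re (\sum_(k < n) f k))) //.
  by apply/funext => n; rewrite /series /= big_mkord cRe_sum.
apply/cvg_lim => //; rewrite [X in (X @ _ --> _)%classic](_ : _ = (fun n => complex.Im (\sum_(k < n) f k))) //.
by apply/funext => n; rewrite /series /= big_mkord cIm_sum.
Qed.

Lemma geo_summable f : geo f -> ccvg (fun n => \sum_(k < n) f k) (csum f).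
Proof.
move=> [K [r [K0 r0 r1 hf]]].
have hr : `|r| < 1 by rewrite ger0_norm.
have main (u : nat -> R) : (forall n, `|u n| <= cabs (f n)) ->
    cvgn (series u).
  move=> hu; apply: normed_cvg.
  apply: (@series_le_cvg _ _ (geometric K r)) => [n|n|n|] //=.
  - by rewrite mulr_ge0 ?exprn_ge0.
  - exact: le_trans (hu n) (hf n).
  - exact: is_cvg_geometric_series.
split => /=.
  have := main (fun n => complex.Re (f n)) (fun n => le_Re_cabs _) => h.
  rewrite [X in (X @ _ --> _)%classic](_ : _ = series (fun n => complex.Re (f n))) //.
  by apply/funext => n; rewrite /series /= big_mkord cRe_sum.
have := main (fun n => complex.Im (f n)) (fun n => le_Im_cabs _) => h.
rewrite [X in (X @ _ --> _)%classic](_ : _ = series (fun n => complex.Im (f n))) //.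
by apply/funext => n; rewrite /series /= big_mkord cIm_sum.
Qed.

Lemma eq_csum f g : f =1 g -> csum f = csum g.
Proof. by move=> e; have -> : f = g by apply/funext. Qed.

Lemma csumD f g : geo f -> geo g -> csum (fun n => f n + g n) = csum f + csum g.
Proof.
move=> hf hg; apply: csumP.
apply: eq_ccvg (ccvgD (geo_summable hf) (geo_summable hg)) => n.
by rewrite big_split.
Qed.

Lemma csumZ a f : geo f -> csum (fun n => a * f n) = a * csum f.
Proof.
move=> hf; apply: csumP.
by apply: eq_ccvg (ccvgM (ccvg_cst a) (geo_summable hf)) => n; rewrite mulr_sumr.
Qed.

Lemma csum0 : csum (fun=> 0 : C) = 0.
Proof. by apply: csumP; apply: eq_ccvg (ccvg_cst 0) => n; rewrite big1. Qed.

Lemma csum_conj f : geo f -> csum (fun n => (f n)^*) = (csum f)^*.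
Proof.
move=> hf; apply: csumP; apply: eq_ccvg (ccvg_conj (geo_summable hf)) => n.
by rewrite rmorph_sum.
Qed.

Lemma csum_sum I (r : seq I) (P : pred I) (F : I -> nat -> C) :
  (forall i, P i -> geo (F i)) ->
  csum (fun n => \sum_(i <- r | P i) F i n) = \sum_(i <- r | P i) csum (F i).
Proof.
move=> h; apply: csumP.
apply: eq_ccvg (ccvg_sum r (fun i Pi => geo_summable (h i Pi))) => n.
by rewrite exchange_big.
Qed.

Lemma csum_recl f : geo f -> csum f = f 0%N + csum (fun n => f n.+1).
Proof.
move=> hf; apply: csumP.
have hf' : geo (fun n => f n.+1).
  by apply: eq_geo (geo_shift 1 hf) => n; rewrite addn1.
have := ccvgD (ccvg_cst (f 0%N)) (geo_summable hf').
move=> h; have [a b] := geo_summable hf.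
have := ccvg_shift (conj a b) => h2.
have e : csum f = f 0%N + csum (fun n => f n.+1).
  apply: ccvg_unique h2 _; apply: eq_ccvg h => n.
  by rewrite big_ord_recl.
by rewrite -e.
Qed.

Lemma csum_delta (f : nat -> C) k : (forall n, n != k -> f n = 0) -> csum f = f k.
Proof.
move=> h; apply: csumP.
have e n : (k < n)%N -> \sum_(i < n) f i = f k.
  move=> kn; rewrite (bigD1 (Ordinal kn)) //= big1 ?addr0 // => i hi.
  by apply: h; apply: contra hi => /eqP hi; apply/eqP/val_inj.
split; apply: cvg_near_cst; near=> n; rewrite e //; near: n; exact: nbhs_infty_gt.
Unshelve. all: end_near.
Qed.

Lemma geo_l2 f : geo f -> hk_l2 f.
Proof.
move=> hf; have [K [r [K0 r0 r1 h]]] := geoM hf hf.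
have hr : `|r| < 1 by rewrite ger0_norm.
apply: (@series_le_cvg _ _ (geometric K r)) => [n|n|n|] //=.
- by rewrite addr_ge0 ?sqr_ge0.
- by rewrite mulr_ge0 ?exprn_ge0.
- by have := h n; rewrite cabsM -expr2 cabs_sqr.
- exact: is_cvg_geometric_series.
Qed.

(** This is how square summability of an argument of [H_u] is used: the product of a bounded
    sequence with a geometrically decaying symbol is summable. *)
Lemma l2_bounded f : hk_l2 f -> exists B, forall n, cabs (f n) <= B.
Proof.
move=> /cvg_series_bounded /bounded_fun_has_ubound [B hB].
exists (Num.max B 1) => n.
have h : cabs (f n) ^+ 2 <= Num.max B 1.
  by rewrite cabs_sqr le_max; apply/orP; left; apply: hB; exists n.
have [h1|h1] := leP (cabs (f n)) 1; first by rewrite le_max h1 orbT.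
apply: le_trans h; rewrite expr2 ler_peMl ?cabs_ge0 //; exact: ltW.
Qed.

End ComplexSequences.

(** * Matrix sequences, linear recurrences and companion matrices *)

Section MatrixSequences.
Variable R : realType.
Local Notation C := (R[i]).

Definition cj m n (M : 'M[C]_(m, n)) : 'M[C]_(m, n) := map_mx Num.conj M.
Definition ct m n (M : 'M[C]_(m, n)) : 'M[C]_(n, m) := (cj M)^T.

Lemma cjE m n (M : 'M[C]_(m, n)) i j : cj M i j = (M i j)^*.
Proof. by rewrite mxE. Qed.
Lemma ctE m n (M : 'M[C]_(m, n)) i j : ct M i j = (M j i)^*.
Proof. by rewrite !mxE. Qed.
Lemma cjK m n (M : 'M[C]_(m, n)) : cj (cj M) = M.
Proof. by apply/matrixP => i j; rewrite !mxE conjCK. Qed.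
Lemma ctK m n (M : 'M[C]_(m, n)) : ct (ct M) = M.
Proof. by apply/matrixP => i j; rewrite !mxE conjCK. Qed.
Lemma cjM m n p (A : 'M[C]_(m, n)) (B : 'M[C]_(n, p)) : cj (A *m B) = cj A *m cj B.
Proof. by rewrite /cj map_mxM. Qed.
Lemma ctM m n p (A : 'M[C]_(m, n)) (B : 'M[C]_(n, p)) : ct (A *m B) = ct B *m ct A.
Proof. by rewrite /ct cjM trmx_mul. Qed.
Lemma cj1 n : cj (1%:M : 'M[C]_n) = 1%:M. Proof. by rewrite /cj map_mx1. Qed.
Lemma ct1 n : ct (1%:M : 'M[C]_n) = 1%:M. Proof. by rewrite /ct cj1 trmx1. Qed.
Lemma cjD m n (A B : 'M[C]_(m, n)) : cj (A + B) = cj A + cj B.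
Proof. by rewrite /cj map_mxD. Qed.
Lemma cjB m n (A B : 'M[C]_(m, n)) : cj (A - B) = cj A - cj B.
Proof. by rewrite /cj map_mxB. Qed.
Lemma ctB m n (A B : 'M[C]_(m, n)) : ct (A - B) = ct A - ct B.
Proof. by rewrite /ct cjB linearB. Qed.
Lemma cjZ m n a (A : 'M[C]_(m, n)) : cj (a *: A) = a^* *: cj A.
Proof. by rewrite /cj map_mxZ. Qed.
Lemma ctZ m n a (A : 'M[C]_(m, n)) : ct (a *: A) = a^* *: ct A.
Proof. by rewrite /ct cjZ linearZ. Qed.
Lemma cj_tr m n (A : 'M[C]_(m, n)) : cj A^T = (cj A)^T.
Proof. by rewrite /cj map_trmx. Qed.
Lemma ct_tr m n (A : 'M[C]_(m, n)) : ct A^T = cj A.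
Proof. by rewrite /ct cj_tr trmxK. Qed.
Lemma ct_cj m n (A : 'M[C]_(m, n)) : ct (cj A) = A^T.
Proof. by rewrite /ct cjK. Qed.
Lemma cj_ct m n (A : 'M[C]_(m, n)) : cj (ct A) = A^T.
Proof. by rewrite /ct cj_tr cjK. Qed.
Lemma tr_ct m n (A : 'M[C]_(m, n)) : (ct A)^T = cj A.
Proof. by rewrite /ct trmxK. Qed.
Definition mgeo m n (M : nat -> 'M[C]_(m, n)) :=
  forall i j, geo (fun k => M k i j).
Definition msum m n (M : nat -> 'M[C]_(m, n)) : 'M[C]_(m, n) :=
  \matrix_(i, j) csum (fun k => M k i j).

Lemma eq_mgeo m n (M M' : nat -> 'M[C]_(m, n)) : M =1 M' -> mgeo M -> mgeo M'.
Proof. by move=> e h i j; apply: eq_geo (h i j) => k; rewrite e. Qed.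

Lemma eq_msum m n (M M' : nat -> 'M[C]_(m, n)) : M =1 M' -> msum M = msum M'.
Proof. by move=> e; have -> : M = M' by apply/funext. Qed.

Lemma mgeoM m n p (M : nat -> 'M[C]_(m, n)) (M' : nat -> 'M[C]_(n, p)) :
  mgeo M -> mgeo M' -> mgeo (fun k => M k *m M' k).
Proof.
move=> h h' i j.
apply: eq_geo (geo_sum (index_enum _) (P := xpredT) (fun l _ => geoM (h i l) (h' l j))) => k.
by rewrite mxE.
Qed.

Lemma mgeo_mull m n p (A : 'M[C]_(m, n)) (M : nat -> 'M[C]_(n, p)) :
  mgeo M -> mgeo (fun k => A *m M k).
Proof.
move=> h i j.
apply: eq_geo (geo_sum (index_enum _) (P := xpredT) (fun l _ => geoZ (A i l) (h l j))) => k.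
by rewrite mxE.
Qed.

Lemma mgeo_tr m n (M : nat -> 'M[C]_(m, n)) : mgeo M -> mgeo (fun k => (M k)^T).
Proof. by move=> h i j; apply: eq_geo (h j i) => k; rewrite mxE. Qed.

Lemma mgeo_cj m n (M : nat -> 'M[C]_(m, n)) : mgeo M -> mgeo (fun k => cj (M k)).
Proof. by move=> h i j; apply: eq_geo (geo_conj (h i j)) => k; rewrite mxE. Qed.

Lemma mgeo_ct m n (M : nat -> 'M[C]_(m, n)) : mgeo M -> mgeo (fun k => ct (M k)).
Proof. by move=> h; apply: mgeo_tr; apply: mgeo_cj. Qed.

Lemma mgeo_mulr m n p (A : 'M[C]_(n, p)) (M : nat -> 'M[C]_(m, n)) :
  mgeo M -> mgeo (fun k => M k *m A).
Proof.
move=> h; apply: eq_mgeo (mgeo_tr (mgeo_mull A^T (mgeo_tr h))) => k.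
by rewrite trmx_mul !trmxK.
Qed.

Lemma mgeoD m n (M M' : nat -> 'M[C]_(m, n)) :
  mgeo M -> mgeo M' -> mgeo (fun k => M k + M' k).
Proof. by move=> h h' i j; apply: eq_geo (geoD (h i j) (h' i j)) => k; rewrite mxE. Qed.

Lemma mgeo_shift m n (M : nat -> 'M[C]_(m, n)) l :
  mgeo M -> mgeo (fun k => M (k + l)%N).
Proof. by move=> h i j; apply: geo_shift (h i j). Qed.

Lemma mgeoS m n (M : nat -> 'M[C]_(m, n)) : mgeo M -> mgeo (fun k => M k.+1).
Proof. by move=> h; apply: eq_mgeo (mgeo_shift 1 h) => k; rewrite addn1. Qed.

Lemma msumD m n (M M' : nat -> 'M[C]_(m, n)) : mgeo M -> mgeo M' ->
  msum (fun k => M k + M' k) = msum M + msum M'.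
Proof.
move=> h h'; apply/matrixP => i j; rewrite !mxE -csumD //.
by apply: eq_csum => k; rewrite mxE.
Qed.

Lemma msum_mull m n p (A : 'M[C]_(m, n)) (M : nat -> 'M[C]_(n, p)) : mgeo M ->
  msum (fun k => A *m M k) = A *m msum M.
Proof.
move=> h; apply/matrixP => i j; rewrite !mxE.
rewrite (eq_csum (g := fun k => \sum_l A i l * M k l j)); last by move=> k; rewrite mxE.
rewrite csum_sum; last by move=> l _; apply: geoZ.
by apply: eq_bigr => l _; rewrite csumZ // mxE.
Qed.

Lemma msum_tr m n (M : nat -> 'M[C]_(m, n)) : msum (fun k => (M k)^T) = (msum M)^T.
Proof. by apply/matrixP => i j; rewrite !mxE; apply: eq_csum => k; rewrite mxE. Qed.

Lemma msum_mulr m n p (A : 'M[C]_(n, p)) (M : nat -> 'M[C]_(m, n)) : mgeo M ->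
  msum (fun k => M k *m A) = msum M *m A.
Proof.
move=> h; apply: trmx_inj; rewrite trmx_mul -msum_tr -msum_tr -msum_mull; last exact: mgeo_tr.
by apply: eq_msum => k; rewrite trmx_mul.
Qed.

Lemma msum_cj m n (M : nat -> 'M[C]_(m, n)) : mgeo M ->
  msum (fun k => cj (M k)) = cj (msum M).
Proof.
move=> h; apply/matrixP => i j; rewrite !mxE -csum_conj //.
by apply: eq_csum => k; rewrite mxE.
Qed.

Lemma msum_recl m n (M : nat -> 'M[C]_(m, n)) : mgeo M ->
  msum M = M 0%N + msum (fun k => M k.+1).
Proof. by move=> h; apply/matrixP => i j; rewrite !mxE csum_recl. Qed.

(** The uniqueness principle for fixed points of stable maps: iterating the fixed-point equation
    writes the same matrix as each term of a decaying sequence. *)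
Lemma mgeo_eq0 m n (A : 'M[C]_(m, n)) (M : nat -> 'M[C]_(m, n)) :
  mgeo M -> (forall k, M k = A) -> A = 0.
Proof.
move=> h e; apply/matrixP => i j; rewrite mxE.
apply: (ccvg_unique (s := fun=> A i j)); first exact: ccvg_cst.
by apply: eq_ccvg (geo_ccvg0 (h i j)) => k; rewrite e.
Qed.

Lemma unitmx_row_inj n (A : 'M[C]_n) :
  (forall v : 'rV_n, v *m A = 0 -> v = 0) -> A \in unitmx.
Proof.
move=> h; rewrite -row_free_unit -kermx_eq0; apply/eqP/row_matrixP => i.
by rewrite row0; apply: h; rewrite -row_mul mulmx_ker row0.
Qed.

Lemma unitmx_col_inj n (A : 'M[C]_n) :
  (forall v : 'cV_n, A *m v = 0 -> v = 0) -> A \in unitmx.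
Proof.
move=> h; rewrite -unitmx_tr; apply: unitmx_row_inj => v hv.
by apply: trmx_inj; rewrite trmx0; apply: h; apply: trmx_inj; rewrite trmx_mul trmxK hv trmx0.
Qed.

(** A row fixed by [A] is fixed by all its powers, hence zero. *)
Lemma geo_powers_unit n (A : 'M[C]_n) : mgeo (fun k => A ^+ k) -> 1%:M - A \in unitmx.
Proof.
move=> h; apply: unitmx_row_inj => v.
rewrite mulmxBr mulmx1 => /eqP; rewrite subr_eq0 => /eqP hv.
apply: (mgeo_eq0 (mgeo_mull v h)) => k.
elim: k => [|k ih]; first by rewrite expr0 mulmx1.
by rewrite exprS -mulmxE mulmxA -hv.
Qed.

Lemma msum_powers n (A : 'M[C]_n) : mgeo (fun k => A ^+ k) ->
  msum (fun k => A ^+ k) = invmx (1%:M - A).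
Proof.
move=> h; have u := geo_powers_unit h.
have e : msum (fun k => A ^+ k) *m (1%:M - A) = 1%:M.
  rewrite mulmxBr mulmx1 {1}(msum_recl h) expr0.
  rewrite (eq_msum (M' := fun k => A ^+ k *m A)); last by move=> k; rewrite exprSr -mulmxE.
  by rewrite msum_mulr // addrK.
by rewrite -[LHS]mulmx1 -[X in _ *m X](mulmxV u) mulmxA e mul1mx.
Qed.

(* [P] of the left shift: [pact P w = 0] is a linear recurrence for [w]. *)
Definition pact (P : {poly C}) (w : nat -> C) (n : nat) : C :=
  \sum_(k < size P) P`_k * w (n + k)%N.

Lemma pactE d (P : {poly C}) w n : (size P <= d)%N ->
  pact P w n = \sum_(k < d) P`_k * w (n + k)%N.
Proof.
move=> h; rewrite /pact (big_ord_widen _ (fun k => P`_k * w (n + k)%N) h).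
rewrite big_mkcond; apply: eq_bigr => k _.
by case: ifPn => // hk; rewrite nth_default ?mul0r // leqNgt.
Qed.

Lemma pactD P Q w n : pact (P + Q) w n = pact P w n + pact Q w n.
Proof.
rewrite !(@pactE (maxn (size P) (size Q))) ?size_polyD ?leq_maxl ?leq_maxr //.
by rewrite -big_split /=; apply: eq_bigr => k _; rewrite coefD mulrDl.
Qed.

Lemma pactC a w n : pact a%:P w n = a * w n.
Proof. by rewrite (@pactE 1) ?size_polyC_leq1 // big_ord1 coefC addn0. Qed.

Lemma pactMX (P : {poly C}) w n : pact (P * 'X) w n = pact P w n.+1.
Proof.
have hs : (size (P * 'X)%R <= (size P).+1)%N.
  by apply: leq_trans (size_polyMleq _ _) _; rewrite size_polyX addn2.
rewrite (@pactE (size P).+1) // big_ord_recl coefMX /= mul0r add0r.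
rewrite /pact; apply: eq_bigr => k _.
by rewrite /bump /= add1n coefMX /= addnS.
Qed.

Lemma pact_ext P w w' n : w =1 w' -> pact P w n = pact P w' n.
Proof. by move=> e; apply: eq_bigr => k _; rewrite e. Qed.

Lemma pactZ a P w n : pact (a *: P) w n = a * pact P w n.
Proof.
rewrite (@pactE (size P)) ?size_scale_leq // mulr_sumr.
by apply: eq_bigr => k _; rewrite coefZ mulrA.
Qed.

(** Sequences form a module over polynomials through the left shift, so a recurrence can be factored
    along the roots of its polynomial. *)
Lemma pactM (P Q : {poly C}) w n : pact (P * Q) w n = pact P (pact Q w) n.
Proof.
elim/poly_ind: P n => [|P a ih] n; first by rewrite mul0r /pact size_poly0 !big_ord0.
by rewrite mulrDl !pactD mul_polyC pactZ pactC [P * 'X * Q]mulrAC !pactMX ih.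
Qed.

Lemma pact_XsubC z w n : pact ('X - z%:P) w n = w n.+1 - z * w n.
Proof.
have -> : 'X - z%:P = 1%:P * 'X + (- z)%:P by rewrite mul1r polyCN.
by rewrite pactD pactMX !pactC mul1r mulNr.
Qed.

(** One root is removed at a time: the action of the remaining factors satisfies a first-order
    recurrence with a decaying source, which is [geo_recur]. *)
Lemma geo_pact_prod (rs : seq C) w : (forall z, z \in rs -> `|z| < 1) ->
  geo (pact (\prod_(z <- rs) ('X - z%:P)) w) -> geo w.
Proof.
elim: rs w => [|z rs ih] w hrs; first by rewrite big_nil; apply: eq_geo => n; rewrite pactC mul1r.
rewrite big_cons => h; apply: ih; first by move=> y hy; apply: hrs; rewrite inE hy orbT.
apply: geo_recur (hrs z (mem_head _ _)) h _ => n.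
by rewrite pactM pact_XsubC addrC subrK.
Qed.

Lemma stable_geo (P : {poly C}) w : P \is monic -> (forall z, root P z -> `|z| < 1) ->
  (forall n, pact P w n = 0) -> geo w.
Proof.
move=> mP hP h; have [rs e] := closed_field_poly_normal P.
move: e; rewrite (monicP mP) scale1r => e.
apply: (@geo_pact_prod rs).
  by move=> z hz; apply: hP; rewrite e root_prod_XsubC.
by rewrite -e; apply: eq_geo (geo0 R) => n; rewrite h.
Qed.

Lemma pact_horner_mx n (A : 'M[C]_n.+1) P i j k :
  pact P (fun l => (A ^+ l) i j) k = (A ^+ k *m horner_mx A P) i j.
Proof.
elim/poly_ind: P k => [|P a ih] k; first by rewrite raddf0 mulmx0 /pact size_poly0 big_ord0 mxE.
rewrite pactD pactMX ih pactC rmorphD rmorphM /= horner_mx_X horner_mx_C mulmxDr [RHS]mxE.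
congr (_ + _); last by rewrite mul_mx_scalar mxE.
have := comm_horner_mx2 A P 'X; rewrite horner_mx_X => ->.
by rewrite exprSr -!mulmxE mulmxA.
Qed.

(** By Cayley-Hamilton each entry of [A ^+ k] satisfies the recurrence of the characteristic
    polynomial, so eigenvalues inside the disc give decay without any norm estimate. *)
Lemma stable_powers_geo n (A : 'M[C]_n.+1) :
  (forall z, root (char_poly A) z -> `|z| < 1) -> mgeo (fun k => A ^+ k).
Proof.
move=> h i j; apply: stable_geo (char_poly_monic A) h _ => k.
by rewrite pact_horner_mx Cayley_Hamilton mulmx0 mxE.
Qed.

(** The companion matrix acting on windows of [d] consecutive values: the upper rows shift the
    window and the last row applies the recurrence of the monic polynomial [P]. *)
Definition cmpmx d (P : {poly C}) : 'M[C]_d :=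
  \matrix_(i, j) if i == d.-1 :> nat then - P`_j else (i.+1 == j)%:R.

Lemma char_poly_cmpmx d (P : {poly C}) : P \is monic -> size P = d.+1 ->
  char_poly (cmpmx d P) = P.
Proof.
move=> mP sP; have e : d = (size P).-1 by rewrite sP.
move: {sP} mP; rewrite {}e => mP.
exact: companionmxK.
Qed.

Definition state d (w : nat -> C) (k : nat) : 'cV[C]_d := \col_i w (k + i)%N.

Lemma cmpmx_state n (P : {poly C}) w k : P \is monic -> size P = n.+2 ->
  (forall m, pact P w m = 0) -> cmpmx n.+1 P *m state n.+1 w k = state n.+1 w k.+1.
Proof.
move=> mP sP h; apply/colP => i; rewrite !mxE.
case: (boolP (i == n :> nat)) => [/eqP hi|hi].
  have := h k; rewrite (@pactE n.+2) ?sP // big_ord_recr /=.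
  have -> : P`_n.+1 = 1 by have /monicP := mP; rewrite lead_coefE sP.
  rewrite mul1r => /eqP; rewrite addrC addr_eq0 => /eqP e.
  rewrite addSnnS hi /= e -sumrN; apply: eq_bigr => j _.
  by rewrite !mxE hi /= eqxx mulNr.
have hi' : (i.+1 < n.+1)%N by rewrite ltn_neqAle ltn_ord andbT eqSS.
rewrite (bigD1 (Ordinal hi')) //= big1 => [|j hj].
  by rewrite !mxE (negbTE hi) /= eqxx mul1r addr0 addSnnS.
rewrite !mxE (negbTE hi); case: eqP => [e|]; last by rewrite mul0r.
by case/eqP: hj; apply: val_inj.
Qed.

Lemma cmpmx_stateX n (P : {poly C}) w k l : P \is monic -> size P = n.+2 ->
  (forall m, pact P w m = 0) -> cmpmx n.+1 P ^+ l *m state n.+1 w k = state n.+1 w (k + l).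
Proof.
move=> mP sP h; elim: l => [|l ih]; first by rewrite expr0 mul1mx addn0.
by rewrite exprS -mulmxE -mulmxA ih cmpmx_state // addnS.
Qed.

End MatrixSequences.

(** * Takagi form of a Hankel operator *)

(** Orders identify indices: this matches two lists of eigenvalues, interlaced sequences, and the
    roots at neighbouring parameters. *)
Lemma incr_ord_id N (h : 'I_N -> 'I_N) :
  (forall i j : 'I_N, (i < j)%N -> (h i < h j)%N) -> forall i, h i = i.
Proof.
have ge (g : 'I_N -> 'I_N) : (forall i j : 'I_N, (i < j)%N -> (g i < g j)%N) ->
    forall i : 'I_N, (i <= g i)%N.
  move=> hg [i hi]; elim: i hi => [//|i ih] hi.
  have hi' : (i < N)%N by apply: ltnW.
  apply: leq_ltn_trans (ih hi') _; exact: hg.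
move=> hh i; apply/val_inj/eqP; rewrite eqn_leq (ge h hh i) andbT.
(* The upper bound on [h i] is the lower bound for [h] conjugated by order reversal. *)
have := ge (fun i => rev_ord (h (rev_ord i))) _ (rev_ord i).
rewrite rev_ordK /= => H; have {H} : (N - i.+1 <= N - (h i).+1)%N.
  apply: H => a b ab /=.
  have /= h1 := hh (rev_ord b) (rev_ord a); have h2 := ltn_ord (h (rev_ord a)).
  have h4 := ltn_ord b; have /h1 : (N - b.+1 < N - a.+1)%N by lia.
  by move: h2; lia.
have := ltn_ord i; have := ltn_ord (h i); lia.
Qed.

Section Takagi.
Variable R : realType.
Local Notation C := (R[i]).

Lemma decr_lt N (f : 'I_N -> R) i j :
  (forall i j : 'I_N, (i < j)%N -> f j < f i) -> f i < f j -> (j < i)%N.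
Proof.
move=> hf; apply: contraTT; rewrite -leqNgt -leNgt leq_eqVlt => /orP[/eqP e|/hf/ltW //].
by rewrite (val_inj e).
Qed.

Lemma decr_image_eq N (f g : 'I_N -> R) :
  (forall i j : 'I_N, (i < j)%N -> f j < f i) ->
  (forall i j : 'I_N, (i < j)%N -> g j < g i) ->
  (forall i, exists j, f i = g j) -> f =1 g.
Proof.
move=> hf hg /choice [h e] i; rewrite e; congr g; apply: incr_ord_id => {}i j ij.
by apply: decr_lt hg _; rewrite -!e; apply: hf.
Qed.

(* The [j]-th column of [Y] is the eigenvector [e_j] with [H_c e_j = lam_j e_j]. *)
Definition takagi N (c : seqC R) (lam : 'I_N -> R) (Y : nat -> 'rV[C]_N) :=
  [/\ mgeo Y, msum (fun k => ct (Y k) *m Y k) = 1%:M &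
      forall n k, c (n + k)%N = \sum_j (lam j)%:C%C * Y n 0 j * Y k 0 j].

Definition comb N (Y : nat -> 'rV[C]_N) (v : 'I_N -> C) : seqC R :=
  fun n => \sum_(j < N) v j * Y n 0 j.

Section TakagiRep.
Variables (N : nat) (c : seqC R) (lam : 'I_N -> R) (Y : nat -> 'rV[C]_N).
Hypothesis H : takagi c lam Y.

Lemma tak_geo j : geo (fun n => Y n 0 j).
Proof. by case: H => h _ _; apply: h. Qed.

Lemma tak_on i j : csum (fun n => (Y n 0 i)^* * Y n 0 j) = (i == j)%:R.
Proof.
case: H => _ /matrixP /(_ i j) h _; move: h; rewrite !mxE => <-.
by apply: eq_csum => n; rewrite !mxE big_ord1 !mxE.
Qed.

Lemma comb_geo v : geo (comb Y v).
Proof. by apply: geo_sum => j _; apply: geoZ; apply: tak_geo. Qed.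

Lemma tak_coef n : c n = \sum_j (lam j)%:C%C * Y 0%N 0 j * Y n 0 j.
Proof. by case: H => _ _ h; rewrite -(h 0%N n). Qed.

Lemma tak_comb : c = comb Y (fun j => (lam j)%:C%C * Y 0%N 0 j).
Proof. by apply/funext => n; rewrite tak_coef. Qed.

Lemma tak_c_geo : geo c.
Proof. by rewrite tak_comb; apply: comb_geo. Qed.

Definition tcoef (h : seqC R) (j : 'I_N) : C :=
  (lam j)%:C%C * csum (fun k => Y k 0 j * (h k)^*).

Lemma hankel_tak h : hk_l2 h -> hankel c h = comb Y (tcoef h).
Proof.
move=> /l2_bounded [B hB]; apply/funext => n; rewrite /hankel /comb.
have g j : geo (fun k => Y k 0 j * (h k)^*).
  by apply: geoMb (tak_geo j) _ => k; rewrite cabs_conj.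
rewrite (eq_csum (g := fun k => \sum_j ((lam j)%:C%C * Y n 0 j) * (Y k 0 j * (h k)^*))).
  rewrite csum_sum; last by move=> j _; apply: geoZ.
  by apply: eq_bigr => j _; rewrite csumZ // /tcoef mulrAC.
move=> k; case: H => _ _ ->; rewrite mulr_suml.
by apply: eq_bigr => j _; rewrite !mulrA.
Qed.

Lemma csum_comb v j : csum (fun k => (Y k 0 j)^* * comb Y v k) = v j.
Proof.
rewrite (eq_csum (g := fun k => \sum_i v i * ((Y k 0 j)^* * Y k 0 i))).
  have g i : geo (fun k => (Y k 0 j)^* * Y k 0 i).
    by apply: geoM (tak_geo i); apply: geo_conj; apply: tak_geo.
  rewrite csum_sum; last by move=> i _; apply: geoZ.
  rewrite (bigD1 j) //= csumZ // tak_on eqxx mulr1 big1 ?addr0 // => i ij.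
  by rewrite csumZ // tak_on eq_sym (negbTE ij) mulr0.
by move=> k; rewrite mulr_sumr; apply: eq_bigr => i _; rewrite mulrCA.
Qed.

Lemma inner_comb v j : hk_inner (comb Y v) (fun n => Y n 0 j) = v j.
Proof. by rewrite -(csum_comb v j); apply: eq_csum => k; rewrite mulrC. Qed.

Lemma comb_inj v w : comb Y v = comb Y w -> v = w.
Proof. by move=> e; apply/funext => j; rewrite -(inner_comb v) e inner_comb. Qed.

Lemma tak_inner v w : hk_inner (comb Y v) (comb Y w) = \sum_j v j * (w j)^*.
Proof.
rewrite /hk_inner (eq_csum (g := fun k => \sum_j (w j)^* * ((Y k 0 j)^* * comb Y v k))).
  have g j : geo (fun k => (Y k 0 j)^* * comb Y v k).
    by apply: geoM (comb_geo v); apply: geo_conj; apply: tak_geo.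
  rewrite csum_sum; last by move=> j _; apply: geoZ.
  by apply: eq_bigr => j _; rewrite csumZ // csum_comb mulrC.
move=> k; rewrite /comb rmorph_sum mulr_sumr; apply: eq_bigr => j _ /=.
by rewrite rmorphM mulrC !mulrA.
Qed.

Lemma hankel_comb v :
  hankel c (comb Y v) = comb Y (fun j => (lam j)%:C%C * (v j)^*).
Proof.
rewrite hankel_tak; last by apply: geo_l2; apply: comb_geo.
congr comb; apply/funext => j; rewrite /tcoef; congr (_ * _).
rewrite -{1}(csum_comb v j) -csum_conj; last first.
  by apply: geoM (comb_geo v); apply: geo_conj; apply: tak_geo.
by apply: eq_csum => k; rewrite rmorphM /= conjCK.
Qed.

Lemma comb_delta j : comb Y (fun i => (i == j)%:R) = fun n => Y n 0 j.
Proof.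
apply/funext => n; rewrite /comb (bigD1 j) //= eqxx mul1r big1 ?addr0 // => i /negbTE ->.
by rewrite mul0r.
Qed.

Lemma comb_scale s v : hk_scale s (comb Y v) = comb Y (fun j => s%:C%C * v j).
Proof. by apply/funext => n; rewrite /hk_scale mulr_sumr; apply: eq_bigr => j _; rewrite mulrA. Qed.

Hypothesis lam0 : forall j, 0 < lam j.
Hypothesis lam_decr : forall i j : 'I_N, (i < j)%N -> lam j < lam i.

Lemma lam_inj : injective lam.
Proof.
move=> i j e; apply: val_inj; case: (ltngtP i j) => // /lam_decr; by rewrite e ltxx.
Qed.

(** [T] only has to agree with [hankel c] on [hk_l2], so the same lemmas apply to [H_u] and to
    [Kop], which is the Hankel operator of the shifted symbol. *)
Variable T : seqC R -> seqC R.
Hypothesis TH : forall h, hk_l2 h -> T h = hankel c h.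

Lemma T_comb v : T (comb Y v) = comb Y (fun j => (lam j)%:C%C * (v j)^*).
Proof. by rewrite TH ?hankel_comb //; apply: geo_l2; apply: comb_geo. Qed.

Lemma T_e j : T (fun n => Y n 0 j) = hk_scale (lam j) (fun n => Y n 0 j).
Proof.
rewrite -comb_delta T_comb comb_scale; congr comb; apply/funext => i.
by case: eqP => [->|]; rewrite ?rmorph1 // rmorph0 !mulr0.
Qed.

Lemma real_conj (x : R) : (x%:C%C : C)^* = x%:C%C.
Proof. by apply: complex_eq; rewrite ?cRe_conj ?cIm_conj /= ?oppr0. Qed.

Lemma T2_comb v : T (T (comb Y v)) = comb Y (fun j => (lam j ^+ 2)%:C%C * v j).
Proof.
rewrite !T_comb; congr comb; apply/funext => j.
by rewrite rmorphM /= conjCK real_conj mulrA -rmorphM /= -expr2.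
Qed.

Lemma tak_eigenvalue s : 0 < s ->
  is_eigenvalue (fun h => T (T h)) s <-> exists j, s = lam j ^+ 2.
Proof.
move=> s0; split; last first.
  move=> [j ->]; exists (fun n => Y n 0 j); split; first exact: geo_l2 (tak_geo j).
  split.
    move=> e; have := tak_on j j; rewrite eqxx (eq_csum (g := fun=> 0)) ?csum0; last first.
      by move=> n; rewrite (congr1 (@^~ n) e) mulr0.
    by move/eqP; rewrite eq_sym oner_eq0.
  rewrite -comb_delta T2_comb comb_scale; congr comb; apply/funext => i.
  by case: eqP => [->|] //; rewrite !mulr0.
move=> [h [hl2 [hn0 e]]].
(* An eigenvector for [s > 0] equals [s^-1 T (T h)], so it lies in the span of the columns of
   [Y]. *)
have [v hv] : exists v, h = comb Y v.
  exists (fun j => (s^-1)%:C%C * tcoef (T h) j).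
  have l2T : hk_l2 (T h) by rewrite TH // hankel_tak //; apply: geo_l2; apply: comb_geo.
  rewrite -comb_scale -hankel_tak // -TH // e; apply/funext => n.
  by rewrite /hk_scale mulrA -rmorphM /= mulVf ?gt_eqF // mul1r.
move: e; rewrite hv T2_comb comb_scale => /comb_inj e.
apply: contrapT => hN; apply: hn0; rewrite hv.
rewrite (_ : v = fun=> 0); first by apply/funext => n; rewrite /comb big1 // => j _; rewrite mul0r.
apply/funext => j; have /(congr1 (@^~ j)) /= := e => /eqP.
rewrite -subr_eq0 -mulrBl mulf_eq0 -rmorphB /= => /orP[/eqP h0|/eqP //].
case: hN; exists j; apply/esym/eqP; rewrite -subr_eq0; apply/eqP.
exact: complexI h0.
Qed.

Lemma tak_ONB : ONB_of_range T (fun j n => Y n 0 j).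
Proof.
split; first by move=> j; exact: geo_l2 (tak_geo j).
split; first by move=> i j; rewrite -comb_delta inner_comb eq_sym.
split.
  move=> j; exists (hk_scale (lam j)^-1 (fun n => Y n 0 j)).
  rewrite -comb_delta comb_scale; split; first exact: geo_l2 (comb_geo _).
  rewrite T_comb; congr comb; apply/funext => i.
  have [->|_] := eqVneq i j; last by rewrite rmorphM /= rmorph0 !mulr0.
  by rewrite rmorphM /= rmorph1 mulr1 real_conj -rmorphM /= mulfV ?gt_eqF.
move=> h hl2; exists (tcoef h); rewrite TH // hankel_tak //.
Qed.

(** In the basis [Y] an eigenvector has coordinates with [lam_i conj(v_i) = lam_j v_i]. Comparing
    moduli leaves only [v_j], which is then real; unit norm makes it a sign. Antilinearity is what
    reduces the phase freedom to a sign. *)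
Lemma tak_unique (lam' : 'I_N -> R) (e : 'I_N -> seqC R) :
  (forall j, 0 < lam' j) -> (forall i j : 'I_N, (i < j)%N -> lam' j < lam' i) ->
  (forall s, 0 < s -> (is_eigenvalue (fun h => T (T h)) s <-> exists j, s = lam' j ^+ 2)) ->
  ONB_of_range T e -> (forall j, T (e j) = hk_scale (lam' j) (e j)) ->
  lam' =1 lam /\ forall j, exists s : C, s ^+ 2 = 1 /\ e j = fun n => s * Y n 0 j.
Proof.
move=> l0 ldec hev [el2 [eon [eran _]]] heig.
have hl : lam' =1 lam.
  apply: decr_image_eq => // i.
  have p2 : 0 < lam' i ^+ 2 by rewrite exprn_gt0.
  have /tak_eigenvalue [//|j /eqP] : is_eigenvalue (fun h => T (T h)) (lam' i ^+ 2).
    by apply/hev => //; exists i.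
  by rewrite eqrXn2 ?ltW // => /eqP ->; exists j.
split => // j; have [h [hl2 he]] := eran j.
have [v ev] : exists v, e j = comb Y v by exists (tcoef h); rewrite -he TH // hankel_tak.
have := heig j; rewrite ev T_comb comb_scale hl => /comb_inj /funeqP ve.
have v0 i : i != j -> v i = 0.
  move=> ij; apply: cabs_eq0.
  have := congr1 (@cabs R) (ve i); rewrite !cabsM cabs_conj !cabs_real !gtr0_norm // => /eqP.
  rewrite -subr_eq0 -mulrBl mulf_eq0 subr_eq0 => /orP[/eqP /lam_inj e'|/eqP //].
  by rewrite e' eqxx in ij.
have vj : (v j)^* = v j.
  by have := ve j; apply: mulfI; rewrite -[0]/(0%:C)%C (inj_eq (@complexI R)) gt_eqF.
exists (v j); split.
  have := eon j j; rewrite eqxx ev tak_inner (bigD1 j) //= big1 => [|i ij].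
    by rewrite addr0 vj -expr2.
  by rewrite v0 // mul0r.
apply/funext => n; rewrite /comb (bigD1 j) //= big1 ?addr0 // => i ij.
by rewrite v0 // mul0r.
Qed.

End TakagiRep.

Lemma Kop_hankel (c h : seqC R) : geo c -> hk_l2 h ->
  Kop c h = hankel (fun n => c n.+1) h.
Proof.
move=> gc /l2_bounded [B hB]; apply/funext => n; rewrite /Kop /hankel csum_recl.
  rewrite /= rmorph0 mulr0 add0r; apply: eq_csum => k /=; by rewrite addnS.
have B0 : 0 <= B by apply: le_trans (hB 0%N); rewrite cabs_ge0.
apply: (geoMb (B := B)).
  by apply: eq_geo (geo_shift n gc) => k; rewrite addnC.
by move=> [|k]; rewrite cabs_conj /= ?cabs0.
Qed.

Lemma inner_one (h : seqC R) : hk_inner (hk_one R) h = (h 0%N)^*.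
Proof.
rewrite /hk_inner (csum_delta (k := 0%N)) /hk_one ?eqxx ?mul1r //.
by move=> n /negbTE ->; rewrite mul0r.
Qed.

Lemma inner_scale (c e : seqC R) s : geo c -> geo e ->
  hk_inner c (fun n => s * e n) = s^* * hk_inner c e.
Proof.
move=> gc ge; rewrite /hk_inner -csumZ; last by apply: geoM => //; apply: geo_conj.
by apply: eq_csum => n; rewrite rmorphM /= mulrCA.
Qed.

(** The Takagi forms provide a witness of [chi_spec], and [tak_unique] shows that the value selected
    by [epsilon] differs from it by signs of the vectors, which disappear in the squared inner
    products. *)
Lemma chi_takagi N (c : seqC R) (lam mu : 'I_N -> R) (Y Z : nat -> 'rV[C]_N) :
  takagi c lam Y -> takagi (fun n => c n.+1) mu Z ->
  (forall j, 0 < lam j) -> (forall i j : 'I_N, (i < j)%N -> lam j < lam i) ->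
  (forall j, 0 < mu j) -> (forall i j : 'I_N, (i < j)%N -> mu j < mu i) ->
  chi N c = (fun j => 2 * lam j ^+ 2, fun m => 2 * mu m ^+ 2,
             fun j => phase ((Y 0%N 0 j)^* ^+ 2),
             fun m => phase (hk_inner c (fun n => Z n 0 m) ^+ 2)).
Proof.
move=> HY HZ l0 ld m0 md.
have gc := tak_c_geo HY.
have TK h : hk_l2 h -> Kop c h = hankel (fun n => c n.+1) h by apply: Kop_hankel.
have TH h : hk_l2 h -> hankel c h = hankel c h by [].
set d := (X in chi N c = X).
have spec : chi_spec c d.
  exists lam, mu, (fun j n => Y n 0 j), (fun j n => Z n 0 j).
  split=> //; split=> //; split; first exact: (tak_eigenvalue HY).
  split; first exact: (tak_ONB HY).
  split; first by move=> j; apply: (T_e HY).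
  split=> //; split=> //; split; first exact: (tak_eigenvalue HZ).
  split; first exact: (tak_ONB HZ).
  split; first by move=> j; apply: (T_e HZ).
  by do 3 split => //; move=> j; rewrite inner_one.
have /(ClassicalEpsilon.epsilon_spec (inhabits ((fun=> 0), (fun=> 0), (fun=> 0), (fun=> 0)))) :
  exists d, @chi_spec R N c d by exists d.
rewrite -/(chi N c); case: (chi N c) => [[[Iv Lv] Ph] Th].
move=> [lam' [mu' [e [f [a1 [a2 [a3 [a4 [a5 [b1 [b2 [b3 [b4 [b5 [c1 [c2 [c3 c4]]]]]]]]]]]]]]]]].
have [el he] := tak_unique HY l0 ld TH a1 a2 a3 a4 a5.
have [em hf] := tak_unique HZ m0 md TK b1 b2 b3 b4 b5.
rewrite /d; congr (_, _, _, _); apply/funext => j.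
- by rewrite c1 el.
- by rewrite c2 em.
- rewrite c3; have [s [s2 ->]] := he j.
  by rewrite inner_one rmorphM exprMn -rmorphXn s2 rmorph1 mul1r.
- rewrite c4; have [s [s2 ->]] := hf j.
  by rewrite inner_scale //; [rewrite exprMn -rmorphXn s2 rmorph1 mul1r|apply: (tak_geo HZ)].
Qed.

End Takagi.

(** * Takagi factorization relative to a Gram matrix *)

Section TakagiFactorization.
Variable R : realType.
Local Notation C := (R[i]).

(* In a frame with Gram matrix [G] the antilinear Hankel operator reads
   [w |-> T conj(G w)]; this is its square. *)
Definition hsq n (G T : 'M[C]_n) : 'M[C]_n := T *m cj G *m cj T *m G.
Definition krylov n (A : 'M[C]_n) (v : 'cV[C]_n) : 'M[C]_n :=
  \matrix_(i, k) (A ^+ k *m v) i 0.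
Definition rdiag n (lam : 'I_n -> R) : 'M[C]_n := diag_mx (\row_j (lam j)%:C%C).

Lemma horner_mx_coef n (A : 'M[C]_n.+1) (g : {poly C}) d : (size g <= d)%N ->
  horner_mx A g = \sum_(k < d) g`_k *: A ^+ k.
Proof.
move=> hg; apply/matrixP => i j; rewrite summxE.
have := pact_horner_mx A g i j 0; rewrite expr0 mul1mx => <-.
by rewrite (pactE _ _ hg); apply: eq_bigr => k _; rewrite mxE.
Qed.

(** Invertibility of the Krylov matrix thereby says that no nonzero polynomial of degree at most [n]
    in [A] kills [v]. *)
Lemma horner_krylov n (A : 'M[C]_n.+1) (v : 'cV_n.+1) (g : {poly C}) :
  (size g <= n.+1)%N -> horner_mx A g *m v = krylov A v *m \col_i g`_i.
Proof.
move=> hg; rewrite (horner_mx_coef _ hg) mulmx_suml; apply/colP => i.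
rewrite summxE mxE; apply: eq_bigr => k _.
by rewrite -scalemxAl !mxE mulrC.
Qed.

(** [eigenvalue] provides a row eigenvector; were there no column one, [z - A] would be invertible
    and the row zero. *)
Lemma root_char_col n (A : 'M[C]_n.+1) z : root (char_poly A) z ->
  exists2 w : 'cV_n.+1, w != 0 & A *m w = z *: w.
Proof.
rewrite -eigenvalue_root_char => /eigenvalueP [v hv v0].
apply: contrapT => hN; move: v0; rewrite (_ : v = 0) ?eqxx //.
have u : z%:M - A \in unitmx.
  apply: unitmx_col_inj => w; rewrite mulmxBl mul_scalar_mx => /eqP; rewrite subr_eq0 => /eqP e.
  by apply/eqP; apply: contrapT => /negP w0; apply: hN; exists w.
by rewrite -[v]mulmx1 -(mulmxV u) mulmxA mulmxBr hv mul_mx_scalar subrr mul0mx.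
Qed.

Lemma not_uniq_perm (T : eqType) (rs : seq T) : ~~ uniq rs ->
  exists z rs', perm_eq rs [:: z, z & rs'].
Proof.
elim: rs => [//|x s ih] /=; rewrite negb_and negbK => /orP[xs|/ih [z [s' hp]]].
  by exists x, (rem x s); rewrite perm_cons perm_to_rem.
exists z, (x :: s'); apply: (perm_trans (y := x :: [:: z, z & s'])); first by rewrite perm_cons.
exact/permPl/(perm_catCA [:: x] [:: z; z] s').
Qed.

Lemma real_gt0 (z : C) : 0 < z -> 0 < complex.Re z /\ z = (complex.Re z)%:C%C.
Proof.
rewrite ltcE /= => /andP[/eqP h r]; split => //.
by apply: complex_eq => //=; rewrite h.
Qed.

Lemma exists_decr n (rs : seq R) : size rs = n.+1 -> uniq rs ->
  exists r : 'I_n.+1 -> R, (forall i j : 'I_n.+1, (i < j)%N -> r j < r i) /\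
    forall j, r j \in rs.
Proof.
move=> sr ur; pose s := sort <=%R rs.
have ss : sorted <%R s by rewrite sort_lt_sorted.
have sz : size s = n.+1 by rewrite size_sort.
exists (fun j => nth 0 s (n - j)); split.
  move=> i j ij; rewrite (lt_sorted_ltn_nth 0 ss) ?inE ?sz ?ltnS ?leq_subr //.
  by have := ltn_ord j; lia.
by move=> j; rewrite -(mem_sort <=%R) -/s mem_nth // sz ltnS leq_subr.
Qed.

Section Exists.
Variables (n : nat) (G T : 'M[C]_n.+1) (v : 'cV[C]_n.+1).
Hypothesis G_herm : ct G = G.
Hypothesis G_pos : forall w : 'cV_n.+1, w != 0 -> 0 < (ct w *m G *m w) 0 0.
Hypothesis T_sym : T^T = T.
Hypothesis T_unit : T \in unitmx.
Hypothesis cyc : krylov (hsq G T) v \in unitmx.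
Local Notation Hm := (hsq G T).

Lemma G_unit : G \in unitmx.
Proof.
apply: unitmx_col_inj => w hw; apply/eqP; apply: contraT => /G_pos.
by rewrite -mulmxA hw mulmx0 mxE ltxx.
Qed.

Lemma ct_sym (A : 'M[C]_n.+1) : A^T = A -> ct A = cj A.
Proof. by move=> e; rewrite /ct -cj_tr e. Qed.

Lemma hsq_selfadj : ct Hm *m G = G *m Hm.
Proof.
rewrite /hsq !ctM !ct_cj G_herm (ct_sym T_sym) T_sym.
by rewrite -[in G^T]G_herm tr_ct !mulmxA.
Qed.

Lemma dot_eq0 (w : 'cV_n.+1) : (ct w *m G *m w) 0 0 = 0 -> w = 0.
Proof. by move=> h; apply/eqP; apply: contraT => /G_pos; rewrite h ltxx. Qed.

(** [cj q] is the image of [w] under the antilinear operator, and [z] times the squared [G]-norm of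
    [w] equals the squared norm of that image. *)
Lemma hsq_eig_pos (w : 'cV_n.+1) z : w != 0 -> Hm *m w = z *: w -> 0 < z.
Proof.
move=> w0 hw; pose q := cj T *m G *m w.
have q0 : cj q != 0.
  apply: contra w0 => /eqP h; have : q = 0 by rewrite -[q]cjK h /cj map_mx0.
  have uT : cj T \in unitmx by rewrite /cj map_unitmx.
  rewrite /q => h2; apply/eqP.
  by rewrite -(mul1mx w) -(mulVmx G_unit) -mulmxA -(mul1mx (G *m w)) -(mulVmx uT) -!mulmxA (mulmxA (cj T)) h2 !mulmx0.
have e : ct w *m G *m (Hm *m w) = cj (ct (cj q) *m G *m cj q).
  have -> (x : 'cV[C]_n.+1) : cj (ct (cj x) *m G *m cj x) = ct x *m cj G *m x.
    by rewrite !cjM cjK ct_cj cj_tr.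
  by rewrite /q !ctM G_herm ct_cj T_sym /hsq !mulmxA.
have := congr1 (fun M : 'M[C]_1 => M 0 0) e; rewrite /= hw -scalemxAr [LHS]mxE cjE => e2.
have p1 := G_pos w0; have [q1 q2] := real_gt0 (G_pos q0).
rewrite -(pmulr_lgt0 _ p1) e2 q2 real_conj.
by rewrite -[0]/(0%:C%C) ltcR.
Qed.

Lemma hsq_root_pos z : root (char_poly Hm) z -> 0 < z.
Proof. by move=> /root_char_col [w w0 hw]; apply: hsq_eig_pos w0 hw. Qed.

(** Simplicity combines self-adjointness and cyclicity. For a double root [z], put
    [g = char_poly / (X - z)]. Then [y = g(Hm) v] lies both in the kernel and in the range of the
    self-adjoint [Hm - z], so [y = 0]; but [g] has degree [n], against the invertible Krylov
    matrix. *)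
Lemma hsq_roots : exists rs : seq C,
  [/\ size rs = n.+1, uniq rs & forall z, z \in rs -> root (char_poly Hm) z].
Proof.
have [rs e] := closed_field_poly_normal (char_poly Hm).
move: e; rewrite (monicP (char_poly_monic _)) scale1r => e.
have sz : size rs = n.+1 by have := size_char_poly Hm; rewrite e size_prod_XsubC => -[].
have hroot z : z \in rs -> root (char_poly Hm) z by rewrite e root_prod_XsubC.
exists rs; split => //; apply: contraT => /not_uniq_perm [z [rs' hp]].
have zrs : z \in rs by rewrite (perm_mem hp) mem_head.
have zc : z^* = z.
  by have [_ ->] := real_gt0 (hsq_root_pos (hroot z zrs)); rewrite real_conj.
pose q := \prod_(x <- rs') ('X - x%:P) : {poly C}.
pose g := ('X - z%:P) * q.
have ec : char_poly Hm = ('X - z%:P) * g.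
  by rewrite e (perm_big _ hp) /= !big_cons.
have sg : size g = n.+1.
  have -> : g = \prod_(x <- z :: rs') ('X - x%:P) by rewrite big_cons.
  by rewrite size_prod_XsubC -sz (perm_size hp).
have hz : horner_mx Hm ('X - z%:P) = Hm - z%:M.
  by rewrite rmorphB /= horner_mx_X horner_mx_C.
pose y := horner_mx Hm g *m v.
have y0 : y = 0.
  have y1 : (Hm - z%:M) *m y = 0.
    by rewrite /y mulmxA -hz mulmxE -rmorphM /= -ec Cayley_Hamilton mul0mx.
  have ey : y = (Hm - z%:M) *m (horner_mx Hm q *m v).
    by rewrite /y /g rmorphM /= hz -mulmxE mulmxA.
  have sa : ct (Hm - z%:M) *m G = G *m (Hm - z%:M).
    rewrite ctB mulmxBl hsq_selfadj mulmxBr; congr (_ - _).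
    by rewrite /ct /cj map_scalar_mx /= tr_scalar_mx zc scalar_mxC.
  apply: dot_eq0; rewrite {1}ey ctM -!mulmxA (mulmxA (ct (Hm - _))) sa.
  by rewrite -(mulmxA G) y1 !mulmx0 mxE.
move: y0; rewrite /y horner_krylov ?sg // => h.
have h2 : \col_i g`_i = 0 :> 'cV_n.+1.
  by rewrite -[LHS]mul1mx -(mulVmx cyc) -mulmxA h mulmx0.
have : lead_coef g = 0.
  by rewrite lead_coefE sg /=; have /colP /(_ ord_max) := h2; rewrite !mxE.
by move/eqP; rewrite lead_coef_eq0 -size_poly_eq0 sg.
Qed.

(** For the antilinear [h] with [h (h w) = l^2 w], the vector [h w + l w] is fixed up to the factor
    [l]; it remains to treat its vanishing and to normalize. *)
Lemma takagi_vector (w : 'cV_n.+1) (l : R) : 0 < l -> w != 0 ->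
  Hm *m w = (l ^+ 2)%:C%C *: w ->
  exists e : 'cV_n.+1, (ct e *m G *m e) 0 0 = 1 /\ T *m cj (G *m e) = l%:C%C *: e.
Proof.
move=> l0 w0 hw.
pose h (x : 'cV_n.+1) := T *m cj (G *m x).
have hh x : h (h x) = Hm *m x by rewrite /h !cjM !cjK /hsq !mulmxA.
have hZ a x : h (a *: x) = a^* *: h x by rewrite /h -scalemxAr cjZ -scalemxAr.
have hD x y : h (x + y) = h x + h y by rewrite /h mulmxDr cjD mulmxDr.
have [e0 e00 he0] : exists2 e0, e0 != 0 & h e0 = l%:C%C *: e0.
  have [h0|h0] := eqVneq (h w + l%:C%C *: w) 0.
    (* Here [h w = - l w], and antilinearity turns the sign around:
       [h (i w) = - i h w = l (i w)]. *)
    exists ('i *: w); first by rewrite scaler_eq0 negb_or w0 andbT neq0Ci.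
    rewrite hZ conjCi; move/eqP: h0; rewrite addr_eq0 => /eqP ->.
    by rewrite scalerN scaleNr opprK !scalerA mulrC.
  exists (h w + l%:C%C *: w) => //.
  by rewrite hD hh hw hZ real_conj scalerDr scalerA addrC -rmorphM /= -expr2.
have [a0 ea] := real_gt0 (G_pos e00).
set a := complex.Re _ in a0 ea.
pose s := ((Num.sqrt a)^-1)%:C%C : C.
exists (s *: e0); split.
  rewrite ctZ real_conj -!scalemxAl -scalemxAr scalerA mxE ea /s -!rmorphM /=.
  rewrite -expr2 exprVn sqr_sqrtr ?ltW // mulVf ?gt_eqF //.
by rewrite -/(h _) hZ he0 real_conj !scalerA mulrC.
Qed.

Lemma gram_col (V : 'M[C]_n.+1) i j :
  (ct V *m G *m V) i j = (ct (col i V) *m G *m col j V) 0 0.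
Proof.
have -> : ct (col i V) = row i (ct V) by apply/rowP => k; rewrite !mxE.
by rewrite -row_mul !mxE; apply: eq_bigr => k _; rewrite !mxE.
Qed.

(** Takagi vectors for distinct eigenvalues are [G]-orthogonal, and [T conj(G V) = V Lam] then reads
    [T = V Lam V^T]. A vanishing coordinate of [v] would make a row of [V^-1] kill every Krylov
    column. *)
Lemma takagi_exists : exists (lam : 'I_n.+1 -> R) (V : 'M[C]_n.+1),
  [/\ forall j, 0 < lam j, forall i j : 'I_n.+1, (i < j)%N -> lam j < lam i,
      ct V *m G *m V = 1%:M, T = V *m rdiag lam *m V^T &
      forall j, (invmx V *m v) j 0 != 0].
Proof.
have [rs [srs urs hrs]] := hsq_roots.
have rpos z : z \in rs -> 0 < complex.Re z /\ z = (complex.Re z)%:C%C.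
  by move=> /hrs /hsq_root_pos /real_gt0.
have [r [rdecr rin]] : exists r : 'I_n.+1 -> R,
    (forall i j : 'I_n.+1, (i < j)%N -> r j < r i) /\ forall j, r j \in map (@complex.Re R) rs.
  apply: exists_decr; first by rewrite size_map.
  rewrite map_inj_in_uniq // => x y /rpos [_ ->] /rpos [_ ->] /= ->.
  by [].
have rr j : 0 < r j /\ root (char_poly Hm) (r j)%:C%C.
  have /mapP [z zrs ->] := rin j; have [p e] := rpos z zrs; split => //.
  by rewrite -e; apply: hrs.
pose lam j := Num.sqrt (r j).
have l0 j : 0 < lam j by rewrite sqrtr_gt0; case: (rr j).
have l2 j : lam j ^+ 2 = r j by rewrite sqr_sqrtr // ltW; case: (rr j).
have ldecr (i j : 'I_n.+1) : (i < j)%N -> lam j < lam i.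
  by move=> /rdecr h; rewrite ltr_sqrt; case: (rr i).
have /choice [e he] : forall j, exists e : 'cV_n.+1,
    (ct e *m G *m e) 0 0 = 1 /\ T *m cj (G *m e) = (lam j)%:C%C *: e.
  move=> j; have [_ /root_char_col [w w0 hw]] := rr j.
  by apply: takagi_vector w0 _ => //; rewrite l2.
pose V := (\matrix_(i, j) e j i 0) : 'M[C]_n.+1.
have colV j : col j V = e j by apply/colP => i; rewrite !mxE.
have TV : T *m cj (G *m V) = V *m rdiag lam.
  apply/matrixP => i j; have [_ /colP /(_ i)] := he j.
  rewrite -colV mul_mx_diag !mxE mulrC => <-; apply: eq_bigr => k _.
  by rewrite !mxE; congr (_ * _^*); apply: eq_bigr => m _; rewrite !mxE.
have Hcol j : Hm *m e j = (lam j ^+ 2)%:C%C *: e j.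
  have [_ hj] := he j.
  have -> : Hm *m e j = T *m cj (G *m (T *m cj (G *m e j))) by rewrite !cjM !cjK /hsq !mulmxA.
  by rewrite hj -scalemxAr cjZ -scalemxAr real_conj hj scalerA -rmorphM -expr2.
have VGV : ct V *m G *m V = 1%:M.
  apply/matrixP => i j; rewrite gram_col !colV [RHS]mxE.
  have [<-|ij] := eqVneq i j; first by have [-> _] := he i.
  pose d := (ct (e i) *m G *m e j) 0 0; rewrite -/d.
  have h1 : (ct (e i) *m G *m (Hm *m e j)) 0 0 = (lam j ^+ 2)%:C%C * d.
    by rewrite Hcol -scalemxAr [LHS]mxE.
  have h2 : (ct (e i) *m G *m (Hm *m e j)) 0 0 = (lam i ^+ 2)%:C%C * d.
    rewrite mulmxA -(mulmxA (ct (e i))) -hsq_selfadj mulmxA -ctM Hcol ctZ real_conj.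
    by rewrite -!scalemxAl [LHS]mxE.
  move/eqP: (etrans (esym h1) h2); rewrite -subr_eq0 -mulrBl mulf_eq0 -rmorphB /=.
  rewrite -[X in X || _]/(_%:C%C == 0%:C%C) (inj_eq (@complexI R)) subr_eq0 !l2.
  case/orP=> [/eqP h|/eqP //]; exfalso; move: ij; rewrite -val_eqE neq_ltn.
  by case/orP => /rdecr; rewrite h ltxx.
have [uV _] := mulmx1_unit (mulmx1C VGV).
exists lam, V; split => //.
  have := congr1 (@cj _ _ _) VGV; rewrite !cjM cj_ct cj1 -mulmxA -cjM => h.
  by rewrite -TV -mulmxA (mulmx1C h) mulmx1.
move=> j; apply/eqP => h0.
have HV : invmx V *m Hm = rdiag (fun j => lam j ^+ 2) *m invmx V.
  have h : Hm *m V = V *m rdiag (fun j => lam j ^+ 2).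
    apply/matrixP => a b; have /colP /(_ a) := Hcol b.
    rewrite mul_mx_diag -colV !mxE mulrC => <-; apply: eq_bigr => k _.
    by rewrite !mxE.
  rewrite -[LHS](mulmxK uV) -(mulmxA (invmx V) Hm V) h.
  by rewrite (mulmxA (invmx V) V) (mulVmx uV) mul1mx.
have HVk k : row j (invmx V) *m Hm ^+ k = ((lam j ^+ 2) ^+ k)%:C%C *: row j (invmx V).
  elim: k => [|k ih]; first by rewrite !expr0 mulmx1 scale1r.
  have hrow : row j (invmx V) *m Hm = (lam j ^+ 2)%:C%C *: row j (invmx V).
    by rewrite -row_mul HV; apply/rowP => i; rewrite mxE mul_diag_mx !mxE.
  rewrite exprS -mulmxE mulmxA hrow -scalemxAl ih scalerA.
  by rewrite -rmorphM -exprS.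
have r0 : row j (invmx V) = 0.
  have hk : row j (invmx V) *m krylov Hm v = 0.
    apply/rowP => k; rewrite mxE [RHS]mxE.
    have : (row j (invmx V) *m (Hm ^+ k *m v)) 0 0 = 0.
      rewrite mulmxA HVk -scalemxAl -row_mul !mxE; move: h0; rewrite mxE => ->.
      by rewrite mulr0.
    by rewrite mxE => h1; rewrite -[RHS]h1; apply: eq_bigr => i _; congr (_ * _); rewrite mxE.
  by rewrite -[LHS]mulmx1 -(mulmxV cyc) mulmxA hk mul0mx.
have := congr1 (fun M => (M *m V) 0 j) r0; rewrite /= mul0mx -row_mul mulVmx // !mxE eqxx.
by move/eqP; rewrite oner_eq0.
Qed.

End Exists.
End TakagiFactorization.

(** * Rational symbols *)

Section RationalSymbols.
Variables (R : realType) (n : nat).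
Local Notation C := (R[i]).
Local Notation N := n.+1.
Implicit Types p : 'M[R]_(4, N).

Lemma coef_polyA p m :
  (polyA p)`_m = if insub m is Some j then Complex (p r0 j) (p r1 j) else 0.
Proof.
rewrite /polyA coef_sum; case: insubP => [j jm e|hm].
  rewrite (bigD1 j) //= coefCM coefXn e eqxx mulr1 big1 ?addr0 // => i ij.
  rewrite coefCM coefXn; case: eqP => [h|]; last by rewrite mulr0.
  by case/eqP: ij; apply: val_inj; exact/esym/(etrans e h).
rewrite big1 // => i _; rewrite coefCM coefXn; case: eqP => [h|]; last by rewrite mulr0.
by rewrite h ltn_ord in hm.
Qed.

Lemma coef_polyB0 p : (polyB p)`_0 = 1.
Proof.
rewrite /polyB coefD coef1 coef_sum big1 ?addr0 // => i _.
by rewrite coefCM coefXn mulr0.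
Qed.

Lemma coef_polyBS p m :
  (polyB p)`_m.+1 = if insub m is Some j then Complex (p r2 j) (p r3 j) else 0.
Proof.
rewrite /polyB coefD coef1 add0r coef_sum; case: insubP => [j jm e|hm].
  rewrite (bigD1 j) //= coefCM coefXn e eqxx mulr1 big1 ?addr0 // => i ij.
  rewrite coefCM coefXn eqSS; case: eqP => [h|]; last by rewrite mulr0.
  by case/eqP: ij; apply: val_inj; exact/esym/(etrans e h).
rewrite big1 // => i _; rewrite coefCM coefXn eqSS; case: eqP => [h|]; last by rewrite mulr0.
by rewrite h ltn_ord in hm.
Qed.

Lemma size_polyA p : (size (polyA p) <= N)%N.
Proof.
apply/leq_sizeP => m hm; rewrite coef_polyA; case: insubP => // j jm e.
by rewrite ltnNge hm in jm.
Qed.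

Lemma size_polyB p : (size (polyB p) <= N.+1)%N.
Proof.
apply/leq_sizeP => -[//|m] hm; rewrite coef_polyBS; case: insubP => // j jm e.
by rewrite ltnNge -ltnS hm in jm.
Qed.

Lemma size_taylor_seq (A B : {poly C}) m : size (taylor_seq A B m) = m.+1.
Proof. by elim: m => //= m ih; rewrite size_rcons ih. Qed.

Lemma nth_taylor_seq p m i : (i <= m)%N ->
  nth 0 (taylor_seq (polyA p) (polyB p) m) i = ucoef p i.
Proof.
elim: m => [|m ih]; first by rewrite leqn0 => /eqP ->.
rewrite leq_eqVlt => /orP[/eqP -> //|]; rewrite ltnS => hi /=.
by rewrite nth_rcons size_taylor_seq ltnS hi ih.
Qed.

Lemma ucoef_rec p m :
  \sum_(k < m.+1) (polyB p)`_k * ucoef p (m - k)%N = (polyA p)`_m.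
Proof.
rewrite big_ord_recl coef_polyB0 mul1r subn0.
case: m => [|m]; first by rewrite big_ord0 addr0.
rewrite {1}/ucoef /= nth_rcons size_taylor_seq ltnn eqxx.
rewrite (big_addn 0 m.+2 1) big_mkord subn1 /=.
set S := (X in _ - X); suff -> : \sum_(i < m.+1) (polyB p)`_(bump 0 i) * ucoef p (m.+1 - bump 0 i)%N = S.
  by rewrite subrK.
apply: eq_bigr => i _; rewrite /bump /= add1n addn1; congr (_ * _).
by rewrite nth_taylor_seq // subSS leq_subr.
Qed.

Lemma ucoef_unique p (c : nat -> C) :
  (forall m, \sum_(k < m.+1) (polyB p)`_k * c (m - k)%N = (polyA p)`_m) -> c = ucoef p.
Proof.
move=> h; apply/funext => m; elim/ltn_ind: m => m ih.
have := etrans (h m) (esym (ucoef_rec p m)).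
rewrite !big_ord_recl coef_polyB0 !mul1r subn0 => /eqP.
rewrite (eq_bigr (fun i : 'I_m => (polyB p)`_(bump 0 i) * ucoef p (m - bump 0 i)%N)).
  by move/eqP/addIr.
move=> i _; rewrite ih // lift0 ltn_subrL /=; exact: leq_ltn_trans (leq0n _) (ltn_ord i).
Qed.

(* [z ^ N B(1/z)], the characteristic polynomial of the recurrence satisfied by
   the Taylor coefficients of [A/B]. *)
Definition Prev p : {poly C} := \poly_(k < N.+1) (polyB p)`_(N - k).

Lemma coef_Prev p k : (k <= N)%N -> (Prev p)`_k = (polyB p)`_(N - k).
Proof. by move=> hk; rewrite coef_poly ltnS hk. Qed.

Lemma size_Prev p : size (Prev p) = N.+1.
Proof. by apply: size_poly_eq; rewrite subnn coef_polyB0 oner_neq0. Qed.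

Lemma monic_Prev p : Prev p \is monic.
Proof. by apply/monicP; rewrite lead_coefE size_Prev /= coef_Prev // subnn coef_polyB0. Qed.

(** Only [d + 1] coefficients of [B] can enter the Cauchy product at index [m + d]; reversing the
    index turns it into a forward recurrence at [m]. *)
Lemma pact_rev (B : {poly C}) (u : nat -> C) d m : (size B <= d.+1)%N ->
  \sum_(k < (m + d).+1) B`_k * u (m + d - k)%N =
  \sum_(k < d.+1) B`_(d - k) * u (m + k)%N.
Proof.
move=> sB; have hd : (d.+1 <= (m + d).+1)%N by rewrite ltnS leq_addl.
transitivity (\sum_(k < d.+1) B`_k * u (m + d - k)%N).
  rewrite [RHS](big_ord_widen _ (fun k => B`_k * u (m + d - k)%N) hd).
  rewrite [RHS]big_mkcond; apply: eq_bigr => k _; case: ifPn => //.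
  by rewrite -leqNgt => hk; rewrite nth_default ?mul0r // (leq_trans sB).
rewrite (reindex_inj rev_ord_inj); apply: eq_bigr => k _ /=.
have hk : (k <= d)%N by rewrite -ltnS.
by rewrite subSS subnBA // addnAC addnK.
Qed.

Lemma pact_Prev p (c : nat -> C) m :
  pact (Prev p) c m = \sum_(k < (m + N).+1) (polyB p)`_k * c (m + N - k)%N.
Proof.
rewrite pact_rev ?size_polyB // (@pactE _ N.+1) ?size_Prev //.
by apply: eq_bigr => k _; rewrite coef_Prev // -ltnS.
Qed.

Lemma pact_ucoef p m : pact (Prev p) (ucoef p) m = 0.
Proof.
rewrite pact_Prev ucoef_rec nth_default // (leq_trans (size_polyA p)) //.
exact: leq_addl.
Qed.

Lemma horner_Prev p z : z != 0 -> (Prev p).[z] = z ^+ N * (polyB p).[z^-1].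
Proof.
move=> z0; rewrite (horner_coef_wide _ (n := N.+1)) ?size_Prev //.
rewrite (horner_coef_wide _ (size_polyB p)) mulr_sumr.
rewrite (reindex_inj rev_ord_inj); apply: eq_bigr => k _ /=.
have hk : (k <= N)%N by rewrite -ltnS.
rewrite subSS coef_Prev ?leq_subr // subKn // mulrCA; congr (_ * _).
by rewrite exprVn expfB_cond // (negbTE z0).
Qed.

Definition schur p := forall z, root (Prev p) z -> `|z| < 1.

(** Inversion [z -> 1/z] exchanges the roots of [polyB], nonzero because [B(0) = 1], with the
    nonzero roots of [Prev]. *)
Lemma schurP p : schur p <-> (forall z : C, `|z| <= 1 -> (polyB p).[z] != 0).
Proof.
split => h z.
  move=> z1; apply/eqP => hz.
  have z0 : z != 0.
    apply/eqP => e; move: hz; rewrite e horner_coef0 coef_polyB0 => /eqP.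
    by rewrite oner_eq0.
  have : root (Prev p) z^-1.
    by rewrite rootE horner_Prev ?invr_eq0 // invrK hz mulr0.
  move/h; rewrite normfV invf_lt1 ?normr_gt0 // => h1.
  by have := lt_le_trans h1 z1; rewrite ltxx.
have [-> _|z0] := eqVneq z 0; first by rewrite normr0 ltr01.
rewrite rootE horner_Prev // mulf_eq0 expf_eq0 (negbTE z0) andbF /= => hz.
rewrite real_ltNge ?normr_real //; apply/negP => z1.
have : `|z^-1| <= 1 by rewrite normfV invf_le1 // normr_gt0.
by move/h; rewrite hz.
Qed.

Definition hankT (c : nat -> C) : 'M[C]_N := \matrix_(i, j) c (i + j)%N.

Lemma coefM_eq (f g h : {poly C}) m : (forall i, (i <= m)%N -> f`_i = g`_i) ->
  (h * f)`_m = (h * g)`_m.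
Proof.
move=> e; rewrite !coefM; apply: eq_bigr => i _; rewrite e //; exact: leq_subr.
Qed.

Lemma coef_mul_trunc (B : {poly C}) (u : nat -> C) K m : (m < K)%N ->
  (B * \poly_(i < K) u i)`_m = \sum_(k < m.+1) B`_k * u (m - k)%N.
Proof.
move=> mK; rewrite coefM; apply: eq_bigr => k _; rewrite coef_poly.
by rewrite (leq_ltn_trans (leq_subr _ _) mK).
Qed.

Lemma pact0_state (P : {poly C}) (w : nat -> C) : P \is monic -> size P = n.+2 ->
  (forall m, pact P w m = 0) -> (forall i, (i < N)%N -> w i = 0) -> forall m, w m = 0.
Proof.
move=> mP sP h w0 m; have := cmpmx_stateX 0 m mP sP h.
have -> : state N w 0 = 0 by apply/colP => i; rewrite !mxE add0n w0.
by rewrite mulmx0 add0n => /colP /(_ 0); rewrite !mxE addn0.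
Qed.

Lemma pact_comm (P Q : {poly C}) w m : pact P (pact Q w) m = pact Q (pact P w) m.
Proof. by rewrite -!pactM mulrC. Qed.

(** Kronecker's argument. A kernel vector is a polynomial [al] whose action on [u] vanishes at [N]
    consecutive places, hence everywhere. Reversed into [Q], it makes [Q u] a polynomial [P] of
    degree below [n], so [Q A = P B]; coprimality and the degree condition force [Q = 0]. *)
Lemma hankT_unit p : (size (polyA p) = N \/ size (polyB p) = N.+1) ->
  coprimep (polyA p) (polyB p) -> hankT (ucoef p) \in unitmx.
Proof.
move=> hs hc; apply: unitmx_col_inj => a ha.
pose u := ucoef p; pose al := \poly_(k < N) a (inord k) 0 : {poly C}.
have pal m : pact al u m = \sum_k a k 0 * u (m + k)%N.
  rewrite (@pactE _ N) ?size_poly //; apply: eq_bigr => k _.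
  by rewrite coef_poly ltn_ord inord_val.
have al0 m : pact al u m = 0.
  apply: (pact0_state (monic_Prev p) (size_Prev p)).
    move=> l; rewrite pact_comm (@pact_ext R _ _ (fun=> 0)); last exact: pact_ucoef.
    by rewrite /pact big1 // => k _; rewrite mulr0.
  move=> i hi; rewrite pal; have /colP /(_ (Ordinal hi)) := ha.
  by rewrite !mxE => {2}<-; apply: eq_bigr => k _; rewrite !mxE mulrC.
pose Q := \poly_(k < N) a (inord (n - k)) 0 : {poly C}.
pose P := \poly_(m < n) (\sum_(k < m.+1) Q`_k * u (m - k)%N) : {poly C}.
have Qu m : \sum_(k < m.+1) Q`_k * u (m - k)%N = P`_m.
  rewrite coef_poly; case: ltnP => // hm.
  have [q em] : exists q, m = (q + n)%N by exists (m - n)%N; rewrite subnK.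
  rewrite em pact_rev ?size_poly // -[RHS](al0 q) pal.
  apply: eq_bigr => k _; have hk : (k <= n)%N by rewrite -ltnS.
  by rewrite coef_poly ltnS leq_subr subKn // inord_val.
have QAPB : Q * polyA p = P * polyB p.
  apply/polyP => m; pose uK := \poly_(i < m.+1) u i : {poly C}.
  transitivity ((Q * (polyB p * uK))`_m).
    by apply: coefM_eq => i hi; rewrite coef_mul_trunc ?ltnS // ucoef_rec.
  rewrite mulrCA [P * _]mulrC; apply: coefM_eq => i hi.
  by rewrite coef_mul_trunc ?ltnS // Qu.
have Q0 : Q = 0.
  case: hs => hs.
    have dA : polyA p %| P.
      by rewrite -(@Gauss_dvdpl _ P (polyB p) (polyA p)) // -QAPB dvdp_mull.
    have P0 : P = 0.
      apply/eqP; apply: contraT => hP; have := dvdp_leq hP dA; rewrite hs.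
      by move=> /leq_trans /(_ (size_poly _ _)); rewrite ltnn.
    move/eqP: QAPB; rewrite P0 mul0r mulf_eq0 => /orP[/eqP //|].
    by rewrite -size_poly_eq0 hs.
  have dB : polyB p %| Q.
    by rewrite -(@Gauss_dvdpl _ Q (polyA p) (polyB p)) 1?coprimep_sym // QAPB dvdp_mull.
  apply/eqP; apply: contraT => hQ; have := dvdp_leq hQ dB; rewrite hs.
  by move=> /leq_trans /(_ (size_poly _ _)); rewrite ltnn.
apply/colP => k; rewrite mxE; have := congr1 (fun P : {poly C} => P`_(n - k)) Q0.
rewrite coef0 coef_poly ltnS leq_subr subKn ?inord_val //; by rewrite -ltnS.
Qed.

(** A common root can be divided out of [A] and [B], and the reversed coefficients of the shorter
    denominator [B1] form a kernel vector of the Hankel matrix. *)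
Lemma hankT_coprime p : hankT (ucoef p) \in unitmx -> coprimep (polyA p) (polyB p).
Proof.
move=> uT; apply: contraT => hc.
have B0 : polyB p != 0.
  by apply/eqP => e; have := coef_polyB0 p; rewrite e coef0 => /esym/eqP; rewrite oner_eq0.
have [z zA zB] : exists2 z, root (polyA p) z & root (polyB p) z.
  have : size (gcdp (polyA p) (polyB p)) != 1 by rewrite -coprimep_def.
  move/closed_rootP => [z]; rewrite root_gcd => /andP[a b]; by exists z.
have z0 : z != 0.
  by apply: contraL zB => /eqP ->; rewrite rootE horner_coef0 coef_polyB0 oner_eq0.
have /factor_theorem [A1 eA] := zA; have /factor_theorem [B1 eB] := zB.
have B10 : B1 != 0 by apply: contra B0 => /eqP e; rewrite eB e mul0r.
have sXz : size ('X - z%:P : {poly C}) = 2 by rewrite size_XsubC.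
have sB1 : (size B1 <= n.+1)%N.
  have := size_polyB p; rewrite eB size_mul ?polyXsubC_eq0 // sXz addn2 /=.
  by rewrite ltnS.
have sA1 : (size A1 <= n)%N.
  have [->|A10] := eqVneq A1 0; first by rewrite size_poly0.
  by have := size_polyA p; rewrite eA size_mul ?polyXsubC_eq0 // sXz addn2 /= ltnS.
pose u := ucoef p.
have B1u m : \sum_(k < m.+1) B1`_k * u (m - k)%N = A1`_m.
  pose uK := \poly_(i < m.+1) u i : {poly C}; pose D := B1 * uK - A1.
  have hD i : (i <= m)%N -> (D * ('X - z%:P))`_i = 0.
    move=> hi; rewrite mulrBl mulrAC -eB -eA coefB coef_mul_trunc ?ltnS //.
    by rewrite ucoef_rec subrr.
  have D0 i : (i <= m)%N -> D`_i = 0.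
    elim: i => [|i ih] hi.
      have := hD 0%N hi; rewrite mulrBr coefB coefMX coefMC /= sub0r => /eqP.
      by rewrite oppr_eq0 mulf_eq0 (negbTE z0) orbF => /eqP.
    have := hD i.+1 hi; rewrite mulrBr coefB coefMX coefMC /= ih ?(ltnW hi) // sub0r => /eqP.
    by rewrite oppr_eq0 mulf_eq0 (negbTE z0) orbF => /eqP.
  have := D0 m (leqnn m); rewrite coefB coef_mul_trunc // => /eqP.
  by rewrite subr_eq0 => /eqP.
have ker : hankT u *m (\col_k B1`_(n - k)) = 0.
  apply/colP => i; rewrite mxE [RHS]mxE.
  transitivity (A1`_(i + n)); last by rewrite nth_default // (leq_trans sA1) // leq_addl.
  rewrite -B1u pact_rev //; apply: eq_bigr => k _; by rewrite !mxE mulrC.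
have c0 : \col_k B1`_(n - k) = 0 :> 'cV[C]_N.
  by rewrite -[LHS]mul1mx -(mulVmx uT) -mulmxA ker mulmx0.
case/eqP: B10; apply/polyP => k; rewrite coef0.
have [hk|hk] := leqP k n; last by rewrite nth_default // (leq_trans sB1).
have /colP /(_ (inord (n - k))) := c0; rewrite !mxE inordK ?ltnS ?leq_subr // subKn //.
Qed.

Section Stable.
Variable p : 'M[R]_(4, N).
Hypothesis hp : schur p.
Local Notation u := (ucoef p).

Definition Mp : 'M[C]_N := cmpmx N (Prev p).
(** The columns of [k -> rho k] are the solutions of the recurrence whose first [N] values form a
    unit vector. They frame the range of [H_u]; [sv] passes from coordinates to sequences, and [Gp]
    is the Gram matrix of the frame. *)
Definition rho (k : nat) : 'rV[C]_N := row 0 (Mp ^+ k).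
Definition Gp : 'M[C]_N := msum (fun k => ct (rho k) *m rho k).
Definition Tp : 'M[C]_N := hankT u.
Definition T1p : 'M[C]_N := hankT (fun m => u m.+1).
Definition bp : 'cV[C]_N := state N u 0.
(** The coordinates of [H_u^2(1)], since [H_u(1) = u] has coordinates [bp]. *)
Definition vp : 'cV[C]_N := Tp *m cj (Gp *m bp).
Definition sv (w : 'cV[C]_N) : seqC R := fun m => (rho m *m w) 0 0.

Lemma Mp_char : char_poly Mp = Prev p.
Proof. by apply: char_poly_cmpmx; rewrite ?monic_Prev ?size_Prev. Qed.

Lemma Mp_geo : mgeo (fun k => Mp ^+ k).
Proof. by apply: stable_powers_geo => z; rewrite Mp_char; apply: hp. Qed.

Lemma rho_geo : mgeo rho.
Proof. by move=> i j; apply: eq_geo (Mp_geo 0 j) => k; rewrite !mxE. Qed.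

Lemma rhoS k : rho k.+1 = rho k *m Mp.
Proof. by rewrite /rho exprSr -mulmxE row_mul. Qed.

Lemma rho_delta (k : 'I_N) : rho k = delta_mx 0 k.
Proof.
case: k => k; elim: k => [|k ih] hk.
  rewrite /rho expr0 row1; congr delta_mx; exact: val_inj.
rewrite /= rhoS (ih (ltnW hk)) -rowE; apply/rowP => j; rewrite !mxE /=.
by rewrite ltn_eqF // -val_eqE /= eq_sym.
Qed.

Lemma rho_state (w : nat -> C) k l : (forall m, pact (Prev p) w m = 0) ->
  w (k + l)%N = (rho l *m state N w k) 0 0.
Proof.
move=> h; have := cmpmx_stateX k l (monic_Prev p) (size_Prev p) h.
move=> /colP /(_ 0); rewrite [RHS]mxE addn0 => <-.
by rewrite /rho -row_mul [RHS]mxE.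
Qed.

Lemma hankel_rho (w : nat -> C) k l : (forall m, pact (Prev p) w m = 0) ->
  w (k + l)%N = (rho k *m hankT w *m (rho l)^T) 0 0.
Proof.
move=> h.
have e (i : 'I_N) : w (k + i)%N = (rho k *m hankT w) 0 i.
  rewrite addnC (rho_state i k h) [LHS]mxE [RHS]mxE; apply: eq_bigr => j _.
  by rewrite !mxE addnC.
rewrite (rho_state k l h) !mxE; apply: eq_bigr => i _.
by rewrite [state _ _ _ _ _]mxE e [(rho l)^T _ _]mxE mulrC.
Qed.

Lemma u_hankel k l : u (k + l)%N = (rho k *m Tp *m (rho l)^T) 0 0.
Proof. by apply: hankel_rho; apply: pact_ucoef. Qed.

Lemma pact_u1 m : pact (Prev p) (fun i => u i.+1) m = 0.
Proof.
rewrite -[RHS](pact_ucoef p m.+1); apply: eq_bigr => i _; by rewrite addSn.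
Qed.

Lemma u1_hankel k l : u (k + l).+1 = (rho k *m T1p *m (rho l)^T) 0 0.
Proof. by rewrite -(hankel_rho k l pact_u1). Qed.

Lemma Tp_sym : Tp^T = Tp.
Proof. by apply/matrixP => i j; rewrite !mxE addnC. Qed.
Lemma T1p_sym : T1p^T = T1p.
Proof. by apply/matrixP => i j; rewrite !mxE addnC. Qed.

Lemma T1p_Mp : T1p = Mp *m Tp.
Proof.
apply/matrixP => i j.
have /colP /(_ i) := cmpmx_state j (monic_Prev p) (size_Prev p) (pact_ucoef p).
rewrite [RHS]mxE !mxE addSn addnC => <-; apply: eq_bigr => k _.
by rewrite !mxE addnC.
Qed.

Lemma bpE : bp = Tp *m (rho 0)^T.
Proof.
apply/colP => i; rewrite /rho expr0 row1 trmx_delta -colE.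
by rewrite !mxE addn0.
Qed.
End Stable.
End RationalSymbols.

(** * Generic symbols in terms of matrices *)

Section GenericSymbols.
Variables (R : realType) (n : nat).
Local Notation C := (R[i]).
Local Notation N := n.+1.
Implicit Types p : 'M[R]_(4, N).

Lemma geo_fin m (f : nat -> C) : (forall k, (m <= k)%N -> f k = 0) -> geo f.
Proof.
elim: m f => [|m ih] f h; first by apply: eq_geo (geo0 R) => k; rewrite h.
by apply: geo_unshift; apply: ih => k hk; apply: h.
Qed.

Lemma csum_fin m (f : nat -> C) : (forall k, (m <= k)%N -> f k = 0) ->
  csum f = \sum_(k < m) f k.
Proof.
elim: m f => [|m ih] f h.
  by rewrite big_ord0 -[RHS](csum0 R); apply: eq_csum => k; rewrite h.
rewrite csum_recl ?big_ord_recl; last exact: geo_fin h.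
by rewrite ih // => k hk; apply: h.
Qed.

Lemma csum_ge_term (f : nat -> C) k : geo f -> (forall m, 0 <= f m) -> f k <= csum f.
Proof.
move=> gf f0; have [a b] := geo_summable gf.
have im m : complex.Im (f m) = 0 by apply/ger0_Im/f0.
have re m : 0 <= complex.Re (f m) by have := f0 m; rewrite lecE => /andP[].
rewrite lecE im; apply/andP; split.
  have c0 : ((fun m => complex.Im (\sum_(k < m) f k)) @ \oo --> (0 : R))%classic.
    by apply: cvg_near_cst; near=> m; rewrite cIm_sum big1.
  by apply/eqP; apply: cvg_unique b c0.
apply: (cvgr_to_ge a); near=> m.
have km : (k < m)%N by near: m; exact: nbhs_infty_gt.
rewrite cRe_sum (bigD1 (Ordinal km)) //= lerDl; apply: sumr_ge0 => i _; exact: re.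
Unshelve. all: end_near.
Qed.

Lemma mulC_ge0 (z : C) : 0 <= z^* * z.
Proof. by rewrite mulrC mul_conjC_ge0. Qed.

Lemma hsq_comp m m' (G T : 'M[C]_m) (w : 'M[C]_(m, m')) :
  T *m cj (G *m (T *m cj (G *m w))) = hsq G T *m w.
Proof. by rewrite !cjM !cjK /hsq !mulmxA. Qed.

Section StableGram.
Variable p : 'M[R]_(4, N).
Hypothesis hp : schur p.
Local Notation u := (ucoef p).
Local Notation rho := (rho p).
Local Notation G := (Gp p).
Local Notation T := (Tp p).

Lemma rr_geo : mgeo (fun k => ct (rho k) *m rho k).
Proof. by apply: mgeoM; [apply: mgeo_ct|]; apply: rho_geo. Qed.

Lemma Gp_herm : ct G = G.
Proof.
rewrite /ct /Gp -msum_cj -?msum_tr; last exact: rr_geo.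
by apply: eq_msum => k; rewrite -/(ct _) ctM ctK.
Qed.

Lemma gram_csum (V W : 'cV[C]_N) :
  (ct V *m G *m W) 0 0 = csum (fun k => ((rho k *m V) 0 0)^* * (rho k *m W) 0 0).
Proof.
rewrite -msum_mull ?rr_geo //; last exact: rr_geo.
rewrite -msum_mulr; last by apply: mgeo_mull; exact: rr_geo.
rewrite mxE; apply: eq_csum => k; rewrite -!mulmxA mulmxA -ctM.
by rewrite [LHS]mxE big_ord1 ctE.
Qed.

Lemma Gp_pos (w : 'cV[C]_N) : w != 0 -> 0 < (ct w *m G *m w) 0 0.
Proof.
move=> w0; rewrite gram_csum.
have [k hk] : exists k, w k 0 != 0.
  apply: contrapT => h; case/eqP: w0; apply/colP => k; rewrite mxE; apply/eqP.
  by apply: contrapT => /negP hk; apply: h; exists k.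
pose f m := ((rho m *m w) 0 0)^* * (rho m *m w) 0 0.
have fk : f k = (w k 0)^* * w k 0.
  by rewrite /f rho_delta -rowE !mxE.
apply: lt_le_trans (csum_ge_term k (f := f) _ _).
- by rewrite fk lt_def mulC_ge0 andbT mulf_neq0 // conjC_eq0.
- have g : geo (fun m => (rho m *m w) 0 0) by apply: mgeo_mulr; exact: rho_geo.
  by apply: geoM => //; apply: geo_conj.
- by move=> m; apply: mulC_ge0.
Qed.

(** The first term of the Gram sum is split off and [rhoS] shifts the others; the rank-one term is
    the source of the rank-one difference between [H_u^2] and [K_u^2]. *)
Lemma Gp_stein : G = ct (rho 0) *m rho 0 + ct (Mp p) *m G *m Mp p.
Proof.
rewrite {1}/Gp msum_recl; last exact: rr_geo.
rewrite -msum_mull; last exact: rr_geo.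
rewrite -msum_mulr; last by apply: mgeo_mull; exact: rr_geo.
by congr (_ + _); apply: eq_msum => k; rewrite rhoS ctM !mulmxA.
Qed.

Lemma sv_geo w : geo (sv p w).
Proof. by apply: (mgeo_mulr w (rho_geo hp)). Qed.

Lemma sv_inj w w' : sv p w = sv p w' -> w = w'.
Proof.
move=> e; apply/colP => k; have := congr1 (@^~ (k : nat)) e; rewrite /sv /= rho_delta -!rowE.
by rewrite !mxE.
Qed.

Lemma u_sv : u = sv p (bp p).
Proof.
by apply/funext => m; rewrite -[m]add0n (rho_state 0 m (pact_ucoef p)).
Qed.

Lemma hankel_one (c : seqC R) : hankel c (hk_one R) = c.
Proof.
apply/funext => m; rewrite /hankel (csum_delta (k := 0%N)).
  by rewrite addn0 /hk_one eqxx rmorph1 mulr1.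
by move=> k /negbTE h; rewrite /hk_one h rmorph0 mulr0.
Qed.

Lemma hankel_sv w : hankel u (sv p w) = sv p (T *m cj (G *m w)).
Proof.
apply/funext => m; rewrite /hankel /sv.
have e k : u (m + k)%N * ((rho k *m w) 0 0)^* =
    (rho m *m T *m (cj (ct (rho k) *m rho k) *m cj w)) 0 0.
  rewrite u_hankel (cjM (ct (rho k))) cj_ct -(mulmxA _ _ (cj w)) -cjM.
  by rewrite (mulmxA _ (rho k)^T) [RHS]mxE big_ord1 cjE.
rewrite (eq_csum e).
have g1 : mgeo (fun k => cj (ct (rho k) *m rho k)) by apply: mgeo_cj; exact: rr_geo.
have g2 : mgeo (fun k => cj (ct (rho k) *m rho k) *m cj w) by apply: mgeo_mulr.
transitivity ((rho m *m T *m (cj G *m cj w)) 0 0); last by rewrite cjM !mulmxA.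
rewrite /Gp -msum_cj; last exact: rr_geo.
by rewrite -msum_mulr // -msum_mull // [RHS]mxE.
Qed.

Lemma iter_hankel_one k :
  iter (2 * k.+1) (hankel u) (hk_one R) = sv p (hsq G T ^+ k *m vp p).
Proof.
elim: k => [|k ih].
  by rewrite expr0 mul1mx /= hankel_one {2}u_sv hankel_sv.
have -> : (2 * k.+2 = (2 * k.+1).+2)%N by rewrite mulnS.
by rewrite 2!iterS ih !hankel_sv exprS -mulmxE hsq_comp mulmxA.
Qed.

(** The recurrence acts on the first index of [u (m + l)] and commutes with the sum over [l]. *)
Lemma hankel_l2_pact h m : hk_l2 h -> pact (Prev p) (hankel u h) m = 0.
Proof.
move=> /l2_bounded [B hB].
have gu : geo u by rewrite u_sv; apply: sv_geo.
have g k : geo (fun l => u (m + k + l)%N * (h l)^*).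
  apply: geoMb (_ : forall l, cabs (h l)^* <= B); last by move=> l; rewrite cabs_conj.
  by apply: eq_geo (geo_shift (m + k) gu) => l; rewrite addnC.
rewrite /pact /hankel.
transitivity (csum (fun l => \sum_(k < size (Prev p)) (Prev p)`_k * (u (m + k + l)%N * (h l)^*))).
  rewrite csum_sum; last by move=> k _; apply: geoZ.
  by apply: eq_bigr => k _; rewrite csumZ.
rewrite (eq_csum (g := fun=> 0)) ?csum0 // => l.
transitivity (pact (Prev p) u (m + l) * (h l)^*); last by rewrite pact_ucoef mul0r.
rewrite /pact mulr_suml.
by apply: eq_bigr => k _; rewrite mulrA addnAC.
Qed.

Lemma Mp_col0 : (Prev p)`_0 = 0 -> forall m, rho m 0 0 = (m == 0%N)%:R.
Proof.
move=> P0 [|m]; first by rewrite /rho expr0 row1 !mxE.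
rewrite rhoS mxE big1 // => i _; rewrite !mxE.
by case: ifP => _; rewrite ?P0 ?oppr0 mulr0.
Qed.

(** The coefficient [(Prev p)_0] is that of [z^N] in [B]. If it vanishes, the first frame vector is
    the constant [1], reached because [T] is invertible; conversely, the recurrence applied to the
    sequence of [1] at index zero returns this coefficient. *)
Lemma one_range : T \in unitmx ->
  (~ exists h, hk_l2 h /\ hankel u h = hk_one R) <-> (Prev p)`_0 != 0.
Proof.
move=> uT; split => [h|h0 [h [hl2 e]]].
  apply/negP => /eqP P0; apply: h.
  pose w := cj (invmx T *m (rho 0)^T).
  exists (fun k => if (k < N)%N then w (inord k) 0 else 0); split.
    by apply: geo_l2; apply: (@geo_fin N) => k hk; rewrite ltnNge hk.
  apply/funext => m; rewrite /hankel (@csum_fin N); last first.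
    by move=> k hk; rewrite ltnNge hk rmorph0 mulr0.
  transitivity ((rho m *m T *m cj w) 0 0).
    rewrite mxE; apply: eq_bigr => i _; rewrite ltn_ord inord_val [cj w _ _]cjE; congr (_ * _).
    by rewrite u_hankel rho_delta trmx_delta -colE [LHS]mxE.
  rewrite /w cjK mulmxA -(mulmxA (rho m)) (mulmxV uT) mulmx1 {2}/rho expr0 row1 trmx_delta -colE mxE.
  by rewrite Mp_col0 // /hk_one; case: eqP.
have := hankel_l2_pact 0 hl2; rewrite e /pact size_Prev big_ord_recl /= mulr1 big1 ?addr0.
  by move=> e0; rewrite e0 eqxx in h0.
by move=> i _; rewrite mulr0.
Qed.

Lemma rho_takagi (c : seqC R) (Tc V : 'M[C]_N) (lam : 'I_N -> R) :
  (forall k l, c (k + l)%N = (rho k *m Tc *m (rho l)^T) 0 0) ->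
  ct V *m G *m V = 1%:M -> Tc = V *m rdiag lam *m V^T ->
  takagi c lam (fun k => rho k *m V).
Proof.
move=> hc hV hT; split.
- by apply: mgeo_mulr; exact: rho_geo.
- rewrite -hV -msum_mull; last exact: rr_geo.
  rewrite -msum_mulr; last by apply: mgeo_mull; exact: rr_geo.
  by apply: eq_msum => k; rewrite ctM !mulmxA.
- move=> k l; rewrite hc hT !mulmxA -[_ *m V^T *m _]mulmxA -trmx_mul.
  rewrite mul_mx_diag mxE; apply: eq_bigr => j _.
  by rewrite !mxE [X in X * _]mulrC.
Qed.

(** This is [K_u^2 = H_u^2 - (.|u) u] in the frame: shifting the symbol multiplies [T] by the
    companion matrix, and [Gp_stein] absorbs it. *)
Lemma hsq_T1p : hsq G (T1p p) = hsq G T - bp p *m ct (bp p) *m G.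
Proof.
have e1 : T1p p = T *m (Mp p)^T by rewrite -T1p_sym T1p_Mp trmx_mul Tp_sym.
have -> : hsq G (T1p p) = T *m cj (ct (Mp p) *m G *m Mp p) *m cj T *m G.
  by rewrite /hsq {1}e1 T1p_Mp !cjM cj_ct !mulmxA.
have -> : ct (Mp p) *m G *m Mp p = G - ct (rho 0) *m rho 0.
  by rewrite {2}Gp_stein [X in X - _]addrC addrK.
rewrite cjB mulmxBr !mulmxBl /hsq; congr (_ - _).
rewrite cjM cj_ct bpE ctM ct_tr -/(ct T) (_ : ct T = cj T) ?mulmxA //.
by rewrite /ct -cj_tr Tp_sym.
Qed.
End StableGram.

Definition Gen p := chartMN p /\ inMNgen N (ucoef p).

Lemma sv_krylov p (A : 'M[C]_N) v (a : 'I_N -> C) m :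
  \sum_(k < N) a k * sv p (A ^+ k *m v) m = sv p (krylov A v *m \col_k a k) m.
Proof.
rewrite [RHS]/sv mulmxA [RHS]mxE; apply: eq_bigr => k _; rewrite [X in _ = _ * X]mxE mulrC.
congr (_ * _); rewrite /sv [LHS]mxE [RHS]mxE; apply: eq_bigr => i _.
by rewrite [X in _ = _ * X]mxE.
Qed.

(** Genericity becomes stability together with the nonvanishing of three elementary functions, the
    form used for openness. In the converse direction [(Prev p)_0 != 0] gives [deg B = N], and the
    invertible Hankel matrix gives coprimality. *)
Lemma genP p : Gen p <-> [/\ schur p, Tp p \in unitmx, (Prev p)`_0 != 0 &
  krylov (hsq (Gp p) (Tp p)) (vp p) \in unitmx].
Proof.
split.
  move=> [[hs [hc hd]] [_ [h1 hi]]].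
  have hsch : schur p by apply/schurP.
  have uT : Tp p \in unitmx by apply: hankT_unit.
  split => //; first by apply/(one_range hsch uT).
  apply: unitmx_col_inj => a ha.
  have h0 k : a k 0 = 0.
    apply: (hi (fun k => a k 0)) => m.
    rewrite (eq_bigr (fun k : 'I_N => a k 0 * sv p (hsq (Gp p) (Tp p) ^+ k *m vp p) m)); last first.
      by move=> i _; rewrite iter_hankel_one.
    rewrite sv_krylov (_ : \col_i a i 0 = a) ?ha; last by apply/colP => i; rewrite mxE.
    by rewrite /sv mulmx0 mxE.
  by apply/colP => k; rewrite h0 mxE.
move=> [hsch uT P0 uK].
have ch : chartMN p.
  split; [right|split; [exact: hankT_coprime|exact/schurP]].
  apply/eqP; rewrite eqn_leq size_polyB ltnNge; apply: contra P0 => h.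
  by rewrite coef_Prev // subn0 nth_default.
split => //; split; first by exists p.
split; first exact/(one_range hsch uT).
move=> a ha k.
have : krylov (hsq (Gp p) (Tp p)) (vp p) *m \col_k a k = 0.
  apply: (@sv_inj p); apply/funext => m; rewrite -sv_krylov {2}/sv mulmx0 [RHS]mxE -[RHS](ha m).
  by apply: eq_bigr => i _; rewrite iter_hankel_one.
move=> h; have : \col_k a k = 0 :> 'cV[C]_N by rewrite -[LHS]mul1mx -(mulVmx uK) -mulmxA h mulmx0.
by move=> /colP /(_ k); rewrite !mxE.
Qed.

(** By Cayley-Hamilton the numbers [r A^k b] satisfy a recurrence of order [n' + 1], so a row
    killing the Krylov columns kills [A^k b] for every [k]. *)
Lemma krylov_row n' (A : 'M[C]_n'.+1) (b : 'cV[C]_n'.+1) :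
  (forall r : 'rV_n'.+1, (forall k, (r *m A ^+ k *m b) 0 0 = 0) -> r = 0) ->
  krylov A b \in unitmx.
Proof.
move=> h; apply: unitmx_row_inj => r hr; apply: h => k.
pose w k := (r *m A ^+ k *m b) 0 0.
have e l : w l = \sum_i \sum_j r 0 i * b j 0 * (A ^+ l) i j.
  rewrite /w -mulmxA mxE; apply: eq_bigr => i _; rewrite mxE mulr_sumr.
  by apply: eq_bigr => j _; rewrite -mulrA [b j 0 * _]mulrC.
apply: (@pact0_state R n' (char_poly A) w (char_poly_monic A) (size_char_poly A)) => [m|i hi].
  rewrite (@pact_ext R _ _ _ m e) /pact.
  under eq_bigr => l _ do rewrite mulr_sumr.
  rewrite exchange_big big1 //= => i _.
  under eq_bigr => l _ do rewrite mulr_sumr.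
  rewrite exchange_big big1 //= => j _.
  under eq_bigr => l _ do rewrite mulrCA.
  rewrite -mulr_sumr -/(pact _ (fun l => (A ^+ l) i j) m) pact_horner_mx Cayley_Hamilton.
  by rewrite mulmx0 mxE mulr0.
have /rowP /(_ (Ordinal hi)) := hr; rewrite mxE [RHS]mxE => e0; rewrite /w -mulmxA mxE -[RHS]e0.
by apply: eq_bigr => j _; rewrite [krylov _ _ _ _]mxE.
Qed.

(** The relations extend from powers to all polynomials, and the product of [X - t_i] over [i != j]
    isolates [x_j]. *)
Lemma vandermonde_eq0 m (x t : 'I_m -> C) : injective t ->
  (forall k, \sum_j x j * t j ^+ k = 0) -> forall j, x j = 0.
Proof.
move=> ti h j.
have hP (P : {poly C}) : \sum_j x j * P.[t j] = 0.
  under eq_bigr => i _ do rewrite horner_coef mulr_sumr.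
  rewrite exchange_big big1 //= => k _.
  by under eq_bigr => i _ do rewrite mulrCA; rewrite -mulr_sumr h mulr0.
have := hP (\prod_(i | i != j) ('X - (t i)%:P)).
rewrite (bigD1 j) //= [X in _ + X]big1 => [|i ij].
  rewrite addr0 => /eqP; rewrite mulf_eq0 => /orP[/eqP //|].
  rewrite horner_prod prodf_seq_eq0 => /hasP [i _ /=]; rewrite hornerXsubC subr_eq0.
  by move=> /andP[ij /eqP /ti e]; rewrite e eqxx in ij.
rewrite horner_prod (bigD1 i) //= hornerXsubC subrr mul0r mulr0 //.
Qed.

Lemma hsq_diag (G T V : 'M[C]_N) (lam : 'I_N -> R) :
  ct V *m G *m V = 1%:M -> T = V *m rdiag lam *m V^T ->
  hsq G T *m V = V *m rdiag (fun j => lam j ^+ 2).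
Proof.
move=> VG TV.
have VGc : V^T *m cj (G *m V) = 1%:M.
  by have := congr1 (@cj R _ _) VG; rewrite -mulmxA cjM cj_ct cj1.
have e1 : T *m cj (G *m V) = V *m rdiag lam by rewrite TV -!mulmxA VGc mulmx1.
rewrite -hsq_comp e1 mulmxA cjM mulmxA e1 -mulmxA; congr (_ *m _).
apply/matrixP => i j; rewrite mul_diag_mx !mxE.
by case: eqP => [->|]; rewrite ?mulr1n ?mulr0n ?rmorph0 ?mulr0 // real_conj -rmorphM /= -expr2.
Qed.

Lemma hsq_pow (G T V : 'M[C]_N) (lam : 'I_N -> R) :
  ct V *m G *m V = 1%:M -> T = V *m rdiag lam *m V^T ->
  forall (v : 'cV[C]_N) (r : 'rV[C]_N) k, (r *m hsq G T ^+ k *m v) 0 0 =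
    \sum_j (r *m V) 0 j * (invmx V *m v) j 0 * ((lam j ^+ 2)%:C%C) ^+ k.
Proof.
move=> VG TV v r k; have [uV _] := mulmx1_unit (mulmx1C VG).
have HV := hsq_diag VG TV.
have e : hsq G T ^+ k *m V = V *m rdiag (fun j => (lam j ^+ 2) ^+ k).
  elim: k => [|k ih].
    rewrite expr0 mul1mx; apply/matrixP => i j; rewrite mul_mx_diag !mxE.
    by rewrite expr0 mulr1.
  rewrite exprS -mulmxE -mulmxA ih mulmxA HV -mulmxA; congr (_ *m _).
  apply/matrixP => i j; rewrite mul_diag_mx !mxE.
  by case: eqP => [->|]; rewrite ?mulr1n ?mulr0n ?mulr0 // -rmorphM /= -exprS.
rewrite -[v in LHS]mul1mx -[1%:M in LHS](mulmxV uV) !mulmxA -(mulmxA r) e mulmxA.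
rewrite -mulmxA mul_mx_diag mxE; apply: eq_bigr => j _.
by rewrite [X in X * _]mxE [X in _ * X * _]mxE rmorphXn /= mulrAC.
Qed.

(** For [H_u^2] the cyclic vector is [H_u^2(1)]; its coordinates are [lam_j] times the conjugates of
    those of [u], so [u] is cyclic too. A rank-one perturbation along [u] keeps [u] cyclic, which
    lets [takagi_exists] be applied to [K_u]. *)
Lemma gen_takagi p : Gen p -> exists (lam mu : 'I_N -> R) (V V1 : 'M[C]_N),
  [/\ [/\ forall j, 0 < lam j, forall i j : 'I_N, (i < j)%N -> lam j < lam i,
      ct V *m Gp p *m V = 1%:M, Tp p = V *m rdiag lam *m V^T &
      forall j, (invmx V *m bp p) j 0 != 0],
    [/\ forall j, 0 < mu j, forall i j : 'I_N, (i < j)%N -> mu j < mu i,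
      ct V1 *m Gp p *m V1 = 1%:M, T1p p = V1 *m rdiag mu *m V1^T &
      forall j, (invmx V1 *m bp p) j 0 != 0],
    takagi (ucoef p) lam (fun k => rho p k *m V) &
    takagi (fun m => ucoef p m.+1) mu (fun k => rho p k *m V1)].
Proof.
move=> /genP [hs uT P0 uK].
have [lam [V [l0 ld VG TV nz]]] := takagi_exists (Gp_herm hs) (Gp_pos hs) (Tp_sym p) uT uK.
have [uV _] := mulmx1_unit (mulmx1C VG).
have VGc : V^T *m cj (Gp p *m V) = 1%:M.
  by have := congr1 (@cj R _ _) VG; rewrite -mulmxA cjM cj_ct cj1.
have VG' : invmx V = ct V *m Gp p by rewrite -[RHS](mulmxK uV) VG mul1mx.
have nzb j : (invmx V *m bp p) j 0 != 0.
  have := nz j; apply: contra => /eqP h; apply/eqP.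
  have -> : invmx V *m vp p = rdiag lam *m cj (invmx V *m bp p).
    rewrite /vp TV -!mulmxA (mulmxA (invmx V) V) (mulVmx uV) mul1mx; congr (_ *m _).
    by rewrite VG' -mulmxA [in RHS]cjM cj_ct.
  by rewrite mul_diag_mx mxE cjE h rmorph0 mulr0.
have HVk := hsq_pow VG TV (bp p).
have kH (r : 'rV[C]_N) : (forall k, (r *m hsq (Gp p) (Tp p) ^+ k *m bp p) 0 0 = 0) -> r = 0.
  move=> h.
  have inj : injective (fun j => (lam j ^+ 2)%:C%C : C).
    move=> i j /complexI /eqP; rewrite eqrXn2 ?ltW // => /eqP; apply: (lam_inj ld).
  have h1 := vandermonde_eq0 inj (fun k => etrans (esym (HVk r k)) (h k)).
  have rV : r *m V = 0.
    apply/rowP => j; rewrite [RHS]mxE; have /eqP := h1 j.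
    by rewrite mulf_eq0 (negbTE (nzb j)) orbF => /eqP.
  by rewrite -[r](mulmxK uV) rV mul0mx.
have uK1 : krylov (hsq (Gp p) (T1p p)) (bp p) \in unitmx.
  apply: krylov_row => r hr; apply: kH.
  set H1 := hsq (Gp p) (T1p p) in hr; set H := hsq (Gp p) (Tp p).
  have eH : H = H1 + bp p *m (ct (bp p) *m Gp p) by rewrite /H1 hsq_T1p // mulmxA subrK.
  (* Replacing one factor [H] by [H1] changes the product by a multiple of [r H1^j b], which
     vanishes; the induction therefore quantifies over [j]. *)
  have main k : forall j, (r *m H1 ^+ j *m (H ^+ k *m bp p)) 0 0 = 0.
    elim: k => [|k ih] j; first by rewrite expr0 mul1mx hr.
    have -> : H ^+ k.+1 *m bp p = H *m (H ^+ k *m bp p) by rewrite exprS -mulmxE mulmxA.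
    move: ih; move: (H ^+ k *m bp p) => X ih.
    rewrite eH mulmxDl mulmxDr [LHS]mxE.
    have -> : (r *m H1 ^+ j *m (H1 *m X)) 0 0 = 0.
      by have := ih j.+1; rewrite exprSr -mulmxE !mulmxA.
    by rewrite add0r -(mulmxA (bp p)) (mulmxA _ (bp p)) [LHS]mxE big_ord1 hr mul0r.
  by move=> k; have := main k 0%N; rewrite expr0 mulmx1 mulmxA.
(* The determinant of [Mp] is, up to sign, [(Prev p)_0]: the condition that [1] is outside the range
   of [H_u] is what gives [K_u] full rank. *)
have uM : Mp p \in unitmx.
  rewrite unitmxE unitfE; apply: contra P0 => /eqP d0.
  by rewrite -Mp_char char_poly_det d0 mulr0.
have uT1 : T1p p \in unitmx by rewrite T1p_Mp unitmx_mul uM uT.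
have [mu [V1 [m0 md VG1 TV1 nz1]]] :=
  takagi_exists (Gp_herm hs) (Gp_pos hs) (T1p_sym p) uT1 uK1.
exists lam, mu, V, V1; split => //.
- by apply: (@rho_takagi p hs (ucoef p) (Tp p) V lam _ VG TV); exact: u_hankel.
- by apply: (@rho_takagi p hs (fun m => ucoef p m.+1) (T1p p) V1 mu _ VG1 TV1); exact: u1_hankel.
Qed.

End GenericSymbols.

(** * Cauchy systems and interlacing *)

Section CauchySystem.
Variables (R : realFieldType) (n : nat).
Local Notation N := n.+1.
Implicit Types (a b x : 'I_N -> R).

Definition lagr a (j : 'I_N) : {poly R} := \prod_(k | k != j) ('X - (a k)%:P).

Lemma size_lagr a j : size (lagr a j) = N.
Proof.
rewrite size_prod; last by move=> i _; rewrite polyXsubC_eq0.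
rewrite (eq_bigr (fun=> 2%N)) => [|i _]; last by rewrite size_XsubC.
rewrite sum_nat_const; have := cardC1 j; rewrite card_ord /= => e.
by rewrite (eq_card (B := predC1 j)) // e /=; lia.
Qed.

Lemma coef_lagr a j : (lagr a j)`_n = 1.
Proof.
have := monic_prod_XsubC (index_enum 'I_N) (fun k => k != j) a.
by rewrite monicE lead_coefE -/(lagr a j) size_lagr => /eqP.
Qed.

Lemma horner_lagr a j z : (lagr a j).[z] = \prod_(k | k != j) (z - a k).
Proof. by rewrite horner_prod; apply: eq_bigr => k _; rewrite hornerXsubC. Qed.

Lemma lagr_neq a i j : i != j -> (lagr a j).[a i] = 0.
Proof. by move=> ij; rewrite horner_lagr (bigD1 i) //= subrr mul0r. Qed.

Lemma lagr_self a j : injective a -> (lagr a j).[a j] != 0.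
Proof.
move=> ia; rewrite horner_lagr; apply/prodf_neq0 => k kj.
by rewrite subr_eq0 eq_sym (inj_eq ia).
Qed.

Lemma poly_eq0_points a (P : {poly R}) : injective a -> (size P <= N)%N ->
  (forall j, P.[a j] = 0) -> P = 0.
Proof.
move=> ia sP h; apply: (@roots_geq_poly_eq0 _ _ (map a (enum 'I_N))).
- by apply/allP => z /mapP [j _ ->]; rewrite rootE h.
- by rewrite (map_inj_uniq ia) enum_uniq.
- by rewrite size_map size_enum_ord.
Qed.

(** The coefficient of degree [n] in the interpolation formula, each [lagr a j] being monic of that
    degree. *)
Lemma lagrange_lead a (P : {poly R}) : injective a -> (size P <= N)%N ->
  \sum_j P.[a j] / (lagr a j).[a j] = P`_n.
Proof.
move=> ia sP.
have e : P = \sum_j (P.[a j] / (lagr a j).[a j]) *: lagr a j.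
  apply/eqP; rewrite -subr_eq0; apply/eqP; apply: (poly_eq0_points ia).
    apply: leq_trans (size_polyD _ _) _; rewrite size_polyN geq_max sP /=.
    apply: leq_trans (size_sum _ _ _) _; apply/bigmax_leqP => j _.
    by apply: leq_trans (size_scale_leq _ _) _; rewrite size_lagr.
  move=> i; rewrite hornerD hornerN horner_sum (bigD1 i) //= big1 => [|j ij].
    by rewrite addr0 hornerZ divfK ?subrr // lagr_self.
  by rewrite hornerZ (@lagr_neq a i j) ?mulr0 // eq_sym.
rewrite [in RHS]e coef_sum; apply: eq_bigr => j _.
by rewrite coefZ coef_lagr mulr1.
Qed.

(** Clearing denominators turns the system into a polynomial of degree at most [n] vanishing at the
    [N] points [b_m]; its value at [a_j] is a nonzero multiple of [x_j]. *)
Lemma cauchy_unique a b x : injective a -> injective b -> (forall j m, a j != b m) ->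
  (forall m, \sum_j x j / (a j - b m) = 0) -> forall j, x j = 0.
Proof.
move=> ia ib ab h j.
pose Q := \sum_j x j *: lagr a j.
have Q0 : Q = 0.
  apply: (poly_eq0_points ib).
    apply: leq_trans (size_sum _ _ _) _; apply/bigmax_leqP => i _.
    by apply: leq_trans (size_scale_leq _ _) _; rewrite size_lagr.
  move=> m; rewrite horner_sum.
  have d0 i : b m - a i != 0 by rewrite subr_eq0 eq_sym ab.
  have e i : (x i *: lagr a i).[b m] = - (\prod_k (b m - a k)) * (x i / (a i - b m)).
    rewrite hornerZ horner_lagr [in RHS](bigD1 i) //=.
    move: (\prod_(k | k != i) _) => q; field; by rewrite subr_eq0.
  by rewrite (eq_bigr _ (fun i _ => e i)) -mulr_sumr h mulr0.
have := congr1 (fun P : {poly R} => P.[a j]) Q0; rewrite horner0 /Q horner_sum (bigD1 j) //= big1.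
  by rewrite addr0 hornerZ => /eqP; rewrite mulf_eq0 (negbTE (lagr_self j ia)) orbF => /eqP.
by move=> i ij; rewrite hornerZ lagr_neq ?mulr0 // eq_sym.
Qed.

(* The solution of the Cauchy system [sum_j x_j / (a_j - b_m) = 1]. *)
Definition sqS a b (j : 'I_N) : R := (\prod_m (a j - b m)) / \prod_(k | k != j) (a j - a k).

(** [lagrange_lead] applied to the monic product of [X - b_k] over [k != m]. *)
Lemma cauchy_sol a b m : injective a -> (forall j k, a j != b k) ->
  \sum_j sqS a b j / (a j - b m) = 1.
Proof.
move=> ia ab; rewrite -[RHS](coef_lagr b m) -(lagrange_lead ia) ?size_lagr //.
apply: eq_bigr => j _; rewrite /sqS -horner_lagr (bigD1 m) //= -horner_lagr.
have d0 : a j - b m != 0 by rewrite subr_eq0.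
by rewrite mulrAC; congr (_ / _); rewrite mulrC mulKf.
Qed.

Definition interlaced a b :=
  (forall j, b j < a j) /\ (forall j k : 'I_N, k = j.+1 :> nat -> a k < b j).

(** The function [t -> sum_j S_j / (a_j - t)] increases between its poles and is negative beyond the
    largest one. As it takes the value [1] at each [b_m], some pole exceeds each [b_m] and a pole
    separates any two of them. *)
Lemma cauchy_interlaced a b (S : 'I_N -> R) :
  (forall i j : 'I_N, (i < j)%N -> a j < a i) -> (forall i j : 'I_N, (i < j)%N -> b j < b i) ->
  (forall j m, a j != b m) -> (forall j, 0 < S j) ->
  (forall m, \sum_j S j / (a j - b m) = 1) -> interlaced a b.
Proof.
move=> ad bd ab S0 h.
have ex m : exists j, b m < a j.
  apply: contrapT => hN; have := h m; apply/eqP; rewrite lt_eqF //.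
  apply: le_lt_trans ltr01; apply: sumr_le0 => j _.
  rewrite pmulr_rle0 // invr_le0 subr_le0 leNgt; apply/negP => hj.
  by apply: hN; exists j.
have sep (m m' : 'I_N) : (m < m')%N -> exists j, b m' < a j /\ a j < b m.
  move=> mm; apply: contrapT => hN.
  have bm := bd _ _ mm.
  have : \sum_j S j / (a j - b m') < \sum_j S j / (a j - b m).
    apply: ltr_sum; first by apply/hasP; exists ord0; rewrite ?mem_index_enum.
    move=> j _; rewrite ltr_pM2l //.
    case: (ltgtP (a j) (b m')) (ab j m') => // hj _.
      have hj2 : a j < b m by apply: lt_trans bm.
      by rewrite ltf_nV2 ?negrE ?subr_lt0 // ltrD2l ltrN2.
    case: (ltgtP (a j) (b m)) (ab j m) => // hj2 _; first by case: hN; exists j.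
    by rewrite ltf_pV2 ?posrE ?subr_gt0 // ltrD2l ltrN2.
  by rewrite !h ltxx.
(* [g m] is the last index whose pole lies above [b_m]; separation makes [g] strictly increasing,
   hence the identity. *)
have /choice [g hg] : forall m, exists j : 'I_N, b m < a j /\ forall k : 'I_N, (j < k)%N -> a k < b m.
  move=> m; have [i0 hi0] := ex m.
  case: (arg_maxnP (P := fun j => b m < a j) (fun j : 'I_N => val j) hi0) => j hj hmax.
  exists j; split => // k jk; case: (ltgtP (a k) (b m)) (ab k m) => // hk _.
  by have := hmax k hk; rewrite /geq /= leqNgt jk.
have gid : forall i, g i = i.
  apply: incr_ord_id => i j ij; have [k [k1 k2]] := sep _ _ ij.
  have [g1 g2] := hg j; have [g3 g4] := hg i.
  have h1 : (k <= g j)%N by rewrite leqNgt; apply/negP => /g2; rewrite ltNge ltW.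
  apply: leq_trans h1; rewrite ltnNge; apply/negP; rewrite leq_eqVlt => /orP[/eqP/val_inj e|/ad].
    by move: k2; rewrite e ltNge ltW.
  by move=> hk; have := lt_trans hk k2; rewrite ltNge ltW.
split => [j|j k e]; first by have [] := hg j; rewrite gid.
by have [_ h2] := hg j; apply: h2; rewrite gid e.
Qed.

Section Interlaced.
Variables (a b : 'I_N -> R).
Hypothesis ab : interlaced a b.

Lemma int_ba (j m : 'I_N) : (j <= m)%N -> b m < a j.
Proof.
case: ab => h1 h2; case: m => m; elim: m => [|m ih] hm.
  rewrite leqn0 => /eqP e; have -> : j = Ordinal hm by apply: val_inj.
  exact: h1.
rewrite leq_eqVlt => /orP[/eqP e|].
  have -> : j = Ordinal hm by apply: val_inj.
  exact: h1.
rewrite /= ltnS => jm; have hm' : (m < N)%N by apply: ltnW.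
apply: lt_trans (ih hm' jm); apply: lt_trans (h1 _) _; exact: h2.
Qed.

Lemma int_ab (j m : 'I_N) : (m < j)%N -> a j < b m.
Proof.
move=> mj; have hm : (m.+1 < N)%N by apply: leq_ltn_trans mj (ltn_ord j).
case: (ab) => h1 h2.
have hk := h2 m (Ordinal hm) erefl.
have [e|lt] := eqVneq (j : nat) m.+1.
  by have -> : j = Ordinal hm by apply: val_inj.
have hj : (0 < j)%N by apply: leq_ltn_trans mj.
have hj1 : (j.-1 < N)%N by apply: leq_ltn_trans (leq_pred _) (ltn_ord j).
apply: lt_trans (h2 (Ordinal hj1) j _) _; first by rewrite /= prednK.
apply: lt_trans (int_ba (j := Ordinal hm) (m := Ordinal hj1) _) hk => /=.
by rewrite -ltnS prednK // ltn_neqAle eq_sym lt.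
Qed.

Lemma int_neq j m : a j != b m.
Proof.
have [h|h] := leqP j m; first by rewrite gt_eqF // int_ba.
by rewrite lt_eqF // int_ab.
Qed.

Lemma int_adecr (i j : 'I_N) : (i < j)%N -> a j < a i.
Proof. by move=> ij; apply: lt_trans (int_ab ij) _; apply: int_ba. Qed.

Lemma int_bdecr (i j : 'I_N) : (i < j)%N -> b j < b i.
Proof. by move=> ij; apply: lt_trans (int_ab ij); apply: int_ba. Qed.

Lemma decr_inj (f : 'I_N -> R) : (forall i j : 'I_N, (i < j)%N -> f j < f i) -> injective f.
Proof. by move=> h i j e; apply: val_inj; case: (ltngtP i j) => // /h; rewrite e ltxx. Qed.

(** For [k != j], interlacing gives [a_j - b_k] and [a_j - a_k] the same sign. *)
Lemma sqS_gt0 j : 0 < sqS a b j.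
Proof.
have -> : sqS a b j = (a j - b j) * \prod_(k | k != j) ((a j - b k) / (a j - a k)).
  by rewrite /sqS (bigD1 j) //= prodf_div mulrA.
case: (ab) => h1 _; rewrite mulr_gt0 ?subr_gt0 //; apply: prodr_gt0 => k kj.
have [jk|jk|e] := ltngtP j k.
- by rewrite divr_gt0 // subr_gt0 ?int_adecr // int_ba // ltnW.
- rewrite -mulrNN mulr_gt0 // -?invrN ?invr_gt0 opprB subr_gt0 ?int_adecr //.
  exact: int_ab.
- by case/eqP: kj; apply: val_inj.
Qed.

(** The normalization that gives column [m] of the weighted Cauchy matrix unit length. *)
Definition sqK m : R := (\sum_j sqS a b j / (a j - b m) ^+ 2)^-1.

Lemma sqK_gt0 m : 0 < sqK m.
Proof.
rewrite invr_gt0; rewrite (bigD1 ord0) //= ltr_pwDl //.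
  rewrite divr_gt0 ?sqS_gt0 // lt_def sqr_ge0 andbT sqrf_eq0 subr_eq0; exact: int_neq.
by apply: sumr_ge0 => j _; rewrite divr_ge0 ?sqr_ge0 // ltW // sqS_gt0.
Qed.

(** By partial fractions this is the difference of the Cauchy equations [m] and [k], divided by
    [b_m - b_k]. *)
Lemma cauchy_orth m k : m != k -> \sum_j sqS a b j / ((a j - b m) * (a j - b k)) = 0.
Proof.
move=> mk; have d0 : b m - b k != 0 by rewrite subr_eq0 (inj_eq (decr_inj int_bdecr)).
apply: (mulfI d0); rewrite mulr0 mulr_sumr.
rewrite -[RHS](subrr 1) -{1}(cauchy_sol m (decr_inj int_adecr) int_neq).
rewrite -(cauchy_sol k (decr_inj int_adecr) int_neq) -sumrB; apply: eq_bigr => j _.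
have e1 : a j - b m != 0 by rewrite subr_eq0 int_neq.
have e2 : a j - b k != 0 by rewrite subr_eq0 int_neq.
by field; rewrite e1 e2.
Qed.

End Interlaced.
End CauchySystem.

(** * The symbol as a function of its spectral data *)

Section SpectralData.
Variables (R : realType) (n : nat).
Local Notation C := (R[i]).
Local Notation N := n.+1.
Implicit Types (lam mu : 'I_N -> R) (ep dl : 'I_N -> C).

Definition sq (lam : 'I_N -> R) := fun j => lam j ^+ 2.
(* [ssd], [kkd] are the moduli of [s_j = lam_j Y_0j] and [k_m = (s^* U)_m]; they are
   forced by the unitarity of [U], whose entries are [s_j k_m / (lam_j^2 - mu_m^2)]
   by the Stein equation [Lam^2 = s^T conj(s) + U Mu^2 U^*]. *)
Definition ssd lam mu j : R := Num.sqrt (sqS (sq lam) (sq mu) j).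
Definition kkd lam mu m : R := Num.sqrt (sqK (sq lam) (sq mu) m).
Definition Od lam mu j m : R := ssd lam mu j * kkd lam mu m / (lam j ^+ 2 - mu m ^+ 2).
Definition Ud lam mu ep dl : 'M[C]_N := \matrix_(j, m) (ep j * (Od lam mu j m)%:C%C * dl m).
Definition Ad lam mu ep dl : 'M[C]_N :=
  Ud lam mu ep dl *m rdiag mu *m (Ud lam mu ep dl)^T *m rdiag (fun j => (lam j)^-1).
Definition sd lam mu ep : 'rV[C]_N := \row_j ((ssd lam mu j)%:C%C * ep j).
Definition yd lam mu ep : 'rV[C]_N := sd lam mu ep *m rdiag (fun j => (lam j)^-1).
Definition Yd lam mu ep dl (k : nat) : 'rV[C]_N := yd lam mu ep *m Ad lam mu ep dl ^+ k.
Definition cd lam mu ep dl : seqC R := fun k => (Yd lam mu ep dl k *m (sd lam mu ep)^T) 0 0.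

Lemma rdiagM lam mu : rdiag lam *m rdiag mu = rdiag (fun j => lam j * mu j).
Proof.
apply/matrixP => i j; rewrite mul_diag_mx !mxE.
by case: eqP => [->|]; rewrite ?mulr1n ?mulr0n ?mulr0 // rmorphM.
Qed.

Lemma rdiag_tr lam : (rdiag lam)^T = rdiag lam.
Proof. by rewrite /rdiag tr_diag_mx. Qed.

Lemma rdiag_cj lam : cj (rdiag lam) = rdiag lam.
Proof.
apply/matrixP => i j; rewrite !mxE.
by case: eqP => _; rewrite ?mulr1n ?mulr0n ?rmorph0 // real_conj.
Qed.

Lemma rdiag_ct lam : ct (rdiag lam) = rdiag lam.
Proof. by rewrite /ct rdiag_cj rdiag_tr. Qed.

Lemma rdiagV lam : (forall j, lam j != 0) ->
  rdiag lam *m rdiag (fun j => (lam j)^-1) = 1%:M.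
Proof.
move=> l0; rewrite rdiagM; apply/matrixP => i j; rewrite !mxE.
by case: eqP => _; rewrite ?mulr1n ?mulr0n // mulfV.
Qed.

Lemma rdiagVl lam : (forall j, lam j != 0) ->
  rdiag (fun j => (lam j)^-1) *m rdiag lam = 1%:M.
Proof. by move=> l0; apply: mulmx1C; apply: rdiagV. Qed.

Lemma mulmx_sandwich m (e O d k l : 'M[C]_m) : e^T = e -> d^T = d ->
  e *m l = l *m e -> d *m k = k *m d ->
  e *m (e *m O *m d *m k *m (e *m O *m d)^T *m l) =
  e *m e *m O *m (d *m d) *m k *m O^T *m l *m e.
Proof.
move=> he hd el dk; rewrite !trmx_mul he hd !mulmxA -[RHS]mulmxA -el !mulmxA.
by rewrite -[in RHS](mulmxA _ d k) dk !mulmxA.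
Qed.

Section Phases.
(* Only the squares of the half-phases [ep], [dl] enter the symbol. *)
Variables (lam mu : 'I_N -> R).
Let Om : 'M[C]_N := \matrix_(j, m) (Od lam mu j m)%:C%C.
Let dg (e : 'I_N -> C) : 'M[C]_N := diag_mx (\row_j e j).
Let A2 (e2 d2 : 'I_N -> C) : 'M[C]_N :=
  dg e2 *m Om *m dg d2 *m rdiag mu *m Om^T *m rdiag (fun j => (lam j)^-1).
Let srow : 'rV[C]_N := \row_j (ssd lam mu j)%:C%C.

Let dgC e f : dg e *m dg f = dg f *m dg e.
Proof.
apply/matrixP => i j; rewrite !mul_diag_mx !mxE.
by case: eqP => [->|]; rewrite ?mulr1n ?mulr0n ?mulr0 // mulrC.
Qed.

Let dg2 e : dg e *m dg e = dg (fun j => e j ^+ 2).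
Proof.
apply/matrixP => i j; rewrite !mul_diag_mx !mxE.
by case: eqP => [->|]; rewrite ?mulr1n ?mulr0n ?mulr0 // expr2.
Qed.

Lemma cd_squares ep dl k : cd lam mu ep dl k =
  (srow *m rdiag (fun j => (lam j)^-1) *m A2 (fun j => ep j ^+ 2) (fun j => dl j ^+ 2) ^+ k
   *m dg (fun j => ep j ^+ 2) *m srow^T) 0 0.
Proof.
have eU : Ud lam mu ep dl = dg ep *m Om *m dg dl.
  by apply/matrixP => i j; rewrite mul_mx_diag mxE mul_diag_mx !mxE.
have es : sd lam mu ep = srow *m dg ep.
  by apply/rowP => i; rewrite mul_mx_diag !mxE.
have rd (l : 'I_N -> R) : rdiag l = dg (fun j => (l j)%:C%C) by [].
(* In [U Mu U^T] each [dl] meets its own copy across [Mu], and conjugation by [dg ep] brings the two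
   outer factors [ep] together. *)
have eA : dg ep *m Ad lam mu ep dl = A2 (fun j => ep j ^+ 2) (fun j => dl j ^+ 2) *m dg ep.
  by rewrite /Ad eU /A2 -!dg2; apply: mulmx_sandwich; rewrite ?tr_diag_mx // ?rd dgC.
have eAk : dg ep *m Ad lam mu ep dl ^+ k = A2 (fun j => ep j ^+ 2) (fun j => dl j ^+ 2) ^+ k *m dg ep.
  elim: k => [|k ih]; first by rewrite !expr0 mulmx1 mul1mx.
  by rewrite exprS -mulmxE mulmxA eA -mulmxA ih mulmxA mulmxE -exprS.
congr (fun M : 'M[C]_1 => M 0 0); rewrite /cd /Yd /yd es trmx_mul tr_diag_mx -/(dg ep) -dg2.
have := dgC ep (fun j => ((lam j)^-1)%:C%C); rewrite -!rd.
move: eAk; move: (_ ^+ k) (_ ^+ k) (dg ep) (rdiag _) srow => X X' e l r eX el.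
by rewrite -(mulmxA r e l) el !mulmxA -(mulmxA _ e X') eX !mulmxA.
Qed.

End Phases.

Lemma cd_eq lam mu ep dl ep' dl' :
  (forall j, ep j ^+ 2 = ep' j ^+ 2) -> (forall j, dl j ^+ 2 = dl' j ^+ 2) ->
  cd lam mu ep dl = cd lam mu ep' dl'.
Proof.
move=> he hd; apply/funext => k; rewrite !cd_squares.
by rewrite (funext he) (funext hd).
Qed.

Section Pair.
Variables (c : seqC R) (lam mu : 'I_N -> R) (Y : nat -> 'rV[C]_N) (U : 'M[C]_N).
Hypothesis HY : takagi c lam Y.
Hypothesis HZ : takagi (fun m => c m.+1) mu (fun k => Y k *m U).
Hypothesis UU : ct U *m U = 1%:M.
Hypotheses (l0 : forall j, 0 < lam j) (ld : forall i j : 'I_N, (i < j)%N -> lam j < lam i).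
Hypotheses (m0 : forall j, 0 < mu j) (md : forall i j : 'I_N, (i < j)%N -> mu j < mu i).
Let s : 'rV[C]_N := Y 0%N *m rdiag lam.
Let ka : 'rV[C]_N := cj s *m U.
Hypothesis s0 : forall j, s 0 j != 0.
Hypothesis ka0 : forall m, ka 0 m != 0.

Let Yg : mgeo Y. Proof. by case: HY. Qed.
Let YY : msum (fun k => ct (Y k) *m Y k) = 1%:M. Proof. by case: HY. Qed.
Let YYg : mgeo (fun k => ct (Y k) *m Y k).
Proof. by apply: mgeoM => //; apply: mgeo_ct. Qed.
Let lne j : lam j != 0. Proof. by rewrite gt_eqF. Qed.

Let cY k l : c (k + l)%N = (Y k *m rdiag lam *m (Y l)^T) 0 0.
Proof.
case: HY => _ _ ->; rewrite mul_mx_diag mxE; apply: eq_bigr => j _.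
by rewrite !mxE [X in X * _]mulrC.
Qed.

Let cZ k l : c (k + l).+1 = (Y k *m U *m rdiag mu *m U^T *m (Y l)^T) 0 0.
Proof.
case: HZ => _ _ /(_ k l) ->; rewrite -[_ *m U^T *m _]mulmxA -trmx_mul mul_mx_diag [RHS]mxE.
apply: eq_bigr => j _; rewrite [X in _ = X * _]mxE [X in _ = _ * X]mxE [X in _ = _ * X * _]mxE.
by rewrite [X in X * _]mulrC.
Qed.

(** Both expressions of [c (k + 1 + l)] give the same pairing with every [Y l], and a row orthogonal
    to all of these is zero since their Gram sum is the identity. *)
Lemma pair_shift k : Y k.+1 *m rdiag lam = Y k *m U *m rdiag mu *m U^T.
Proof.
apply/eqP; rewrite -subr_eq0; apply/eqP; set D := _ - _.
have hX l : D *m (Y l)^T = 0.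
  rewrite /D mulmxBl; apply/matrixP => i j; rewrite !ord1 [LHS]mxE [X in _ + X]mxE.
  by rewrite -cY -cZ addSn subrr mxE.
have e : msum (fun l => (Y l)^T *m cj (Y l)) = 1%:M.
  rewrite -[RHS]cj1 -YY -msum_cj //; apply: eq_msum => l; by rewrite cjM cj_ct.
have g : mgeo (fun l => (Y l)^T *m cj (Y l)).
  by apply: mgeoM; [apply: mgeo_tr|apply: mgeo_cj].
rewrite -[D]mulmx1 -e -msum_mull //; apply/matrixP => i j; rewrite !mxE.
rewrite (eq_csum (g := fun=> 0)) ?csum0 // => l.
by rewrite mulmxA hX mul0mx mxE.
Qed.

(** The Gram identity is multiplied by [Lam] on both sides, its first term is split off and the tail
    is rewritten by [pair_shift]; conjugation and multiplication by [U] finish. *)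
Lemma pair_stein : rdiag (sq lam) *m U = s^T *m ka + U *m rdiag (sq mu).
Proof.
have e : rdiag (sq lam) = ct s *m s + cj U *m rdiag (sq mu) *m U^T.
  have -> : rdiag (sq lam) = rdiag lam *m msum (fun k => ct (Y k) *m Y k) *m rdiag lam.
    by rewrite YY mulmx1 rdiagM; congr rdiag; apply/funext => j; rewrite /sq expr2.
  rewrite (msum_recl YYg) mulmxDr mulmxDl; congr (_ + _).
    by rewrite /s ctM rdiag_ct !mulmxA.
  rewrite -msum_mull; last exact: (mgeoS YYg).
  rewrite -msum_mulr; last by apply: mgeo_mull; exact: (mgeoS YYg).
  pose W := U *m rdiag mu *m U^T.
  rewrite (eq_msum (M' := fun k => ct W *m (ct (Y k) *m Y k) *m W)).
    rewrite msum_mulr; last exact: mgeo_mull.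
    rewrite msum_mull // YY mulmx1 /W !ctM ct_tr rdiag_ct !mulmxA.
    rewrite -(mulmxA _ (ct U) U) UU mulmx1 -(mulmxA _ (rdiag mu) (rdiag mu)) rdiagM.
    by congr (_ *m rdiag _ *m _); apply/funext => j; rewrite /sq expr2.
  move=> k; rewrite !mulmxA -(mulmxA _ (Y k.+1)) pair_shift.
  have -> : rdiag lam *m ct (Y k.+1) = ct (Y k *m W).
    by rewrite -[rdiag lam]rdiag_ct -ctM pair_shift /W !mulmxA.
  by rewrite ctM /W !mulmxA.
have := congr1 (@cj R _ _) e; rewrite cjD (cjM (ct s)) (cjM _ U^T) (cjM (cj U)) !rdiag_cj cj_ct cjK cj_tr -/(ct U) => ->.
rewrite mulmxDl /ka !mulmxA; congr (_ + _).
by rewrite -(mulmxA _ (ct U)) UU mulmx1.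
Qed.

Lemma pair_entry j m : U j m * (lam j ^+ 2 - mu m ^+ 2)%:C%C = s 0 j * ka 0 m.
Proof.
have /matrixP /(_ j m) := pair_stein.
rewrite mul_diag_mx mul_mx_diag [LHS]mxE [RHS]mxE [X in _ = X + _]mxE big_ord1.
rewrite [X in _ = X * _ + _]mxE [X in _ = _ + X]mxE ![(\row__ _) _ _]mxE => e.
by rewrite rmorphB /= mulrBr mulrC e addrK.
Qed.

Lemma pair_neq j m : lam j ^+ 2 != mu m ^+ 2.
Proof.
apply/eqP => e; have := pair_entry j m; rewrite e subrr mulr0 => /esym/eqP.
by rewrite mulf_eq0 (negbTE (s0 j)) (negbTE (ka0 m)).
Qed.

Let dne j m : (lam j ^+ 2 - mu m ^+ 2)%:C%C != 0 :> C.
Proof. by rewrite -[0]/(0%:C%C) (inj_eq (@complexI R)) subr_eq0 pair_neq. Qed.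

Let Ue j m : U j m = s 0 j * ka 0 m / (lam j ^+ 2 - mu m ^+ 2)%:C%C.
Proof. by rewrite -pair_entry mulfK. Qed.

Let S j : R := cabs (s 0 j) ^+ 2.
Let Ss j : (S j)%:C%C = (s 0 j)^* * s 0 j.
Proof. by rewrite /S rmorphXn /= -cabsE normCK mulrC. Qed.
Let S0 j : 0 < S j.
Proof.
rewrite exprn_gt0 // lt_def cabs_ge0 andbT; apply: contra (s0 j) => /eqP /cabs_eq0 ->.
exact: eqxx.
Qed.

(** The definition [ka = cj s U] with the Cauchy form of [U] inserted has the factor [ka_m] on both
    sides. *)
Lemma pair_cauchy m : \sum_j S j / (sq lam j - sq mu m) = 1.
Proof.
apply: (@complexI R); rewrite rmorph_sum rmorph1 /=.
apply: (mulIf (ka0 m)); rewrite mul1r [in RHS]/ka [RHS]mxE mulr_suml.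
apply: eq_bigr => j _; rewrite cjE Ue rmorphM fmorphV /= Ss.
by rewrite mulrAC !mulrA.
Qed.

Let am : injective (sq lam).
Proof. by move=> i j /eqP; rewrite /sq eqrXn2 ?ltW // => /eqP; apply: (lam_inj ld). Qed.
Let bm : injective (sq mu).
Proof. by move=> i j /eqP; rewrite /sq eqrXn2 ?ltW // => /eqP; apply: (lam_inj md). Qed.

Lemma pair_interlaced : interlaced (sq lam) (sq mu).
Proof.
apply: cauchy_interlaced pair_neq S0 pair_cauchy.
- by move=> i j /ld h; rewrite /sq ltrXn2r // ?ltW.
- by move=> i j /md h; rewrite /sq ltrXn2r // ?ltW.
Qed.

Let Sval j : S j = sqS (sq lam) (sq mu) j.
Proof.
apply/eqP; rewrite -subr_eq0; apply/eqP.
apply: (cauchy_unique (x := fun j => S j - sqS (sq lam) (sq mu) j) am bm pair_neq) => m.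
under eq_bigr => i _ do rewrite mulrBl.
by rewrite sumrB pair_cauchy (cauchy_sol m am pair_neq) subrr.
Qed.

Let sabs j : cabs (s 0 j) = ssd lam mu j.
Proof. by rewrite /ssd -Sval sqrtr_sqr ger0_norm // cabs_ge0. Qed.

Let kabs m : cabs (ka 0 m) = kkd lam mu m.
Proof.
rewrite /kkd; have -> : sqK (sq lam) (sq mu) m = cabs (ka 0 m) ^+ 2.
  have /matrixP /(_ m m) := UU; rewrite mxE [RHS]mxE eqxx => h.
  have {h} : (cabs (ka 0 m) ^+ 2) * \sum_j sqS (sq lam) (sq mu) j / (sq lam j - sq mu m) ^+ 2 = 1.
    apply: (@complexI R); rewrite rmorph1 -[RHS]h rmorphM rmorph_sum mulr_sumr.
    apply: eq_bigr => j _; rewrite ctE [in RHS]mulrC -normCK cabsE Ue !cabsM.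
    rewrite -[RHS]rmorphXn -rmorphM /=; congr (_%:C)%C.
    rewrite -Sval /S !exprMn mulrCA mulrA; congr (_ * _).
    have -> (x : R) : (x%:C%C)^-1 = (x^-1)%:C%C :> C by rewrite fmorphV.
    by rewrite cabs_real real_normK ?num_real // exprVn.
  move=> h; rewrite /sqK; apply/esym; apply: (mulIf (x := \sum_j sqS (sq lam) (sq mu) j / (sq lam j - sq mu m) ^+ 2)).
    by apply/eqP => e; move: h; rewrite e mulr0 => /esym/eqP; rewrite oner_eq0.
  rewrite h mulVf //; by apply/eqP => e; move: h; rewrite e mulr0 => /esym/eqP; rewrite oner_eq0.
by rewrite sqrtr_sqr ger0_norm // cabs_ge0.
Qed.

Let ep j : C := s 0 j / (ssd lam mu j)%:C%C.
Let dl m : C := ka 0 m / (kkd lam mu m)%:C%C.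

Let ssne j : (ssd lam mu j)%:C%C != 0 :> C.
Proof. by rewrite -sabs -cabsE normr_eq0. Qed.
Let kkne m : (kkd lam mu m)%:C%C != 0 :> C.
Proof. by rewrite -kabs -cabsE normr_eq0. Qed.

(** The moduli of [s] and [ka] are forced, by [cauchy_unique] and by the unit columns of [U], so
    [ep] and [dl] are unimodular. The angles follow from [Y_0j = s_j / lam_j] and from the inner
    product of [c] with column [m] of [Y U], which is the conjugate of [ka_m]. *)
Lemma pair_cd : [/\ c = cd lam mu ep dl, (forall j, `|ep j| = 1), (forall m, `|dl m| = 1) &
  chi N c = (fun j => 2 * lam j ^+ 2, fun m => 2 * mu m ^+ 2,
             fun j => ((ep j)^*) ^+ 2, fun m => ((dl m)^*) ^+ 2)].
Proof.
have ne j : `|ep j| = 1.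
  by rewrite normrM normfV !cabsE sabs cabs_real ger0_norm ?sqrtr_ge0 // mulfV.
have nd m : `|dl m| = 1.
  by rewrite normrM normfV !cabsE kabs cabs_real ger0_norm ?sqrtr_ge0 // mulfV.
have es : s = sd lam mu ep.
  by apply/rowP => j; rewrite [RHS]mxE /ep mulrC divfK.
have eU : U = Ud lam mu ep dl.
  apply/matrixP => j m; rewrite [RHS]mxE Ue /ep /dl /Od.
  rewrite !rmorphM /= fmorphV /=; move: (ssne j) (kkne m) (dne j m).
  move: (_%:C%C) => x; move: (_%:C%C) => y; move: (_%:C%C) => z => h1 h2 h3.
  by field; rewrite h1 h2 h3.
have eY k : Y k = Yd lam mu ep dl k.
  have e0 : Y 0%N = yd lam mu ep by rewrite /yd -es /s -mulmxA rdiagV // mulmx1.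
  elim: k => [|k ih]; first by rewrite /Yd expr0 mulmx1.
  rewrite /Yd exprSr -mulmxE mulmxA -/(Yd _ _ _ _ k) -ih /Ad -eU !mulmxA -pair_shift.
  by rewrite -mulmxA rdiagV // mulmx1.
have ec : c = cd lam mu ep dl.
  apply/funext => k; rewrite -[k]addn0 cY /cd -eY -es /s trmx_mul rdiag_tr -mulmxA addn0 //.
have phase_sq (x : C) (r : R) : 0 < r -> `|x| = 1 -> phase ((r%:C%C * x) ^+ 2) = x ^+ 2.
  move=> r0 nx; rewrite /phase normrX normrM nx mulr1 cabsE cabs_real gtr0_norm // exprMn.
  by rewrite [_ * x ^+ 2]mulrC mulfK // expf_neq0 // -[0]/(0%:C%C) (inj_eq (@complexI R)) gt_eqF.
split => //; rewrite (chi_takagi HY HZ) //; congr (_, _, _, _); apply/funext => j.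
  have -> : Y 0%N 0 j = (ssd lam mu j / lam j)%:C%C * ep j.
    by rewrite eY /Yd expr0 mulmx1 /yd mul_mx_diag !mxE rmorphM /= mulrAC.
  rewrite rmorphM /= real_conj phase_sq ?norm_conjC // divr_gt0 // lt_def sqrtr_ge0 andbT.
  by apply: contra (ssne j) => /eqP ->.
have -> : hk_inner c (fun k => (Y k *m U) 0 j) = (ka 0 j)^*.
  rewrite {1}(tak_comb HY).
  have -> : comb Y (fun j => (lam j)%:C%C * Y 0%N 0 j) = comb (fun k => Y k *m U) (fun m => (ka 0 m)^*).
    apply/funext => k.
    have h (v : 'cV[C]_N) (X : nat -> 'rV[C]_N) : comb X (fun j => v j 0) k = (X k *m v) 0 0.
      by rewrite mxE; apply: eq_bigr => i _; rewrite mulrC.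
    have -> : (fun j => (lam j)%:C%C * Y 0%N 0 j) = (fun j => s^T j 0).
      by apply/funext => i; rewrite mxE /s mul_mx_diag mxE [(\row__ _) _ _]mxE mulrC.
    have -> : (fun m => (ka 0 m)^*) = (fun j => (ct ka) j 0).
      by apply/funext => i; rewrite ctE.
    rewrite !h /ka ctM ct_cj -!mulmxA (mulmxA U).
    by rewrite (mulmx1C UU) mul1mx.
  by rewrite (inner_comb HZ).
have -> : ka 0 j = (kkd lam mu j)%:C%C * dl j by rewrite /dl mulrC divfK.
rewrite rmorphM /= real_conj phase_sq ?norm_conjC // lt_def sqrtr_ge0 andbT.
by apply: contra (kkne j) => /eqP ->.
Qed.

End Pair.
End SpectralData.

(** * Reconstruction of a symbol from arbitrary admissible data *)

Section Reconstruction.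
Variables (R : realType) (n : nat).
Local Notation C := (R[i]).

Lemma contr_eig m (A : 'M[C]_m) (y : 'rV[C]_m) (x : 'cV[C]_m) z :
  ct A *m A = 1%:M - ct y *m y -> A *m x = z *: x ->
  z^* * z * (ct x *m x) 0 0 = (ct x *m x) 0 0 - ((y *m x) 0 0)^* * (y *m x) 0 0.
Proof.
move=> h hx.
have e : ct (A *m x) *m (A *m x) = ct x *m x - ct (y *m x) *m (y *m x).
  by rewrite !ctM -!mulmxA (mulmxA (ct A)) h mulmxBl mul1mx mulmxBr !mulmxA.
have := congr1 (fun M : 'M[C]_1 => M 0 0) e; rewrite /= hx ctZ -scalemxAl -scalemxAr scalerA.
rewrite [LHS]mxE => ->; rewrite [LHS]mxE [X in _ + X]mxE; congr (_ - _).
by rewrite [LHS]mxE big_ord1 ctE.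
Qed.

Lemma symm_pow m (A L : 'M[C]_m) k : A *m L = L *m A^T ->
  A ^+ k *m L = L *m (A ^+ k)^T.
Proof.
move=> h; elim: k => [|k ih]; first by rewrite !expr0 trmx1 mulmx1 mul1mx.
by rewrite [in RHS]exprS [in LHS]exprSr -!mulmxE trmx_mul -mulmxA h mulmxA ih mulmxA.
Qed.

Local Notation N := n.+1.
Variables (lam mu : 'I_N -> R) (ep dl : 'I_N -> C).
Hypotheses (l0 : forall j, 0 < lam j) (m0 : forall j, 0 < mu j).
Hypothesis hint : interlaced (sq lam) (sq mu).
Hypotheses (ne : forall j, `|ep j| = 1) (nd : forall j, `|dl j| = 1).

Local Notation U := (Ud lam mu ep dl).
Local Notation A := (Ad lam mu ep dl).
Local Notation s := (sd lam mu ep).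
Local Notation y := (yd lam mu ep).
Local Notation Y := (Yd lam mu ep dl).
Local Notation c := (cd lam mu ep dl).
Let ka : 'rV[C]_N := \row_m ((kkd lam mu m)%:C%C * dl m).

Let epc j : (ep j)^* * ep j = 1.
Proof. by rewrite mulrC -normCK ne expr1n. Qed.
Let dlc j : (dl j)^* * dl j = 1.
Proof. by rewrite mulrC -normCK nd expr1n. Qed.
Let dne j m : lam j ^+ 2 - mu m ^+ 2 != 0.
Proof. by rewrite subr_eq0; apply: (int_neq hint). Qed.
Let lne j : lam j != 0. Proof. by rewrite gt_eqF. Qed.

Let ss2 j : ssd lam mu j ^+ 2 = sqS (sq lam) (sq mu) j.
Proof. by rewrite sqr_sqrtr // ltW // sqS_gt0. Qed.
Let kk2 m : kkd lam mu m ^+ 2 = sqK (sq lam) (sq mu) m.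
Proof. by rewrite sqr_sqrtr // ltW // sqK_gt0. Qed.
Lemma ssd_gt0 j : 0 < ssd lam mu j.
Proof. by rewrite sqrtr_gt0 sqS_gt0. Qed.
Lemma kkd_gt0 m : 0 < kkd lam mu m.
Proof. by rewrite sqrtr_gt0 sqK_gt0. Qed.

Let Uent j m : U j m = ep j * (Od lam mu j m)%:C%C * dl m.
Proof. by rewrite mxE. Qed.
Let conj3 (a b : C) (r : R) : (a * r%:C%C * b)^* = a^* * r%:C%C * b^*.
Proof. by rewrite !rmorphM /= real_conj. Qed.

Let ainj : injective (sq lam). Proof. exact: decr_inj (int_adecr hint). Qed.

(** The phases cancel in each entry; what remains is [cauchy_orth] off the diagonal and the
    definition of [sqK] on it. *)
Lemma data_UU : ct U *m U = 1%:M.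
Proof.
apply/matrixP => m k; rewrite mxE [RHS]mxE.
have e j : ct U m j * U j k = (dl m)^* * dl k *
    (kkd lam mu m * kkd lam mu k * (sqS (sq lam) (sq mu) j /
      ((sq lam j - sq mu m) * (sq lam j - sq mu k))))%:C%C.
  rewrite ctE !Uent conj3.
  have -> (x x' : C) : (ep j)^* * x * (dl m)^* * (ep j * x' * dl k) =
    ((ep j)^* * ep j) * ((dl m)^* * dl k * (x * x')) by ring.
  rewrite epc mul1r -rmorphM; congr (_ * _%:C%C); rewrite -ss2 /Od /sq.
  by field; rewrite !dne.
rewrite (eq_bigr _ (fun j _ => e j)) -mulr_sumr -rmorph_sum -mulr_sumr /=.
case: (eqVneq m k) => [<-|mk]; last by rewrite (cauchy_orth hint mk) mulr0 mulr0.
rewrite dlc mul1r -expr2 kk2 /sqK (eq_bigr (fun j => sqS (sq lam) (sq mu) j / (sq lam j - sq mu m) ^+ 2)).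
  rewrite mulVf //; have := sqK_gt0 hint m; rewrite /sqK invr_gt0 => h; by rewrite gt_eqF.
by move=> j _; rewrite expr2.
Qed.

Let UUc : U *m ct U = 1%:M. Proof. by apply: mulmx1C; exact: data_UU. Qed.

Lemma data_ka : cj s *m U = ka.
Proof.
apply/rowP => m; rewrite mxE [RHS]mxE.
have e j : cj s 0 j * U j m = (kkd lam mu m)%:C%C * dl m *
    (sqS (sq lam) (sq mu) j / (sq lam j - sq mu m))%:C%C.
  rewrite cjE Uent [s 0 j]mxE rmorphM /= real_conj.
  have -> (x o : C) : x * (ep j)^* * (ep j * o * dl m) = ((ep j)^* * ep j) * (dl m * (x * o)) by ring.
  have -> (x q : C) : x * dl m * q = dl m * (x * q) by ring.
  rewrite epc mul1r -!rmorphM; congr (_ * _%:C%C); rewrite -ss2 /Od /sq.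
  by field; rewrite dne.
by rewrite (eq_bigr _ (fun j _ => e j)) -mulr_sumr -rmorph_sum /= (cauchy_sol m ainj (int_neq hint)) rmorph1 mulr1.
Qed.

Lemma data_stein : rdiag (sq lam) = s^T *m cj s + U *m rdiag (sq mu) *m ct U.
Proof.
rewrite -[LHS]mulmx1 -UUc mulmxA.
have -> : rdiag (sq lam) *m U = s^T *m ka + U *m rdiag (sq mu).
  apply/matrixP => j m; rewrite mul_diag_mx mul_mx_diag [LHS]mxE [RHS]mxE.
  rewrite [X in _ = X + _]mxE big_ord1 [X in _ = _ + X]mxE Uent !mxE /sq.
  have : lam j ^+ 2 * Od lam mu j m = ssd lam mu j * kkd lam mu m + Od lam mu j m * mu m ^+ 2.
    by rewrite /Od; field; rewrite dne.
  move: (Od lam mu j m) => o /(congr1 (real_complex R)); rewrite rmorphD !rmorphM /= => e.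
  have -> (a : C) : a * (ep j * o%:C%C * dl m) = ep j * dl m * (a * o%:C%C) by ring.
  by rewrite e; ring.
by rewrite mulmxDl -mulmxA -data_ka mulmxA -!mulmxA UUc mulmx1.
Qed.

Let ALam : A *m rdiag lam = U *m rdiag mu *m U^T.
Proof. by rewrite /Ad -[LHS]mulmxA rdiagVl // mulmx1. Qed.

Let ALs : A *m rdiag lam = rdiag lam *m A^T.
Proof. by rewrite -[rdiag lam in RHS]rdiag_tr -trmx_mul ALam !trmx_mul trmxK rdiag_tr mulmxA. Qed.

Let yL : y *m rdiag lam = s.
Proof. by rewrite /yd -mulmxA rdiagVl // mulmx1. Qed.

(** This is [data_stein] conjugated and divided by [Lam] on both sides: the transfer matrix is a
    contraction with defect of rank one. *)
Lemma data_contr : ct A *m A = 1%:M - ct y *m y.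
Proof.
have inj (X X' : 'M[C]_N) : rdiag lam *m X *m rdiag lam = rdiag lam *m X' *m rdiag lam -> X = X'.
  move=> e; have := congr1 (fun M => rdiag (fun j => (lam j)^-1) *m M *m rdiag (fun j => (lam j)^-1)) e.
  by rewrite /= !mulmxA rdiagVl // !mul1mx -!mulmxA rdiagV // !mulmx1.
apply: inj; rewrite mulmxBr mulmx1 mulmxBl.
have -> : rdiag lam *m (ct A *m A) *m rdiag lam = ct (A *m rdiag lam) *m (A *m rdiag lam).
  by rewrite ctM rdiag_ct !mulmxA.
have -> : rdiag lam *m (ct y *m y) *m rdiag lam = ct s *m s.
  by rewrite -yL ctM rdiag_ct !mulmxA.
have -> : rdiag lam *m rdiag lam = rdiag (sq lam).
  by rewrite rdiagM; congr rdiag; apply/funext => j; rewrite /sq expr2.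
have := congr1 (@cj R _ _) data_stein; rewrite rdiag_cj cjD (cjM s^T) (cjM _ (ct U)) (cjM U) cjK cj_ct rdiag_cj cj_tr -/(ct s) => ->.
rewrite ALam !ctM ct_tr rdiag_ct [ct s *m s + _]addrC addrK !mulmxA.
rewrite -(mulmxA _ (ct U) U) data_UU mulmx1 -(mulmxA _ (rdiag mu) (rdiag mu)) rdiagM.
by congr (_ *m rdiag _ *m _); apply/funext => j; rewrite /sq expr2.
Qed.

Let yne j : y 0 j != 0.
Proof.
rewrite /yd mul_mx_diag !mxE; rewrite !mulf_neq0 //.
- by rewrite -[0]/(0%:C%C) (inj_eq (@complexI R)) gt_eqF // ssd_gt0.
- by rewrite -normr_eq0 ne oner_eq0.
- by rewrite -[0]/(0%:C%C) (inj_eq (@complexI R)) invr_eq0.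
Qed.

Lemma nsq_ge0 (w : 'cV[C]_N) : 0 <= (ct w *m w) 0 0.
Proof. by rewrite mxE; apply: sumr_ge0 => j _; rewrite ctE mulC_ge0. Qed.

Lemma nsq_eq0 (w : 'cV[C]_N) : (ct w *m w) 0 0 = 0 -> w = 0.
Proof.
move=> h; apply/colP => j; rewrite [RHS]mxE.
have : ct w 0 j * w j 0 = 0.
  apply: (psumr_eq0P (P := xpredT) (F := fun j => ct w 0 j * w j 0)) => //.
    by move=> i _; rewrite ctE mulC_ge0.
  by rewrite -[RHS]h mxE.
by rewrite ctE => /eqP; rewrite mulf_eq0 conjC_eq0 orbb => /eqP.
Qed.

(* An eigenspace of [A] for a unimodular eigenvalue would be orthogonal to [y]
   and stable under the antilinear map [w |-> Lam cj w], hence under [Lam^2]. *)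
Lemma data_stable z : root (char_poly A) z -> `|z| < 1.
Proof.
move=> /root_char_col [w w0 hw].
rewrite real_ltNge ?normr_real //; apply/negP => z1.
have key (x : 'cV[C]_N) : A *m x = z *: x -> (y *m x) 0 0 = 0 /\ A *m (rdiag lam *m cj x) = z *: (rdiag lam *m cj x).
  move=> hx.
  have e : z^* * z * (ct x *m x) 0 0 = (ct x *m x) 0 0 - ((y *m x) 0 0)^* * (y *m x) 0 0.
    exact: contr_eig data_contr hx.
  have z2 : 1 <= z^* * z by rewrite mulrC -normCK exprn_ege1.
  have n0 := nsq_ge0 x; have q0 := mulC_ge0 ((y *m x) 0 0).
  have q1 : ((y *m x) 0 0)^* * (y *m x) 0 0 = 0.
    apply/eqP; rewrite eq_le q0 andbT.
    have -> : ((y *m x) 0 0)^* * (y *m x) 0 0 = (1 - z^* * z) * (ct x *m x) 0 0.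
      by rewrite mulrBl mul1r e opprB addrCA subrr addr0.
    by rewrite mulr_le0_ge0 // subr_le0.
  have yx : (y *m x) 0 0 = 0 by move/eqP: q1; rewrite mulf_eq0 conjC_eq0 orbb => /eqP.
  split => //.
  have yx0 : y *m x = 0 by apply/matrixP => i j; rewrite !ord1 yx mxE.
  have aax : z *: (ct A *m x) = x.
    rewrite scalemxAr -hx mulmxA data_contr mulmxBl mul1mx -mulmxA yx0 mulmx0 subr0 //.
  have z0 : z != 0 by apply/eqP => z0; move: z1; rewrite z0 normr0 ler10.
  have [x0|xn0] := eqVneq x 0; first by rewrite x0 /cj map_mx0 !mulmx0 scaler0.
  have zz : z^* * z = 1.
    move: e; rewrite q1 subr0 => /eqP; rewrite -subr_eq0 -{2}[(ct x *m x) 0 0]mul1r -mulrBl mulf_eq0.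
    case/orP; first by rewrite subr_eq0 => /eqP.
    by move=> /eqP/nsq_eq0 h; rewrite h eqxx in xn0.
  (* Conjugated, this is an eigenvector of [A^T]; the symmetry [A Lam = Lam A^T] carries it to the
     eigenvector [Lam cj x] of [A] for the same [z]. *)
  have ax : ct A *m x = z^* *: x by rewrite -{2}aax scalerA zz scale1r.
  rewrite mulmxA ALs -mulmxA; have -> : A^T *m cj x = z *: cj x.
    by have := congr1 (@cj R _ _) ax; rewrite cjM cj_ct cjZ conjCK.
  by rewrite -scalemxAr.
have keyk k : A *m (rdiag (fun j => (lam j ^+ 2) ^+ k) *m w) = z *: (rdiag (fun j => (lam j ^+ 2) ^+ k) *m w).
  elim: k => [|k ih].
    have -> : rdiag (fun j => (lam j ^+ 2) ^+ 0) = 1%:M.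
      by apply/matrixP => i j; rewrite !mxE expr0.
    by rewrite mul1mx.
  have [_ h1] := key _ ih; have [_ h2] := key _ h1.
  move: h2; rewrite cjM rdiag_cj cjK !mulmxA.
  have <- : rdiag lam *m rdiag lam *m rdiag (fun j => lam j ^+ 2 ^+ k) = rdiag (fun j => lam j ^+ 2 ^+ k.+1).
    by rewrite !rdiagM; congr rdiag; apply/funext => j; rewrite -expr2 -exprS.
  by rewrite !mulmxA.
have hv k : \sum_j (y 0 j * w j 0) * ((lam j ^+ 2)%:C%C) ^+ k = 0.
  have [h _] := key _ (keyk k); rewrite -[RHS]h [RHS]mxE; apply: eq_bigr => j _.
  rewrite mul_diag_mx [X in _ = _ * X]mxE [X in _ = _ * (X * _)]mxE.
  have -> (x : R) : (x%:C%C : C) ^+ k = (x ^+ k)%:C%C by rewrite rmorphXn.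
  by rewrite -mulrA; congr (_ * _); rewrite mulrC.
have vi : injective (fun j => (lam j ^+ 2)%:C%C : C) by move=> i j /complexI /ainj.
have /(_ _) h := vandermonde_eq0 vi hv.
case/eqP: w0; apply/colP => j; rewrite mxE; have /eqP := h j.
by rewrite mulf_eq0 (negbTE (yne j)) => /eqP.
Qed.

Lemma data_Ageo : mgeo (fun k => A ^+ k).
Proof. exact: stable_powers_geo data_stable. Qed.

Let Yg : mgeo Y. Proof. by apply: mgeo_mull; exact: data_Ageo. Qed.
Let YYg : mgeo (fun k => ct (Y k) *m Y k).
Proof. by apply: mgeoM => //; apply: mgeo_ct. Qed.

Let YS k : Y k.+1 = Y k *m A.
Proof. by rewrite /Yd exprSr -mulmxE mulmxA. Qed.

Let Y0 : Y 0%N = y. Proof. by rewrite /Yd expr0 mulmx1. Qed.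

(** The Gram sum and the identity solve the same Stein equation; their difference [D] satisfies
    [D = (A^k)^* D A^k] for every [k] and decays. *)
Lemma data_gram : msum (fun k => ct (Y k) *m Y k) = 1%:M.
Proof.
set G := msum _.
have e : G = ct y *m y + ct A *m G *m A.
  rewrite {1}/G msum_recl // Y0; congr (_ + _).
  rewrite -msum_mull // -msum_mulr; last exact: mgeo_mull.
  by apply: eq_msum => k; rewrite YS ctM !mulmxA.
have e1 : G - 1%:M = ct A *m (G - 1%:M) *m A.
  rewrite mulmxBr mulmx1 mulmxBl data_contr {1}e opprB.
  by rewrite addrCA addrA.
have ek k : G - 1%:M = ct (A ^+ k) *m (G - 1%:M) *m A ^+ k.
  elim: k => [|k ih]; first by rewrite expr0 ct1 mul1mx mulmx1.
  by rewrite {1}ih {1}e1 exprS -mulmxE ctM !mulmxA.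
apply/eqP; rewrite -subr_eq0; apply/eqP.
apply: (mgeo_eq0 (M := fun k => ct (A ^+ k) *m (G - 1%:M) *m A ^+ k)) => //.
by apply: mgeoM data_Ageo; apply: mgeo_mulr; apply: mgeo_ct; exact: data_Ageo.
Qed.

Let AkL k : A ^+ k *m rdiag lam = rdiag lam *m (A ^+ k)^T.
Proof.
exact: symm_pow ALs.
Qed.

Let sT : s^T = rdiag lam *m y^T.
Proof. by rewrite -yL trmx_mul rdiag_tr. Qed.

(** The power [A^l] crosses [Lam] as its transpose and is absorbed by the second row. *)
Lemma data_hankel k l : c (k + l)%N = (Y k *m rdiag lam *m (Y l)^T) 0 0.
Proof.
have e : Y (k + l)%N = Y k *m A ^+ l by rewrite /Yd exprD -mulmxE mulmxA.
have e' : (Y l)^T = (A ^+ l)^T *m y^T by rewrite /Yd trmx_mul.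
rewrite /cd e e' sT; have := AkL l; move: (A ^+ l) (rdiag lam) (Y k) => X L y' h.
by rewrite -!mulmxA (mulmxA X L) h !mulmxA.
Qed.

Lemma data_takagi : takagi c lam Y.
Proof.
split => //; first exact: data_gram.
move=> k l; rewrite data_hankel mul_mx_diag mxE; apply: eq_bigr => j _.
by rewrite !mxE [X in X * _]mulrC.
Qed.

Lemma data_takagi1 : takagi (fun k => c k.+1) mu (fun k => Y k *m U).
Proof.
split; first exact: mgeo_mulr.
  rewrite (eq_msum (M' := fun k => ct U *m (ct (Y k) *m Y k) *m U)).
    rewrite msum_mulr; last exact: mgeo_mull.
    by rewrite msum_mull // data_gram mulmx1 data_UU.
  by move=> k; rewrite ctM !mulmxA.
move=> k l; rewrite -addSn data_hankel YS -(mulmxA (Y k)) ALam !mulmxA.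
rewrite -[_ *m U^T *m _]mulmxA -trmx_mul mul_mx_diag mxE.
apply: eq_bigr => j _; rewrite [X in X * _ = _]mxE [X in _ * X = _]mxE [X in _ * X * _ = _]mxE.
by rewrite [X in X * _ = _]mulrC.
Qed.

Lemma lam_decr (i j : 'I_N) : (i < j)%N -> lam j < lam i.
Proof.
move=> /(int_adecr hint); rewrite /sq => h.
by move: h; rewrite ltr_pXn2r ?nnegrE ?ltW.
Qed.

Lemma mu_decr (i j : 'I_N) : (i < j)%N -> mu j < mu i.
Proof.
move=> /(int_bdecr hint); rewrite /sq => h.
by move: h; rewrite ltr_pXn2r ?nnegrE ?ltW.
Qed.

Let Y0L : Y 0%N *m rdiag lam = s. Proof. by rewrite /Yd expr0 mulmx1 yL. Qed.

Let sne j : (Y 0%N *m rdiag lam) 0 j != 0.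
Proof.
rewrite Y0L mxE mulf_neq0 //.
  by rewrite -[0]/(0%:C%C) (inj_eq (@complexI R)) gt_eqF // ssd_gt0.
by rewrite -normr_eq0 ne oner_eq0.
Qed.

Let kane m : (cj (Y 0%N *m rdiag lam) *m U) 0 m != 0.
Proof.
rewrite Y0L data_ka mxE mulf_neq0 //.
  by rewrite -[0]/(0%:C%C) (inj_eq (@complexI R)) gt_eqF // kkd_gt0.
by rewrite -normr_eq0 nd oner_eq0.
Qed.

Lemma data_chi : chi N c = (fun j => 2 * lam j ^+ 2, fun m => 2 * mu m ^+ 2,
             fun j => ((ep j)^*) ^+ 2, fun m => ((dl m)^*) ^+ 2).
Proof.
have [_ _ _ ->] := pair_cd data_takagi data_takagi1 data_UU l0 lam_decr m0 mu_decr sne kane.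
congr (_, _, _, _); apply/funext => j; congr (_^* ^+ 2).
  by rewrite Y0L mxE mulrAC mulfV ?mul1r // -[0]/(0%:C%C) (inj_eq (@complexI R)) gt_eqF // ssd_gt0.
by rewrite Y0L data_ka mxE mulrAC mulfV ?mul1r // -[0]/(0%:C%C) (inj_eq (@complexI R)) gt_eqF // kkd_gt0.
Qed.

End Reconstruction.

(** * The reconstructed symbol in the coordinates of [A] and [B] *)

Section InverseMap.
Variables (R : realType) (n : nat).
Local Notation C := (R[i]).
Local Notation N := n.+1.

(* The denominator is the reversed characteristic polynomial of the transfer
   matrix [A]; the numerator is the truncated product of the denominator by [c]. *)
Definition bco (A : 'M[C]_N) k : C := (char_poly A)`_(N - k).
Definition aco (A : 'M[C]_N) (c : seqC R) j : C := \sum_(k < j.+1) bco A k * c (j - k)%N.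
Definition psid (A : 'M[C]_N) (c : seqC R) : 'M[R]_(4, N) :=
  \matrix_(i, j) if i == r0 then complex.Re (aco A c j)
    else if i == r1 then complex.Im (aco A c j)
    else if i == r2 then complex.Re (bco A j.+1) else complex.Im (bco A j.+1).

Lemma complexK (z : C) : Complex (complex.Re z) (complex.Im z) = z.
Proof. by case: z. Qed.

Lemma psid_polyB A c m : (m <= N)%N -> (polyB (psid A c))`_m = bco A m.
Proof.
case: m => [|m] hm.
  rewrite coef_polyB0 /bco subn0; have /monicP := char_poly_monic A.
  by rewrite lead_coefE size_char_poly.
by rewrite coef_polyBS insubT !mxE /= complexK.
Qed.

Lemma psid_polyA A c m : (m < N)%N -> (polyA (psid A c))`_m = aco A c m.
Proof. by move=> hm; rewrite coef_polyA insubT !mxE /= complexK. Qed.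

Lemma psid_Prev A c : Prev (psid A c) = char_poly A.
Proof.
apply/polyP => k; have [hk|hk] := leqP k N.
  by rewrite coef_Prev // psid_polyB ?leq_subr // /bco subKn.
by rewrite !nth_default // ?size_Prev // size_char_poly.
Qed.

Lemma psid_ucoef A c : (forall m, pact (char_poly A) c m = 0) -> ucoef (psid A c) = c.
Proof.
move=> hc; apply/esym/ucoef_unique => m; have [hm|hm] := ltnP m N.
  rewrite psid_polyA // /aco; apply: eq_bigr => k _; rewrite psid_polyB //.
  by apply: ltnW; apply: leq_ltn_trans hm; rewrite -ltnS.
have [q em] : exists q, m = (q + N)%N by exists (m - N)%N; rewrite subnK.
rewrite em -pact_Prev psid_Prev hc nth_default // (leq_trans (size_polyA _)) //.
exact: leq_addl.
Qed.

Variables (lam mu : 'I_N -> R) (ep dl : 'I_N -> C).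
Hypotheses (l0 : forall j, 0 < lam j) (m0 : forall j, 0 < mu j).
Hypothesis hint : interlaced (sq lam) (sq mu).
Hypotheses (ne : forall j, `|ep j| = 1) (nd : forall j, `|dl j| = 1).
Local Notation A := (Ad lam mu ep dl).
Local Notation c := (cd lam mu ep dl).
Local Notation Y := (Yd lam mu ep dl).
Local Notation p := (psid A c).

Lemma pact_AY (w : 'cV[C]_N) m : pact (char_poly A) (fun k => (Y k *m w) 0 0) m = 0.
Proof.
have e l : (Y l *m w) 0 0 = \sum_i \sum_j yd lam mu ep 0 i * w j 0 * (A ^+ l) i j.
  rewrite /Yd -mulmxA mxE; apply: eq_bigr => i _; rewrite [X in _ * X = _]mxE mulr_sumr.
  by apply: eq_bigr => j _; rewrite -mulrA [w j 0 * _]mulrC.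
rewrite (@pact_ext R _ _ _ m e) /pact.
under eq_bigr => l _ do rewrite mulr_sumr.
rewrite exchange_big big1 //= => i _.
under eq_bigr => l _ do rewrite mulr_sumr.
rewrite exchange_big big1 //= => j _.
under eq_bigr => l _ do rewrite mulrCA.
rewrite -mulr_sumr -/(pact _ (fun l => (A ^+ l) i j) m) pact_horner_mx Cayley_Hamilton.
by rewrite mulmx0 [X in _ * X]mxE mulr0.
Qed.

Lemma data_ucoef : ucoef p = c.
Proof. by apply: psid_ucoef; apply: pact_AY. Qed.

Lemma data_schur : schur p.
Proof. by move=> z; rewrite psid_Prev; apply: data_stable. Qed.

(** The change of frame from the companion coordinates to the Takagi basis: the columns of [Y]
    satisfy the recurrence of [Prev p], so their first [N] values determine them. *)
Definition obs : 'M[C]_N := \matrix_(i, j) Y i 0 j.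

Lemma rho_obs k : rho p k *m obs = Y k.
Proof.
apply/rowP => j.
have h m : pact (Prev p) (fun k => Y k 0 j) m = 0.
  rewrite psid_Prev -[RHS](pact_AY (delta_mx j 0) m); apply: pact_ext => l.
  by rewrite -colE [RHS]mxE.
rewrite -[in RHS](add0n k) (rho_state 0 k h) mxE [RHS]mxE; apply: eq_bigr => i _.
by rewrite !mxE.
Qed.

Lemma data_gram_obs : ct obs *m Gp p *m obs = 1%:M.
Proof.
have rg := rr_geo data_schur.
rewrite -msum_mull // -msum_mulr; last exact: mgeo_mull.
rewrite -(data_gram l0 hint ne nd); apply: eq_msum => k.
by rewrite mulmxA -ctM -mulmxA !rho_obs.
Qed.

Lemma data_Tp : Tp p = obs *m rdiag lam *m obs^T.
Proof.
apply/matrixP => i j; rewrite mxE data_ucoef (data_hankel mu ep dl l0).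
have -> : Y i = row i obs by apply/rowP => k; rewrite !mxE.
have -> : Y j = row j obs by apply/rowP => k; rewrite !mxE.
rewrite -row_mul; set X := obs *m rdiag lam.
by rewrite !mxE; apply: eq_bigr => k _; rewrite !mxE.
Qed.

Lemma obs_unit : obs \in unitmx.
Proof. by have [] := mulmx1_unit (mulmx1C data_gram_obs). Qed.

Let Lunit (l : 'I_N -> R) : (forall j, 0 < l j) -> rdiag l \in unitmx.
Proof.
move=> h; have [] // := mulmx1_unit (rdiagV (lam := l) _).
by move=> j; rewrite gt_eqF.
Qed.

Lemma data_Aunit : A \in unitmx.
Proof.
have [uU _] := mulmx1_unit (mulmx1C (data_UU hint ne nd)).
rewrite /Ad !unitmx_mul unitmx_tr uU Lunit //= Lunit // => j.
by rewrite invr_gt0.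
Qed.

(** In the frame [obs], [H_u^2(1)] has the nonzero coordinates [lam_j conj(s_j)] and the eigenvalues
    are distinct, so the Vandermonde argument gives the Krylov condition; invertibility of [A] gives
    [deg B = N]. *)
Lemma data_Gen : Gen p.
Proof.
apply/genP; split; first exact: data_schur.
- by rewrite data_Tp !unitmx_mul unitmx_tr obs_unit Lunit.
- rewrite psid_Prev char_poly_det mulf_neq0 ?signr_eq0 //.
  by have := data_Aunit; rewrite unitmxE unitfE.
apply: krylov_row => r hr.
have hv := hsq_pow data_gram_obs data_Tp (vp p) r.
have VGc : obs^T *m cj (Gp p *m obs) = 1%:M.
  by have := congr1 (@cj R _ _) data_gram_obs; rewrite -mulmxA cjM cj_ct cj1.
have eb : bp p = obs *m (sd lam mu ep)^T.
  apply/colP => i; rewrite mxE add0n data_ucoef /cd.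
  by rewrite mxE [RHS]mxE; apply: eq_bigr => k _; rewrite [obs _ _]mxE.
have ev : invmx obs *m vp p = rdiag lam *m cj (sd lam mu ep)^T.
  rewrite /vp eb mulmxA cjM mulmxA data_Tp.
  have := mulVmx obs_unit; move: VGc; move: (Gp p) (rdiag lam) obs (invmx obs) => G L V V' h h'.
  by rewrite -!mulmxA (mulmxA V') h' mul1mx (mulmxA V^T) h mul1mx.
have vi : injective (fun j => (lam j ^+ 2)%:C%C : C).
  by move=> i j /complexI /(decr_inj (int_adecr hint)).
have h0 := vandermonde_eq0 vi (fun k => etrans (esym (hv k)) (hr k)).
have rV : r *m obs = 0.
  apply/rowP => j; rewrite [RHS]mxE; have /eqP := h0 j.
  rewrite ev mul_diag_mx [X in _ * X]mxE mulf_eq0 => /orP[/eqP //|].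
  rewrite !mxE mulf_eq0 conjC_eq0 mulf_eq0 -normr_eq0 -[X in _ || (_ || X)]normr_eq0 ne oner_eq0 orbF.
  rewrite normr_eq0 -[X in (_ == X) || _]/(0%:C%C) -[X in _ || (_ == X)]/(0%:C%C) !(inj_eq (@complexI R)).
  by rewrite (gt_eqF (l0 j)) (gt_eqF (ssd_gt0 hint j)).
by rewrite -[r](mulmxK obs_unit) rV mul0mx.
Qed.

End InverseMap.

(** * Elementary functions *)

Section LineDerivative.
Variables (R : realType) (V : normedModType R).
Implicit Types (f g : V -> R) (x v : V).

Lemma growth_line f x v : (fun h : R => h^-1 *: ((f \o shift x) (h *: v) - f x)) =
  (fun h : R => h^-1 *: (((fun h : R => f (h *: v + x)) \o shift (0 : R)) (h *: (1 : R))
    - f (0 *: v + x))).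
Proof.
by apply/funext => h /=; rewrite scale0r add0r -[h *: 1]/(h * 1) mulr1 addr0.
Qed.

Lemma derive_line f x v : 'D_v f x = 'D_1 (fun h : R => f (h *: v + x)) 0.
Proof. by rewrite /derive growth_line. Qed.

Lemma derivable_line f x v : derivable f x v <-> derivable (fun h : R => f (h *: v + x)) 0 1.
Proof. by rewrite /derivable growth_line. Qed.

(** Only one direction is available, so [f] is restricted to the line through [x], where the
    one-variable chain rule applies. *)
Lemma derive_comp (g : R -> R) f x v : derivable g (f x) 1 -> derivable f x v ->
  derivable (fun y => g (f y)) x v /\ 'D_v (fun y => g (f y)) x = 'D_1 g (f x) * 'D_v f x.
Proof.
move=> dg df; pose ph (h : R) := f (h *: v + x).
have e0 : ph 0 = f x by rewrite /ph scale0r add0r.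
have /derivable_line df0 := df.
have dg0 : derivable g (ph 0) 1 by rewrite e0.
have dc : derivable (g \o ph) 0 1.
  by apply/derivable1_diffP; apply: differentiable_comp; apply/derivable1_diffP.
split; first by apply/derivable_line.
have h := derive1_comp df0 dg0.
rewrite [LHS]derive_line [X in _ * X]derive_line -/ph.
have e0' : f (0 *: v + x) = f x := e0.
by move: h; rewrite !derive1E e0'; exact.
Qed.

End LineDerivative.

Section ElementaryFunctions.
Variables (R : realType) (V : normedModType R) (U : set V).
Variable base : (V -> R) -> Prop.
Implicit Types (f g : V -> R) (x v w : V).

(* [base] holds additional generators (later, the eigenvalues of [H_u^2] and
   [K_u^2]) whose derivatives are again elementary. *)
Inductive elem : (V -> R) -> Prop :=
| elem_cst (c : R) : elem (fun=> c)
| elem_lin f : (forall x v, derivable f x v) -> (forall x v, 'D_v f x = f v) ->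
    (forall a v w, f (a *: v + w) = a * f v + f w) -> continuous f -> elem f
| elem_base f : base f -> elem f
| elem_add f g : elem f -> elem g -> elem (fun x => f x + g x)
| elem_mul f g : elem f -> elem g -> elem (fun x => f x * g x)
| elem_inv f : (forall x, U x -> f x != 0) -> elem f -> elem (fun x => (f x)^-1)
| elem_sqrt f : (forall x, U x -> 0 < f x) -> elem f -> elem (fun x => Num.sqrt (f x))
| elem_cos f : elem f -> elem (fun x => cos (f x))
| elem_sin f : elem f -> elem (fun x => sin (f x))
| elem_ext f g : (forall x, U x -> f x = g x) -> elem f -> elem g.

Hypothesis Uopen : forall x, U x -> nbhs x U.

Lemma near_eq f g x : U x -> (forall x, U x -> f x = g x) -> {near x, f =1 g}.
Proof. by move=> /Uopen Ux e; near=> y; apply: e; near: y. Unshelve. all: end_near. Qed.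

Lemma derive_ext f g x v : U x -> (forall x, U x -> f x = g x) -> 'D_v f x = 'D_v g x.
Proof.
move=> Ux e; have [->|v0] := eqVneq v 0; first by rewrite !derive0.
by apply: near_eq_derive => //; apply: near_eq.
Qed.

Lemma derivable_ext f g x v : U x -> (forall x, U x -> f x = g x) ->
  derivable f x v -> derivable g x v.
Proof.
move=> Ux e; have [->|v0] := eqVneq v 0; first by move=> _; exact: derivable0.
by apply: near_eq_derivable => //; apply: near_eq.
Qed.

Hypothesis Hbase : forall f, base f ->
  [/\ forall x, U x -> {for x, continuous f}, forall x v, U x -> derivable f x v &
      forall v, exists2 g, elem g & forall x, U x -> 'D_v f x = g x].

Lemma elem_opp f : elem f -> elem (fun x => - f x).
Proof.
move=> hf; apply: elem_ext (elem_mul (elem_cst (-1)) hf) => x _; by rewrite mulN1r.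
Qed.

Lemma derivable_sqrt (a : R) : 0 < a -> derivable Num.sqrt a 1.
Proof. by move=> a0; have [] := is_derive1_sqrt a0. Qed.

(** The three properties are proved together, since each differentiation rule needs derivability of
    its arguments; closure under derivatives then gives all orders at once. *)
Lemma elem_smooth f : elem f ->
  [/\ forall x, U x -> {for x, continuous f}, forall x v, U x -> derivable f x v &
      forall v, elem (fun x => 'D_v f x)].
Proof.
elim => {f}.
- move=> c; split.
  + by move=> x _; exact: cvg_cst.
  + by move=> x v _; exact: derivable_cst.
  + move=> v; apply: elem_ext (elem_cst 0) => x _; by rewrite derive_cst.
- move=> f h1 h2 h3 h4; split => [x _|x v _|v]; [exact: h4|exact: h1|].
  by apply: elem_ext (elem_cst (f v)) => x _; rewrite h2.
- move=> f /Hbase [h1 h2 h3]; split => // v; have [g hg e] := h3 v.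
  by apply: elem_ext hg => x Ux; rewrite e.
- move=> f g ef [f1 f2 f3] eg [g1 g2 g3]; split => [x Ux|x v Ux|v].
  + by apply: cvgD; [exact: f1|exact: g1].
  + by apply: derivableD; [exact: f2|exact: g2].
  + apply: elem_ext (elem_add (f3 v) (g3 v)) => x Ux.
    by rewrite -deriveD //; [exact: f2|exact: g2].
- move=> f g ef [f1 f2 f3] eg [g1 g2 g3]; split => [x Ux|x v Ux|v].
  + by apply: cvgM; [exact: f1|exact: g1].
  + by apply: derivableM; [exact: f2|exact: g2].
  + apply: elem_ext (elem_add (elem_mul ef (g3 v)) (elem_mul eg (f3 v))) => x Ux.
    by rewrite -[LHS]deriveM //; [exact: f2|exact: g2].
- move=> f f0 ef [f1 f2 f3]; split => [x Ux|x v Ux|v].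
  + by apply: cvgV; [exact: f0|exact: f1].
  + by apply: derivableV; [exact: f0|exact: f2].
  + apply: elem_ext (elem_opp (elem_mul (elem_mul (elem_inv f0 ef) (elem_inv f0 ef)) (f3 v))) => x Ux.
    rewrite (deriveV (f0 x Ux) (f2 x v Ux)) -exprVn expr2 scaleNr //.
- move=> f f0 ef [f1 f2 f3]; split => [x Ux|x v Ux|v].
  + by apply: continuous_comp; [exact: f1|exact: sqrt_continuous].
  + by have [] := derive_comp (derivable_sqrt (f0 x Ux)) (f2 x v Ux).
  + have f0' x : U x -> (fun x => 2 * Num.sqrt (f x)) x != 0.
      by move=> Ux; rewrite mulf_neq0 // gt_eqF // sqrtr_gt0 f0.
    have es := elem_sqrt f0 ef.
    apply: elem_ext (elem_mul (elem_inv f0' (elem_mul (elem_cst 2) es)) (f3 v)) => x Ux.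
    have [_ ->] := derive_comp (derivable_sqrt (f0 x Ux)) (f2 x v Ux).
    by have [_ <-] := is_derive1_sqrt (f0 x Ux).
- move=> f ef [f1 f2 f3]; split => [x Ux|x v Ux|v].
  + by apply: continuous_comp; [exact: f1|exact: continuous_cos].
  + by have [] := derive_comp (@derivable_cos R (f x)) (f2 x v Ux).
  + apply: elem_ext (elem_opp (elem_mul (elem_sin ef) (f3 v))) => x Ux.
    have [_ ->] := derive_comp (@derivable_cos R (f x)) (f2 x v Ux).
    by rewrite derive_val mulNr.
- move=> f ef [f1 f2 f3]; split => [x Ux|x v Ux|v].
  + by apply: continuous_comp; [exact: f1|exact: continuous_sin].
  + by have [] := derive_comp (@derivable_sin R (f x)) (f2 x v Ux).
  + apply: elem_ext (elem_mul (elem_cos ef) (f3 v)) => x Ux.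
    have [_ ->] := derive_comp (@derivable_sin R (f x)) (f2 x v Ux).
    by rewrite derive_val.
- move=> f g e ef [f1 f2 f3]; split => [x Ux|x v Ux|v].
  + rewrite /prop_for /continuous_at -(e x Ux); apply: cvg_trans (f1 x Ux).
    by apply: near_eq_cvg; apply: near_eq.
  + exact: derivable_ext (f2 x v Ux).
  + by apply: elem_ext (f3 v) => x Ux; apply: derive_ext.
Qed.

Lemma elem_smooth_on f : elem f -> smooth_on U f.
Proof.
move=> ef vs x Ux; have : elem (Defs.iterD vs f).
  by elim: vs => //= v vs /elem_smooth [_ _]; exact.
by move=> /elem_smooth [h1 h2 _]; split; [exact: h1|move=> v; exact: h2].
Qed.

Lemma elem_derivable f x v : elem f -> U x -> derivable f x v.
Proof. by move=> /elem_smooth [_ h _]; apply: h. Qed.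

Lemma elem_continuous f x : elem f -> U x -> {for x, continuous f}.
Proof. by move=> /elem_smooth [h _ _]; apply: h. Qed.

Lemma elem_derive f v : elem f -> elem (fun x => 'D_v f x).
Proof. by move=> /elem_smooth [_ _ h]; apply: h. Qed.

Lemma D_add f g x v : elem f -> elem g -> U x ->
  'D_v (fun x => f x + g x) x = 'D_v f x + 'D_v g x.
Proof. move=> ef eg Ux; exact: (deriveD (elem_derivable ef Ux) (elem_derivable eg Ux)). Qed.

Lemma D_mul f g x v : elem f -> elem g -> U x ->
  'D_v (fun x => f x * g x) x = f x * 'D_v g x + g x * 'D_v f x.
Proof. move=> ef eg Ux; exact: (deriveM (elem_derivable ef Ux) (elem_derivable eg Ux)). Qed.

Section NoBase.
Lemma leibniz_sym (f g P Q fv fw gv gw : R) :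
  f * P + gw * fv + (g * Q + fw * gv) = f * P + gv * fw + (g * Q + fv * gw).
Proof. by ring. Qed.
Lemma leibniz_lin (a f g fv fw gv gw : R) :
  f * (a * gv + gw) + g * (a * fv + fw) = a * (f * gv + g * fv) + (f * gw + g * fw).
Proof. by ring. Qed.

Hypothesis nobase : forall f, ~ base f.

Lemma D_comp (g : R -> R) f x v : derivable g (f x) 1 -> elem f -> U x ->
  'D_v (fun x => g (f x)) x = 'D_1 g (f x) * 'D_v f x.
Proof. by move=> dg ef Ux; have [_ h] := derive_comp (v := v) dg (elem_derivable ef Ux); exact: h. Qed.

Lemma derivable_inv (a : R) : a != 0 -> derivable (fun z : R => z^-1) a 1.
Proof. by move=> a0; apply: derivableV => //; exact: derivable_id. Qed.

Lemma derive_inv (a : R) : a != 0 -> 'D_1 (fun z : R => z^-1) a = - (a^-1 * a^-1).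
Proof.
move=> a0; have := @deriveV R R (fun z : R => z) a 1 a0 (@derivable_id R R a 1).
rewrite derive_id => h; rewrite [LHS]h -exprVn expr2 -[_ *: 1]/(_ * 1) mulr1 //.
Qed.

(** Directional derivability does not yield linearity in the direction; it is propagated through the
    constructors from the linear functions. *)
Lemma D_linear f x a v w : elem f -> U x ->
  'D_(a *: v + w) f x = a * 'D_v f x + 'D_w f x.
Proof.
have key (g : R -> R) h y : derivable g (h y) 1 -> elem h -> U y ->
    'D_(a *: v + w) h y = a * 'D_v h y + 'D_w h y ->
    'D_(a *: v + w) (fun x => g (h x)) y =
    a * 'D_v (fun x => g (h x)) y + 'D_w (fun x => g (h x)) y.
  move=> dg eh Uy e; rewrite (D_comp _ dg eh Uy) (D_comp _ dg eh Uy) (D_comp _ dg eh Uy) e.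
  by rewrite mulrDr mulrCA.
move=> ef Ux; move: x Ux; elim: ef => {f}.
- by move=> c x Ux; rewrite !derive_cst mulr0 addr0.
- by move=> f h1 h2 h3 h4 x Ux; rewrite !h2 h3.
- by move=> f bf; case: (nobase bf).
- move=> f g ef hf eg hg x Ux; rewrite (D_add _ ef eg Ux) (D_add _ ef eg Ux) (D_add _ ef eg Ux).
  by rewrite (hf x Ux) (hg x Ux) mulrDr addrACA.
- move=> f g ef hf eg hg x Ux; rewrite (D_mul _ ef eg Ux) (D_mul _ ef eg Ux) (D_mul _ ef eg Ux).
  rewrite (hf x Ux) (hg x Ux); exact: leibniz_lin.
- move=> f f0 ef hf x Ux.
  exact: (key (fun z : R => z^-1) f x (derivable_inv (f0 x Ux)) ef Ux (hf x Ux)).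
- move=> f f0 ef hf x Ux.
  exact: (key Num.sqrt f x (derivable_sqrt (f0 x Ux)) ef Ux (hf x Ux)).
- move=> f ef hf x Ux; exact: (key cos f x (@derivable_cos R (f x)) ef Ux (hf x Ux)).
- move=> f ef hf x Ux; exact: (key sin f x (@derivable_sin R (f x)) ef Ux (hf x Ux)).
- move=> f g e ef hf x Ux; rewrite -!(derive_ext _ Ux e); exact: hf.
Qed.

(* Chain rule for a scalar function [g] whose derivative along [f] is again
   elementary: the mixed derivative is visibly symmetric. *)
Lemma D_sym_comp (g g' : R -> R) f x v w : elem f -> (forall x, U x -> derivable g (f x) 1) ->
  (forall x, U x -> derivable g' (f x) 1) -> (forall x, U x -> 'D_1 g (f x) = g' (f x)) ->
  elem (fun x => g' (f x)) -> U x -> 'D_v (fun y => 'D_w f y) x = 'D_w (fun y => 'D_v f y) x ->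
  'D_v (fun y => 'D_w (fun x => g (f x)) y) x = 'D_w (fun y => 'D_v (fun x => g (f x)) y) x.
Proof.
move=> ef dg dg' eg eg' Ux hs.
have e u y : U y -> 'D_u (fun x => g (f x)) y = g' (f y) * 'D_u f y.
  by move=> Uy; rewrite (D_comp _ (dg y Uy) ef Uy) eg.
rewrite (derive_ext _ Ux (e w)) (derive_ext _ Ux (e v)).
rewrite (D_mul _ eg' (elem_derive w ef) Ux) (D_mul _ eg' (elem_derive v ef) Ux).
rewrite (D_comp _ (dg' x Ux) ef Ux) (D_comp _ (dg' x Ux) ef Ux) hs.
by congr (_ + _); rewrite mulrCA [X in _ * X]mulrC mulrA [X in X * _]mulrC mulrA.
Qed.

(** Structural induction takes the place of Schwarz's theorem: every differentiation rule preserves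
    the symmetry of mixed derivatives. *)
Lemma D_sym f x v w : elem f -> U x ->
  'D_v (fun y => 'D_w f y) x = 'D_w (fun y => 'D_v f y) x.
Proof.
move=> ef Ux; move: x Ux; elim: ef => {f}.
- move=> c x Ux.
  have e u y : U y -> 'D_u (fun=> c) y = (fun=> 0) y :> R by move=> _; rewrite derive_cst.
  by rewrite (derive_ext _ Ux (e w)) (derive_ext _ Ux (e v)) !derive_cst.
- move=> f h1 h2 h3 h4 x Ux.
  have e u y : U y -> 'D_u f y = (fun=> f u) y by move=> _; rewrite h2.
  by rewrite (derive_ext _ Ux (e w)) (derive_ext _ Ux (e v)) !derive_cst.
- by move=> f bf; case: (nobase bf).
- move=> f g ef hf eg hg x Ux.
  have e u y : U y -> 'D_u (fun x => f x + g x) y = 'D_u f y + 'D_u g y.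
    by move=> Uy; exact: D_add.
  rewrite (derive_ext _ Ux (e w)) (derive_ext _ Ux (e v)).
  rewrite (D_add _ (elem_derive w ef) (elem_derive w eg) Ux).
  by rewrite (D_add _ (elem_derive v ef) (elem_derive v eg) Ux) (hf x Ux) (hg x Ux).
- move=> f g ef hf eg hg x Ux.
  have e u y : U y -> 'D_u (fun x => f x * g x) y = f y * 'D_u g y + g y * 'D_u f y.
    by move=> Uy; exact: D_mul.
  rewrite (derive_ext _ Ux (e w)) (derive_ext _ Ux (e v)).
  have [dfv dfw] := (elem_derive v ef, elem_derive w ef).
  have [dgv dgw] := (elem_derive v eg, elem_derive w eg).
  rewrite (D_add _ (elem_mul ef dgw) (elem_mul eg dfw) Ux).
  rewrite (D_add _ (elem_mul ef dgv) (elem_mul eg dfv) Ux).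
  rewrite (D_mul _ ef dgw Ux) (D_mul _ eg dfw Ux) (D_mul _ ef dgv Ux) (D_mul _ eg dfv Ux).
  rewrite (hf x Ux) (hg x Ux); exact: leibniz_sym.
- move=> f f0 ef hf x Ux.
  apply: (@D_sym_comp (fun z : R => z^-1) (fun z => - (z^-1 * z^-1)) f x v w ef _ _ _ _ Ux (hf x Ux)).
  + move=> y Uy; exact: derivable_inv (f0 y Uy).
  + by move=> y Uy; apply: derivableN; apply: derivableM; exact: derivable_inv (f0 y Uy).
  + move=> y Uy; exact: derive_inv (f0 y Uy).
  + by apply: elem_opp; apply: elem_mul; apply: elem_inv.
- move=> f f0 ef hf x Ux.
  apply: (@D_sym_comp Num.sqrt (fun z => (2 * Num.sqrt z)^-1) f x v w ef _ _ _ _ Ux (hf x Ux)).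
  + move=> y Uy; exact: derivable_sqrt (f0 y Uy).
  + move=> y Uy; apply: derivableV; first by rewrite mulf_neq0 // gt_eqF // sqrtr_gt0 f0.
    apply: derivableM; [exact: derivable_cst|exact: derivable_sqrt (f0 y Uy)].
  + by move=> y Uy; have [_ <-] := is_derive1_sqrt (f0 y Uy).
  + apply: elem_inv; first by move=> y Uy; rewrite mulf_neq0 // gt_eqF // sqrtr_gt0 f0.
    by apply: elem_mul; [exact: elem_cst|exact: elem_sqrt].
- move=> f ef hf x Ux.
  apply: (@D_sym_comp cos (fun z => - sin z) f x v w ef _ _ _ _ Ux (hf x Ux)).
  + move=> y Uy; exact: derivable_cos.
  + by move=> y Uy; apply: derivableN; exact: derivable_sin.
  + by move=> y Uy; rewrite derive_val.
  + by apply: elem_opp; apply: elem_sin.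
- move=> f ef hf x Ux.
  apply: (@D_sym_comp sin cos f x v w ef _ _ _ _ Ux (hf x Ux)).
  + move=> y Uy; exact: derivable_sin.
  + move=> y Uy; exact: derivable_cos.
  + by move=> y Uy; rewrite derive_val.
  + exact: elem_cos.
- move=> f g e ef hf x Ux.
  have e' u y : U y -> 'D_u g y = 'D_u f y by move=> Uy; rewrite (derive_ext _ Uy e).
  by rewrite (derive_ext _ Ux (e' w)) (derive_ext _ Ux (e' v)) hf.
Qed.

End NoBase.
End ElementaryFunctions.

(** * Complex and matrix-valued elementary functions; state-space sums *)

Section ComplexElementary.
Variables (R : realType) (V : normedModType R) (U : set V).
Variable base : (V -> R) -> Prop.
Hypothesis Uopen : forall x, U x -> nbhs x U.
Hypothesis Hbase : forall f, base f ->
  [/\ forall x, U x -> {for x, continuous f}, forall x v, U x -> derivable f x v &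
      forall v, exists2 g, elem U base g & forall x, U x -> 'D_v f x = g x].
Local Notation C := (R[i]).
Local Notation elem := (elem U base).
Implicit Types (f g : V -> C) (x v : V).

Definition celem f := elem (fun x => complex.Re (f x)) /\ elem (fun x => complex.Im (f x)).
Definition cD v f x : C :=
  Complex ('D_v (fun y => complex.Re (f y)) x) ('D_v (fun y => complex.Im (f y)) x).

Lemma celem_ext f g : (forall x, U x -> f x = g x) -> celem f -> celem g.
Proof.
by move=> e [h1 h2]; split; [apply: elem_ext h1|apply: elem_ext h2] => x Ux; rewrite e.
Qed.

Lemma celem_cst z : celem (fun=> z).
Proof. by split; apply: elem_cst. Qed.

Lemma celem_real (h : V -> R) : elem h -> celem (fun x => (h x)%:C%C).
Proof. by move=> eh; split => //; apply: elem_cst. Qed.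

Lemma celemD f g : celem f -> celem g -> celem (fun x => f x + g x).
Proof.
move=> [a b] [c d]; split.
  by apply: elem_ext (elem_add a c) => x _; rewrite cReD.
by apply: elem_ext (elem_add b d) => x _; rewrite cImD.
Qed.

Lemma celemM f g : celem f -> celem g -> celem (fun x => f x * g x).
Proof.
move=> [a b] [c d]; split.
  by apply: elem_ext (elem_add (elem_mul a c) (elem_opp (elem_mul b d))) => x _; rewrite cReM.
by apply: elem_ext (elem_add (elem_mul a d) (elem_mul b c)) => x _; rewrite cImM.
Qed.

Lemma celemN f : celem f -> celem (fun x => - f x).
Proof. by move=> h; apply: celem_ext (celemM (celem_cst (-1)) h) => x _; rewrite mulN1r. Qed.

Lemma celemB f g : celem f -> celem g -> celem (fun x => f x - g x).
Proof. by move=> hf hg; apply: celemD => //; apply: celemN. Qed.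

Lemma celem_conj f : celem f -> celem (fun x => (f x)^*).
Proof.
move=> [a b]; split; first by apply: elem_ext a => x _; rewrite cRe_conj.
by apply: elem_ext (elem_opp b) => x _; rewrite cIm_conj.
Qed.

Lemma celem_sum I (r : seq I) (P : pred I) (F : I -> V -> C) :
  (forall i, P i -> celem (F i)) -> celem (fun x => \sum_(i <- r | P i) F i x).
Proof.
move=> h; elim: r => [|i r ih].
  by apply: celem_ext (celem_cst 0) => x _; rewrite big_nil.
case Pi: (P i).
  by apply: celem_ext (celemD (h i Pi) ih) => x _; rewrite big_cons Pi.
by apply: celem_ext ih => x _; rewrite big_cons Pi.
Qed.

Lemma celem_prod I (r : seq I) (P : pred I) (F : I -> V -> C) :
  (forall i, P i -> celem (F i)) -> celem (fun x => \prod_(i <- r | P i) F i x).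
Proof.
move=> h; elim: r => [|i r ih].
  by apply: celem_ext (celem_cst 1) => x _; rewrite big_nil.
case Pi: (P i).
  by apply: celem_ext (celemM (h i Pi) ih) => x _; rewrite big_cons Pi.
by apply: celem_ext ih => x _; rewrite big_cons Pi.
Qed.

Lemma elem_cabs2 f : celem f -> elem (fun x => cabs (f x) ^+ 2).
Proof.
move=> [a b]; apply: elem_ext (elem_add (elem_mul a a) (elem_mul b b)) => x _.
by rewrite cabs_sqr !expr2.
Qed.

Lemma celemV f : (forall x, U x -> f x != 0) -> celem f -> celem (fun x => (f x)^-1).
Proof.
move=> f0 hf; have h2 := elem_cabs2 hf.
have h0 x : U x -> cabs (f x) ^+ 2 != 0.
  move=> Ux; rewrite sqrf_eq0; apply: contra (f0 x Ux) => /eqP /cabs_eq0 ->; exact: eqxx.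
apply: celem_ext (celemM (celem_conj hf) (celem_real (elem_inv h0 h2))) => x Ux.
apply: (mulfI (f0 x Ux)); rewrite mulfV ?f0 // mulrA -normCK cabsE -rmorphXn -rmorphM /=.
by rewrite mulfV // h0.
Qed.

Lemma elem_cabs f : (forall x, U x -> f x != 0) -> celem f -> elem (fun x => cabs (f x)).
Proof.
move=> f0 hf; have h2 := elem_cabs2 hf.
have h0 x : U x -> 0 < cabs (f x) ^+ 2.
  move=> Ux; rewrite lt_def sqr_ge0 andbT sqrf_eq0; apply: contra (f0 x Ux) => /eqP /cabs_eq0 ->; exact: eqxx.
by apply: elem_ext (elem_sqrt h0 h2) => x Ux; rewrite sqrtr_sqr ger0_norm // cabs_ge0.
Qed.

Lemma celem_cD v f : celem f -> celem (cD v f).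
Proof. by move=> [a b]; split; apply: elem_derive. Qed.

Lemma cD_ext v f g x : U x -> (forall x, U x -> f x = g x) -> cD v f x = cD v g x.
Proof.
by move=> Ux e; congr Complex; apply: (derive_ext Uopen) => // y Uy; rewrite e.
Qed.

Lemma cDD v f g x : celem f -> celem g -> U x ->
  cD v (fun x => f x + g x) x = cD v f x + cD v g x.
Proof.
move=> [a b] [c d] Ux; apply: complex_eq; rewrite ?cReD ?cImD /=.
  rewrite -(D_add Uopen Hbase v a c Ux); apply: (derive_ext Uopen) => // y _; exact: cReD.
rewrite -(D_add Uopen Hbase v b d Ux); apply: (derive_ext Uopen) => // y _; exact: cImD.
Qed.

Lemma D_opp v (h : V -> R) x : elem h -> U x -> 'D_v (fun y => - h y) x = - 'D_v h x.
Proof. by move=> eh Ux; exact: (deriveN (elem_derivable Uopen Hbase eh Ux)). Qed.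

Lemma cDM v f g x : celem f -> celem g -> U x ->
  cD v (fun x => f x * g x) x = cD v f x * g x + f x * cD v g x.
Proof.
move=> [a b] [c d] Ux; apply: complex_eq; rewrite ?cReD ?cImD ?cReM ?cImM /=.
  rewrite (derive_ext Uopen (g := fun x => complex.Re (f x) * complex.Re (g x) + - (complex.Im (f x) * complex.Im (g x)))) //; last first.
    by move=> y _; rewrite cReM.
  rewrite (D_add Uopen Hbase v (elem_mul a c) (elem_opp (elem_mul b d)) Ux).
  rewrite (D_opp v (elem_mul b d) Ux) (D_mul Uopen Hbase v a c Ux) (D_mul Uopen Hbase v b d Ux).
  move: ('D_v _ x) ('D_v _ x) ('D_v _ x) ('D_v _ x) => p q r s; ring.
rewrite (derive_ext Uopen (g := fun x => complex.Re (f x) * complex.Im (g x) + complex.Im (f x) * complex.Re (g x))) //; last first.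
  by move=> y _; rewrite cImM.
rewrite (D_add Uopen Hbase v (elem_mul a d) (elem_mul b c) Ux).
rewrite (D_mul Uopen Hbase v a d Ux) (D_mul Uopen Hbase v b c Ux).
move: ('D_v _ x) ('D_v _ x) ('D_v _ x) ('D_v _ x) => p q r s; ring.
Qed.

Lemma cD_cst v z x : cD v (fun=> z) x = 0.
Proof. by rewrite /cD !derive_cst. Qed.

Lemma cD_conj v f x : celem f -> U x -> cD v (fun y => (f y)^*) x = (cD v f x)^*.
Proof.
move=> [a b] Ux; apply: complex_eq; rewrite ?cRe_conj ?cIm_conj /=.
  by apply: (derive_ext Uopen) => // y _; rewrite cRe_conj.
by rewrite -(D_opp v b Ux); apply: (derive_ext Uopen) => // y _; rewrite cIm_conj.
Qed.

Lemma cD_sum v I (r : seq I) (F : I -> V -> C) x : (forall i, celem (F i)) -> U x ->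
  cD v (fun y => \sum_(i <- r) F i y) x = \sum_(i <- r) cD v (F i) x.
Proof.
move=> h Ux; elim: r => [|i r ih].
  rewrite big_nil -[RHS](cD_cst v 0 x); apply: cD_ext => // y _; by rewrite big_nil.
rewrite big_cons -ih -cDD //; last exact: celem_sum.
by apply: cD_ext => // y _; rewrite big_cons.
Qed.

Definition melem m n (M : V -> 'M[C]_(m, n)) := forall i j, celem (fun x => M x i j).
Definition mD m n v (M : V -> 'M[C]_(m, n)) x : 'M[C]_(m, n) :=
  \matrix_(i, j) cD v (fun y => M y i j) x.

Lemma melem_ext m n (M M' : V -> 'M[C]_(m, n)) :
  (forall x, U x -> M x = M' x) -> melem M -> melem M'.
Proof. by move=> e h i j; apply: celem_ext (h i j) => x Ux; rewrite e. Qed.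

Lemma melem_cst m n (M : 'M[C]_(m, n)) : melem (fun=> M).
Proof. by move=> i j; apply: celem_cst. Qed.

Lemma melemM m n p (A : V -> 'M[C]_(m, n)) (B : V -> 'M[C]_(n, p)) :
  melem A -> melem B -> melem (fun x => A x *m B x).
Proof.
move=> hA hB i j.
apply: celem_ext (celem_sum (index_enum _) (P := xpredT) (fun k _ => celemM (hA i k) (hB k j))) => x _.
by rewrite mxE.
Qed.

Lemma melemD m n (A B : V -> 'M[C]_(m, n)) : melem A -> melem B -> melem (fun x => A x + B x).
Proof. by move=> hA hB i j; apply: celem_ext (celemD (hA i j) (hB i j)) => x _; rewrite mxE. Qed.

Lemma melemN m n (A : V -> 'M[C]_(m, n)) : melem A -> melem (fun x => - A x).
Proof. by move=> hA i j; apply: celem_ext (celemN (hA i j)) => x _; rewrite mxE. Qed.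

Lemma melem_tr m n (A : V -> 'M[C]_(m, n)) : melem A -> melem (fun x => (A x)^T).
Proof. by move=> hA i j; apply: celem_ext (hA j i) => x _; rewrite mxE. Qed.

Lemma melem_cj m n (A : V -> 'M[C]_(m, n)) : melem A -> melem (fun x => cj (A x)).
Proof. by move=> hA i j; apply: celem_ext (celem_conj (hA i j)) => x _; rewrite mxE. Qed.

Lemma melem_pow n (A : V -> 'M[C]_n) k : melem A -> melem (fun x => A x ^+ k).
Proof.
move=> hA; elim: k => [|k ih].
  by apply: melem_ext (melem_cst 1%:M) => x _; rewrite expr0.
by apply: melem_ext (melemM hA ih) => x _; rewrite exprS -mulmxE.
Qed.

Lemma melem_det n (A : V -> 'M[C]_n) : melem A -> celem (fun x => \det (A x)).
Proof.
move=> hA; apply: celem_sum => s _; apply: celemM; first exact: celem_cst.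
by apply: celem_prod => i _; exact: hA.
Qed.

Lemma melem_inv n (A : V -> 'M[C]_n) : (forall x, U x -> A x \in unitmx) -> melem A ->
  melem (fun x => invmx (A x)).
Proof.
move=> uA hA i j.
have d0 x : U x -> \det (A x) != 0 by move=> /uA; rewrite unitmxE unitfE.
have hadj : celem (fun x => \adj (A x) i j).
  apply: celem_ext (celemM (celem_cst ((-1) ^+ (j + i))) (melem_det (A := fun x => row' j (col' i (A x))) _)).
    by move=> x _; rewrite mxE.
  by move=> a b; apply: celem_ext (hA (lift j a) (lift i b)) => x _; rewrite !mxE.
apply: celem_ext (celemM (celemV d0 (melem_det hA)) hadj) => x Ux.
by rewrite /invmx (uA x Ux) [RHS]mxE.
Qed.

Lemma melem_mD m n v (A : V -> 'M[C]_(m, n)) : melem A -> melem (mD v A).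
Proof. by move=> hA i j; apply: celem_ext (celem_cD v (hA i j)) => x _; rewrite mxE. Qed.

Lemma mD_ext m n v (A B : V -> 'M[C]_(m, n)) x : U x -> (forall x, U x -> A x = B x) ->
  mD v A x = mD v B x.
Proof. by move=> Ux e; apply/matrixP => i j; rewrite !mxE; apply: cD_ext => // y Uy; rewrite e. Qed.

Lemma mDM m n p v (A : V -> 'M[C]_(m, n)) (B : V -> 'M[C]_(n, p)) x :
  melem A -> melem B -> U x ->
  mD v (fun y => A y *m B y) x = mD v A x *m B x + A x *m mD v B x.
Proof.
move=> hA hB Ux; apply/matrixP => i j; rewrite !mxE -big_split /=.
rewrite (cD_ext v Ux (g := fun y => \sum_k A y i k * B y k j)); last by move=> y _; rewrite mxE.
rewrite cD_sum //; last by move=> k; apply: celemM.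
by apply: eq_bigr => k _; rewrite cDM // !mxE.
Qed.

Lemma mDD m n v (A B : V -> 'M[C]_(m, n)) x : melem A -> melem B -> U x ->
  mD v (fun y => A y + B y) x = mD v A x + mD v B x.
Proof.
move=> hA hB Ux; apply/matrixP => i j; rewrite !mxE -cDD //.
by apply: cD_ext => // y _; rewrite mxE.
Qed.

Lemma mD_cst m n v (A : 'M[C]_(m, n)) x : mD v (fun=> A) x = 0.
Proof. by apply/matrixP => i j; rewrite !mxE cD_cst. Qed.

Lemma mD_tr m n v (A : V -> 'M[C]_(m, n)) x : U x -> mD v (fun y => (A y)^T) x = (mD v A x)^T.
Proof. by move=> Ux; apply/matrixP => i j; rewrite !mxE; apply: cD_ext => // y _; rewrite mxE. Qed.

Definition pelem (P : V -> {poly C}) := forall k, celem (fun x => (P x)`_k).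

Lemma pelem_sum I (r : seq I) (Q : pred I) (F : I -> V -> {poly C}) :
  (forall i, pelem (F i)) -> pelem (fun x => \sum_(i <- r | Q i) F i x).
Proof.
move=> h k; apply: celem_ext (celem_sum r (P := Q) (F := fun i x => (F i x)`_k) _) => [x _|i _].
  by rewrite coef_sum.
exact: h.
Qed.

Lemma pelemM P Q : pelem P -> pelem Q -> pelem (fun x => P x * Q x).
Proof.
move=> hP hQ k.
apply: celem_ext (celem_sum (index_enum _) (P := xpredT) (fun (i : 'I_k.+1) _ => celemM (hP i) (hQ (k - i)%N))) => x _.
by rewrite coefM.
Qed.

Lemma pelem_cst P : pelem (fun=> P).
Proof. by move=> k; apply: celem_cst. Qed.

Lemma pelem_prod I (r : seq I) (F : I -> V -> {poly C}) :
  (forall i, pelem (F i)) -> pelem (fun x => \prod_(i <- r) F i x).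
Proof.
move=> h; elim: r => [|i r ih] k.
  by apply: celem_ext (pelem_cst 1 k) => x _; rewrite big_nil.
by apply: celem_ext (pelemM (h i) ih k) => x _; rewrite big_cons.
Qed.

Lemma pelem_char_poly n (A : V -> 'M[C]_n) : melem A -> pelem (fun x => char_poly (A x)).
Proof.
move=> hA.
have h i j : pelem (fun x => char_poly_mx (A x) i j).
  move=> k.
  apply: celem_ext (celemB (celem_cst (('X *+ (i == j) : {poly C})`_k)) (celemM (hA i j) (celem_cst (k == 0%N)%:R))) => x _.
  rewrite !mxE coefB coefC; congr (_ - _).
  by case: eqP => _; rewrite ?mulr1 ?mulr0.
apply: pelem_sum => s; apply: pelemM; first exact: pelem_cst.
by apply: pelem_prod => i; exact: h.
Qed.

(* State-space form: all sums over the coefficient index reduce to the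
   rational expression [a (1 - M)^-1 b], so that term by term differentiation
   is an algebraic identity. *)
Definition ss (f : nat -> V -> C) := exists d (a : V -> 'rV[C]_d) (M : V -> 'M[C]_d) (b : V -> 'cV[C]_d),
  [/\ melem a, melem M, melem b, forall x, U x -> mgeo (fun k => M x ^+ k) &
      forall x k, U x -> f k x = (a x *m M x ^+ k *m b x) 0 0].

Lemma ss_geo (f : nat -> V -> C) x : ss f -> U x -> geo (fun k => f k x).
Proof.
move=> [d [a [M [b [ha hM hb hg e]]]]] Ux.
apply: eq_geo (mgeo_mulr (b x) (mgeo_mull (a x) (hg x Ux)) 0 0) => k.
by rewrite e.
Qed.

Lemma ss_celem (f : nat -> V -> C) k : ss f -> celem (f k).
Proof.
move=> [d [a [M [b [ha hM hb hg e]]]]].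
apply: celem_ext (melemM (melemM ha (melem_pow k hM)) hb 0 0) => x Ux.
by rewrite e.
Qed.

Lemma ss_csumE d (a : 'rV[C]_d) (M : 'M[C]_d) (b : 'cV[C]_d) : mgeo (fun k => M ^+ k) ->
  csum (fun k => (a *m M ^+ k *m b) 0 0) = (a *m invmx (1%:M - M) *m b) 0 0.
Proof.
move=> hM; rewrite -(msum_powers hM) -msum_mull // -msum_mulr; last exact: mgeo_mull.
by rewrite mxE.
Qed.

Lemma ss_csum (f : nat -> V -> C) : ss f -> celem (fun x => csum (fun k => f k x)).
Proof.
move=> [d [a [M [b [ha hM hb hg e]]]]].
have hI : melem (fun x => invmx (1%:M - M x)).
  apply: melem_inv => [x Ux|]; first exact: geo_powers_unit (hg x Ux).
  by apply: melemD; [exact: melem_cst|exact: melemN].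
apply: celem_ext (melemM (melemM ha hI) hb 0 0) => x Ux.
by rewrite -ss_csumE; [apply: eq_csum => k; rewrite e|exact: hg].
Qed.

(** The noncommutative Leibniz sum: the derivative of [M ^+ k] when [M] varies by [M']. *)
Definition dpow d (M M' : 'M[C]_d) k : 'M[C]_d := \sum_(l < k) M ^+ l *m M' *m M ^+ (k - l.+1).

Lemma dpowS d (M M' : 'M[C]_d) k : dpow M M' k.+1 = dpow M M' k *m M + M ^+ k *m M'.
Proof.
rewrite /dpow big_ord_recr /= subnn expr0 mulmx1 mulmx_suml; congr (_ + _).
by apply: eq_bigr => l _; rewrite subSS -(subnSK (ltn_ord l)) exprSr -mulmxE !mulmxA.
Qed.

Lemma dpow_geo d (M M' : 'M[C]_d) : mgeo (fun k => M ^+ k) -> mgeo (dpow M M').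
Proof.
move=> hM i j; apply: geo_unshift.
have h : geo (fun k => \sum_p \sum_(l < k.+1) (M ^+ l *m M') i p * (M ^+ (k - l)) p j).
  by apply: geo_sum => p _; exact: (geo_conv (mgeo_mulr M' hM i p) (hM p j)).
apply: eq_geo h => k; rewrite summxE exchange_big /=.
by apply: eq_bigr => l _; rewrite [RHS]mxE subSS.
Qed.

Lemma mD_pow d v (M : V -> 'M[C]_d) x k : melem M -> U x ->
  mD v (fun y => M y ^+ k) x = dpow (M x) (mD v M x) k.
Proof.
move=> hM Ux; elim: k => [|k ih].
  rewrite /dpow big_ord0 -[RHS](mD_cst v 1%:M x); apply: mD_ext => // y _; by rewrite expr0.
rewrite dpowS -ih -mDM //; last exact: melem_pow.
by apply: mD_ext => // y _; rewrite exprSr -mulmxE.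
Qed.

Lemma msum_dpow d (M M' : 'M[C]_d) : mgeo (fun k => M ^+ k) ->
  msum (dpow M M') = invmx (1%:M - M) *m M' *m invmx (1%:M - M).
Proof.
move=> hM; have u := geo_powers_unit hM; have hd := dpow_geo M' hM.
have e : msum (dpow M M') *m (1%:M - M) = invmx (1%:M - M) *m M'.
  rewrite mulmxBr mulmx1 {1}(msum_recl hd) {1}/dpow big_ord0 add0r.
  rewrite (eq_msum (M' := fun k => dpow M M' k *m M + M ^+ k *m M')); last exact: dpowS.
  rewrite msumD; [|exact: mgeo_mulr|exact: mgeo_mulr].
  by rewrite (msum_mulr M hd) (msum_mulr M' hM) -(msum_powers hM) addrAC subrr add0r.
by rewrite -e mulmxK.
Qed.

Section Deriv.
Variables (d : nat) (a : V -> 'rV[C]_d) (M : V -> 'M[C]_d) (b : V -> 'cV[C]_d).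
Hypotheses (ha : melem a) (hM : melem M) (hb : melem b).
Hypothesis hg : forall x, U x -> mgeo (fun k => M x ^+ k).

Lemma mD_state v x k : U x -> mD v (fun y => a y *m M y ^+ k *m b y) x =
  mD v a x *m M x ^+ k *m b x + a x *m dpow (M x) (mD v M x) k *m b x + a x *m M x ^+ k *m mD v b x.
Proof.
move=> Ux; have hk := melem_pow k hM.
rewrite mDM //; last exact: melemM.
by rewrite mDM // mD_pow // mulmxDl.
Qed.
End Deriv.

Lemma cD_entry m n v (A : V -> 'M[C]_(m, n)) i j x : cD v (fun y => A y i j) x = mD v A x i j.
Proof. by rewrite mxE. Qed.

(** Both sides are computed: differentiating [a (1 - M)^-1 b] produces [(1 - M)^-1 M' (1 - M)^-1],
    which is the sum of [dpow] over all powers. *)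
Lemma ss_exchange v (f : nat -> V -> C) x : ss f -> U x ->
  cD v (fun y => csum (fun k => f k y)) x = csum (fun k => cD v (f k) x).
Proof.
move=> [d [a [M [b [ha hM hb hg e]]]]] Ux.
pose Q y := invmx (1%:M - M y).
have hI : melem Q.
  apply: melem_inv => [y Uy|]; first exact: geo_powers_unit (hg y Uy).
  by apply: melemD; [exact: melem_cst|exact: melemN].
have eQ : mD v Q x = Q x *m mD v M x *m Q x.
  have u := geo_powers_unit (hg x Ux).
  have : mD v (fun y => Q y *m (1%:M - M y)) x = 0.
    rewrite -(mD_cst v (1%:M : 'M[C]_d) x); apply: mD_ext => // y Uy.
    by rewrite mulVmx // (geo_powers_unit (hg y Uy)).
  rewrite mDM //; last by apply: melemD; [exact: melem_cst|exact: melemN].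
  rewrite mDD; [|exact: melem_cst|exact: melemN|exact: Ux].
  rewrite mD_cst add0r (_ : mD v (fun y => - M y) x = - mD v M x); last first.
    apply/matrixP => i j; rewrite !mxE -[RHS]mulN1r -[RHS]add0r -{1}(mul0r (M x i j)) -(cD_cst v (-1) x) -cDM //.
      by apply: cD_ext => // y _; rewrite mxE mulN1r.
    exact: celem_cst.
  move=> /eqP; rewrite mulmxN subr_eq0 => /eqP h.
  by rewrite -[LHS](mulmxK u) h.
rewrite (cD_ext v Ux (g := fun y => (a y *m Q y *m b y) 0 0)); last first.
  by move=> y Uy; rewrite -ss_csumE; [apply: eq_csum => k; rewrite e|exact: hg].
rewrite cD_entry mDM //; last exact: melemM.
rewrite mDM // eQ.
have gM := hg x Ux; have gD := dpow_geo (mD v M x) gM.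
have e2 k : cD v (f k) x = (mD v a x *m M x ^+ k *m b x + a x *m dpow (M x) (mD v M x) k *m b x
   + a x *m M x ^+ k *m mD v b x) 0 0.
  rewrite -(mD_state ha hM hb v k Ux) -cD_entry; apply: cD_ext => // y Uy; by rewrite e.
rewrite (eq_csum e2).
transitivity ((msum (fun k => mD v a x *m M x ^+ k *m b x + a x *m dpow (M x) (mD v M x) k *m b x
   + a x *m M x ^+ k *m mD v b x)) 0 0); last by rewrite mxE.
have g1 := mgeo_mulr (b x) (mgeo_mull (mD v a x) gM).
have g2 := mgeo_mulr (b x) (mgeo_mull (a x) gD).
have g3 := mgeo_mulr (mD v b x) (mgeo_mull (a x) gM).
rewrite msumD //; last exact: mgeoD.
rewrite msumD // (msum_mulr _ (mgeo_mull (mD v a x) gM)) (msum_mulr _ (mgeo_mull (a x) gD)).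
rewrite (msum_mulr _ (mgeo_mull (a x) gM)) (msum_mull _ gM) (msum_mull _ gD) (msum_mull _ gM).
by rewrite (msum_dpow _ gM) (msum_powers gM) -/(Q x) mulmxDl.
Qed.

(** A stable block-triangular matrix generates the Leibniz sums, so derivatives keep the state-space
    form, with doubled dimension. *)
Lemma block_pow d (M M' : 'M[C]_d) k :
  (block_mx M M' 0 M) ^+ k = block_mx (M ^+ k) (dpow M M' k) 0 (M ^+ k).
Proof.
elim: k => [|k ih]; first by rewrite !expr0 /dpow big_ord0 -scalar_mx_block.
rewrite exprSr -mulmxE ih mulmx_block !mul0mx !mulmx0 !addr0 add0r dpowS [X in block_mx _ X]addrC.
by rewrite !exprSr -!mulmxE.
Qed.

Lemma ss_cD v (f : nat -> V -> C) : ss f -> ss (fun k => cD v (f k)).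
Proof.
move=> [d [a [M [b [ha hM hb hg e]]]]].
exists (d + d)%N, (fun x => row_mx (a x) (mD v a x)),
  (fun x => block_mx (M x) (mD v M x) 0 (M x)), (fun x => col_mx (mD v b x) (b x)).
have hbl m1 m2 n1 n2 (A : V -> 'M[C]_(m1, n1)) (B : V -> 'M[C]_(m1, n2)) (D : V -> 'M[C]_(m2, n1)) (E : V -> 'M[C]_(m2, n2)) :
    melem A -> melem B -> melem D -> melem E -> melem (fun x => block_mx (A x) (B x) (D x) (E x)).
  move=> h1 h2 h3 h4 i j.
  case: (splitP i) => i' ei; case: (splitP j) => j' ej;
   [have -> : i = lshift _ i' by apply: val_inj|have -> : i = lshift _ i' by apply: val_inj
   |have -> : i = rshift _ i' by apply: val_inj|have -> : i = rshift _ i' by apply: val_inj];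
   [have -> : j = lshift _ j' by apply: val_inj|have -> : j = rshift _ j' by apply: val_inj
   |have -> : j = lshift _ j' by apply: val_inj|have -> : j = rshift _ j' by apply: val_inj].
  - by apply: celem_ext (h1 i' j') => x _; rewrite block_mxEul.
  - by apply: celem_ext (h2 i' j') => x _; rewrite block_mxEur.
  - by apply: celem_ext (h3 i' j') => x _; rewrite block_mxEdl.
  - by apply: celem_ext (h4 i' j') => x _; rewrite block_mxEdr.
split.
- move=> i j; case: (splitP j) => j' ej.
    have -> : j = lshift _ j' by apply: val_inj.
    by apply: celem_ext (ha i j') => x _; rewrite row_mxEl.
  have -> : j = rshift _ j' by apply: val_inj.
  by apply: celem_ext (melem_mD v ha i j') => x _; rewrite row_mxEr.
- by apply: hbl => //; [exact: melem_mD|exact: melem_cst].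
- move=> i j; case: (splitP i) => i' ei.
    have -> : i = lshift _ i' by apply: val_inj.
    by apply: celem_ext (melem_mD v hb i' j) => x _; rewrite col_mxEu.
  have -> : i = rshift _ i' by apply: val_inj.
  by apply: celem_ext (hb i' j) => x _; rewrite col_mxEd.
- move=> x Ux; have gM := hg x Ux; have gD := dpow_geo (mD v M x) gM.
  move=> i j; apply: eq_geo (fun k => congr1 (fun X : 'M[C]_(d + d) => X i j) (esym (block_pow (M x) (mD v M x) k))) _.
  case: (splitP i) => i' ei; case: (splitP j) => j' ej;
   [have -> : i = lshift _ i' by apply: val_inj|have -> : i = lshift _ i' by apply: val_inj
   |have -> : i = rshift _ i' by apply: val_inj|have -> : i = rshift _ i' by apply: val_inj];
   [have -> : j = lshift _ j' by apply: val_inj|have -> : j = rshift _ j' by apply: val_inj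
   |have -> : j = lshift _ j' by apply: val_inj|have -> : j = rshift _ j' by apply: val_inj].
  - by apply: eq_geo (gM i' j') => k; rewrite block_mxEul.
  - by apply: eq_geo (gD i' j') => k; rewrite block_mxEur.
  - by apply: eq_geo (geo0 R) => k; rewrite block_mxEdl mxE.
  - by apply: eq_geo (gM i' j') => k; rewrite block_mxEdr.
- move=> x k Ux; rewrite block_pow mul_row_block mulmx0 addr0 mul_row_col.
  rewrite (cD_ext v Ux (g := fun y => (a y *m M y ^+ k *m b y) 0 0)); last by move=> y Uy; rewrite e.
  by rewrite cD_entry mD_state // mulmxDl addrC [mD v a x *m _ *m _ + _]addrC.
Qed.

Lemma ss_conj (f : nat -> V -> C) : ss f -> ss (fun k x => (f k x)^*).
Proof.
move=> [d [a [M [b [ha hM hb hg e]]]]].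
have cjX (X : 'M[C]_d) k : cj X ^+ k = cj (X ^+ k).
  elim: k => [|k ih]; first by rewrite !expr0 cj1.
  by rewrite !exprS -!mulmxE ih cjM.
exists d, (fun x => cj (a x)), (fun x => cj (M x)), (fun x => cj (b x)).
split; try exact: melem_cj.
- by move=> x Ux; apply: eq_mgeo (mgeo_cj (hg x Ux)) => k; rewrite cjX.
- by move=> x k Ux; rewrite e // cjX -!cjM cjE.
Qed.

Lemma tensmx1 m n : (1%:M : 'M[C]_m) *t (1%:M : 'M[C]_n) = 1%:M.
Proof.
apply/matrixP => i j; case: (mxtens_indexP i) => i0 i1; case: (mxtens_indexP j) => j0 j1.
rewrite tensmxE !mxE (inj_eq (can_inj (@mxtens_indexK m n))) xpair_eqE.
by case: eqP => _; case: eqP => _; rewrite ?mulr1 ?mulr0.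
Qed.

Lemma tensmx_pow m n (A : 'M[C]_m) (B : 'M[C]_n) k : (A *t B) ^+ k = (A ^+ k) *t (B ^+ k).
Proof.
elim: k => [|k ih]; first by rewrite !expr0 tensmx1.
by rewrite !exprS -!mulmxE ih tensmx_mul.
Qed.

Lemma melem_tens m n p q (A : V -> 'M[C]_(m, n)) (B : V -> 'M[C]_(p, q)) :
  melem A -> melem B -> melem (fun x => A x *t B x).
Proof. by move=> hA hB i j; apply: celem_ext (celemM (hA _ _) (hB _ _)) => x _; rewrite mxE. Qed.

(** The Kronecker product realizes the termwise product, because powers and products are taken
    factor by factor. *)
Lemma ssM (f g : nat -> V -> C) : ss f -> ss g -> ss (fun k x => f k x * g k x).
Proof.
move=> [d [a [M [b [ha hM hb hg e]]]]] [d' [a' [M' [b' [ha' hM' hb' hg' e']]]]].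
exists (d * d')%N, (fun x => a x *t a' x : 'rV[C]_(d * d')), (fun x => M x *t M' x),
  (fun x => b x *t b' x : 'cV[C]_(d * d')).
split; [exact: (melem_tens ha ha')|exact: (melem_tens hM hM')|exact: (melem_tens hb hb')| |].
- move=> x Ux i j; apply: eq_geo (geoM (hg x Ux _ _) (hg' x Ux _ _)) => k.
  by rewrite tensmx_pow [RHS]mxE.
- move=> x k Ux; rewrite e // e' // tensmx_pow.
  have h := congr1 (fun X : 'M[C]_1 => X 0 0) (tensmx_mul (a x *m M x ^+ k) (a' x *m M' x ^+ k) (b x) (b' x)).
  have h' := tensmx_mul (a x) (a' x) (M x ^+ k) (M' x ^+ k).
  rewrite h' h [RHS]mxE; congr (_ * _); by rewrite !ord1.
Qed.

End ComplexElementary.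

(** * The symplectic form in action-angle variables *)

Section CauchyProduct.
Variable R : realType.
Local Notation C := (R[i]).
Implicit Types (f g : nat -> C).

Lemma ccvg_bounded (s : nat -> C) l (B : R) : ccvg s l -> (forall n, cabs (s n) <= B) ->
  cabs l <= 2 * B.
Proof.
move=> [hr hi] sB.
have bnd (t : nat -> R) (m : R) : (t @ \oo --> m)%classic -> (forall n, `|t n| <= B) -> `|m| <= B.
  move=> ht tB; have h : ((fun n => `|t n|) @ \oo --> `|m|)%classic by apply: cvg_norm.
  by apply: (cvgr_to_le h); near=> n; exact: tB.
have hR := bnd _ _ hr (fun n => le_trans (le_Re_cabs _) (sB n)).
have hI := bnd _ _ hi (fun n => le_trans (le_Im_cabs _) (sB n)).
rewrite -(complexK l) (_ : Complex _ _ = (complex.Re l)%:C%C + 'i%C * (complex.Im l)%:C%C); last first.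
  by apply: complex_eq; rewrite /= ?mul0r ?mul1r ?subr0 ?addr0 ?add0r ?mulr0 ?oppr0.
apply: le_trans (cabsD _ _) _; rewrite cabsM !cabs_real (_ : cabs 'i%C = 1) ?mul1r; last first.
  by rewrite /cabs /= expr0n /= expr1n add0r sqrtr1.
by rewrite mulr2n mulrDl mul1r lerD.
Unshelve. all: end_near. Qed.

Lemma geo_tail g : geo g -> geo (fun m => csum (fun l => g (l + m)%N)).
Proof.
move=> hg; have [K [r [K0 r0 r1 h]]] := hg.
have r1' : 0 < 1 - r by rewrite subr_gt0.
exists (2 * (K / (1 - r))), r; split => //.
  by rewrite mulr_ge0 // divr_ge0 // ltW.
move=> m; rewrite -mulrA; apply: (ccvg_bounded (geo_summable (geo_shift m hg))) => k.
apply: le_trans (cabs_sum _ _ _) _.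
apply: le_trans (_ : \sum_(i < k) K * r ^+ m * r ^+ i <= _).
  by apply: ler_sum => i _; rewrite -mulrA -exprD addnC; exact: h.
rewrite -mulr_sumr -[leRHS]mulrA [_^-1 * _]mulrC mulrA ler_wpM2l ?mulr_ge0 ?exprn_ge0 //.
rewrite -[leRHS]mul1r ler_pdivlMr //.
rewrite -[X in _ * X]opprB mulrN mulrC -subrX1 opprB gerBl exprn_ge0 //.
Qed.

(** The defect between the partial sum and the product is the convolution of [f] with the tails of
    [g]; the tails decay geometrically, so the defect does. *)
Lemma csum_conv f g : geo f -> geo g ->
  csum (fun n => \sum_(k < n.+1) f k * g (n - k)%N) = csum f * csum g.
Proof.
move=> hf hg; pose T m := csum (fun l => g (l + m)%N).
have T0 : T 0%N = csum g by apply: eq_csum => l; rewrite addn0.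
have TS m : T m = g m + T m.+1.
  rewrite /T (csum_recl (geo_shift m hg)) add0n; congr (_ + _).
  by apply: eq_csum => l; rewrite addnS addSn.
have e M : \sum_(n < M) \sum_(k < n.+1) f k * g (n - k)%N =
    (\sum_(k < M) f k) * csum g - \sum_(k < M) f k * T (M - k)%N.
  elim: M => [|M ih]; first by rewrite !big_ord0 mul0r subr0.
  rewrite big_ord_recr ih /= [in RHS]big_ord_recr /= mulrDl.
  have -> : \sum_(k < M.+1) f k * g (M - k)%N =
      \sum_(k < M.+1) f k * T (M - k)%N - \sum_(k < M.+1) f k * T (M.+1 - k)%N.
    rewrite -sumrB; apply: eq_bigr => k _.
    by rewrite -mulrBr (subSn (ltn_ord k : (k <= M)%N)) (TS (M - k)%N) addrK.
  by rewrite big_ord_recr /= subnn T0 !addrA subrK.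
apply: csumP; apply: (eq_ccvg (s := fun M => (\sum_(k < M) f k) * csum g - \sum_(k < M) f k * T (M - k)%N)).
  by move=> M; rewrite e.
rewrite -[X in ccvg _ X]subr0; apply: ccvgB.
  by apply: ccvgM; [exact: geo_summable|exact: ccvg_cst].
apply: geo_ccvg0; apply: geo_unshift.
apply: eq_geo (geo_conv hf (geo_shift 1 (geo_tail hg))) => n.
by apply: eq_bigr => k _; rewrite addn1 subSn // -ltnS.
Qed.

End CauchyProduct.

(** * Pairing a variation of the symbol with Cauchy squares *)

Section Pairing.
Variables (R : realType) (N : nat).
Local Notation C := (R[i]).
Variables (Y Y' : nat -> 'rV[C]_N) (lam lam' : 'I_N -> R) (u' : nat -> C).
Hypotheses (hY : mgeo Y) (hY' : mgeo Y').
Hypothesis YY : forall i j, csum (fun k => (Y k 0 i)^* * Y k 0 j) = (i == j)%:R.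
Hypothesis YY' : forall j, complex.Re (csum (fun k => (Y k 0 j)^* * Y' k 0 j)) = 0.
Hypothesis uE : forall k l, u' (k + l)%N =
  \sum_i ((lam i)%:C%C * Y' k 0 i * Y l 0 i + (lam' i)%:C%C * Y k 0 i * Y l 0 i
    + (lam i)%:C%C * Y k 0 i * Y' l 0 i).

(** The Taylor coefficients of the square of the function whose coefficients are column [j] of
    [Y]. *)
Definition yconv j n : C := \sum_(k < n.+1) Y k 0 j * Y (n - k)%N 0 j.

Lemma yconv_geo j : geo (yconv j).
Proof. exact: (geo_conv (hY 0 j) (hY 0 j)). Qed.

(* Splitting [u' n] along [n = k + (n - k)] turns the pairing into a finite sum
   of Cauchy products. *)
Lemma pairing j : complex.Re (csum (fun n => yconv j n * (u' n)^*)) = lam' j.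
Proof.
pose w i k := Y k 0 j * (Y k 0 i)^*.
pose w' i k := Y k 0 j * (Y' k 0 i)^*.
have gw i : geo (w i) by apply: geoM; [exact: hY|exact: geo_conj (hY 0 i)].
have gw' i : geo (w' i) by apply: geoM; [exact: hY|exact: geo_conj (hY' 0 i)].
pose cv (f g : nat -> C) n := \sum_(k < n.+1) f k * g (n - k)%N.
have gc f g : geo f -> geo g -> geo (cv f g) by exact: geo_conv.
have e n : yconv j n * (u' n)^* = \sum_i ((lam i)%:C%C * cv (w' i) (w i) n
    + (lam' i)%:C%C * cv (w i) (w i) n + (lam i)%:C%C * cv (w i) (w' i) n).
  rewrite mulr_suml /cv.
  under [RHS]eq_bigr do rewrite !mulr_sumr -!big_split /=.
  rewrite [RHS]exchange_big /=; apply: eq_bigr => k _.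
  have -> : u' n = u' (k + (n - k))%N by rewrite subnKC // -ltnS.
  rewrite uE rmorph_sum mulr_sumr /=.
  apply: eq_bigr => i _; rewrite !rmorphD !rmorphM /= !real_conj /w /w'.
  move: (Y k 0 j) (Y _ 0 j) (Y k 0 i)^* (Y' k 0 i)^* (Y _ 0 i)^* (Y' _ 0 i)^* (lam i)%:C%C (lam' i)%:C%C => a b c d p q l l'.
  by ring.
rewrite (eq_csum e) csum_sum; last first.
  by move=> i _; do 2?apply: geoD; apply: geoZ; apply: gc.
have wE i : csum (w i) = (i == j)%:R.
  by rewrite -YY; apply: eq_csum => k; rewrite mulrC.
rewrite (eq_bigr (fun i => (i == j)%:R * (2 * (lam i)%:C%C * csum (w' i) + (lam' i)%:C%C))); last first.
  move=> i _; rewrite csumD; [|by apply: geoD; apply: geoZ; apply: gc|by apply: geoZ; apply: gc].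
  rewrite csumD; [|by apply: geoZ; apply: gc|by apply: geoZ; apply: gc].
  rewrite !csumZ; try by apply: gc.
  rewrite !csum_conv // wE; case: (i == j); rewrite ?(mulr0, mul0r, addr0, mulr1, mul1r) //.
  by rewrite addrAC -mulrA [2]mulr2n mulrDl mul1r.
rewrite (bigD1 j) //= eqxx mul1r big1 ?addr0; last by move=> i /negbTE ->; rewrite mul0r.
have -> : csum (w' j) = (csum (fun k => (Y k 0 j)^* * Y' k 0 j))^*.
  rewrite -csum_conj; last by apply: geoM; [exact: geo_conj (hY 0 j)|exact: hY'].
  by apply: eq_csum => k; rewrite rmorphM /= conjCK.
have h := YY' j; move: (csum _) h => [a b] /= ->.
by rewrite !(mul0r, mulr0, addr0, add0r, subr0, oppr0, mul1r, mulr1, mulrN, mulNr).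
Qed.

End Pairing.

Section PairingDerivative.
Variables (R : realType) (V : normedModType R) (U : set V).
Variable base : (V -> R) -> Prop.
Hypothesis Uopen : forall x, U x -> nbhs x U.
Hypothesis Hbase : forall f, base f ->
  [/\ forall x, U x -> {for x, continuous f}, forall x v, U x -> derivable f x v &
      forall v, exists2 g, elem U base g & forall x, U x -> 'D_v f x = g x].
Local Notation C := (R[i]).
Variables (N : nat) (Y : nat -> V -> 'rV[C]_N) (lam : 'I_N -> V -> R) (u : nat -> V -> C).
Hypothesis hY : forall j, ss U base (fun k x => Y k x 0 j).
Hypothesis hlam : forall j, elem U base (lam j).
Hypothesis hT : forall x, U x -> takagi (fun k => u k x) (fun j => lam j x) (fun k => Y k x).

(** The hypotheses of [pairing] come from differentiation: unit norm makes the inner product of a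
    column with its derivative purely imaginary, and [uE] is the product rule for the Takagi
    form. *)
Lemma pairing_deriv x w j : U x ->
  complex.Re (csum (fun n => yconv (fun k => Y k x) j n * (cD w (u n) x)^*)) = 'D_w (lam j) x.
Proof.
move=> Ux; have [gY _ _] := hT Ux; have on := tak_on (hT Ux).
have cY k i : celem U base (fun x => Y k x 0 i) := ss_celem k (hY i).
have sY' i := ss_cD Uopen Hbase w (hY i).
apply: (pairing (Y' := fun k => mD w (Y k) x) (lam := fun i => lam i x)
  (lam' := fun i => 'D_w (lam i) x) gY _ on).
- move=> a i; rewrite (ord1 a).
  by apply: eq_geo (ss_geo (sY' i) Ux) => k; rewrite mxE.
- move=> i.
  have sc : ss U base (fun k x => (Y k x 0 i)^* * Y k x 0 i) by apply: ssM => //; exact: ss_conj.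
  have e0 : cD w (fun y => csum (fun k => (Y k y 0 i)^* * Y k y 0 i)) x = 0.
    rewrite (cD_ext Uopen w Ux (g := fun=> 1)) ?cD_cst // => y Uy.
    by rewrite (tak_on (hT Uy)) eqxx.
  move: e0; rewrite (ss_exchange Uopen Hbase w sc Ux).
  rewrite (eq_csum (g := fun k => (Y k x 0 i)^* * cD w (fun x => Y k x 0 i) x +
      ((Y k x 0 i)^* * cD w (fun x => Y k x 0 i) x)^*)); last first.
    move=> k; rewrite (cDM Uopen Hbase) //; last exact: celem_conj.
    by rewrite (cD_conj Uopen Hbase) // rmorphM /= conjCK addrC [X in _ + X]mulrC.
  have g : geo (fun k => (Y k x 0 i)^* * cD w (fun x => Y k x 0 i) x).
    by apply: geoM; [exact: geo_conj (gY 0 i)|exact: ss_geo (sY' i) Ux].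
  rewrite csumD //; last exact: geo_conj.
  rewrite csum_conj // => e0; have := congr1 (@complex.Re R) e0; rewrite cReD cRe_conj => h.
  rewrite (eq_csum (g := fun k => (Y k x 0 i)^* * cD w (fun x => Y k x 0 i) x)); last first.
    by move=> k; rewrite mxE.
  by move: h => /=; lra.
- move=> k l.
  rewrite (cD_ext Uopen w Ux (g := fun y => \sum_i (lam i y)%:C%C * Y k y 0 i * Y l y 0 i)); last first.
    by move=> y Uy; have [_ _ e] := hT Uy; rewrite -e.
  have hl i := celem_real (hlam i).
  rewrite (cD_sum Uopen Hbase) //; last by move=> i; do 2?apply: celemM.
  apply: eq_bigr => i _; rewrite (cDM Uopen Hbase) //; last by apply: celemM.
  rewrite (cDM Uopen Hbase) // !mxE.
  have -> : cD w (fun y => (lam i y)%:C%C) x = ('D_w (lam i) x)%:C%C.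
    by rewrite /cD /= derive_cst.
  by rewrite mulrDl addrAC addrC addrA [X in X + _]addrC.
Qed.

End PairingDerivative.

Section AngleVariation.
Variables (R : realType) (N : nat).
Local Notation C := (R[i]).
Variables (y s : 'rV[C]_N) (A a B : 'M[C]_N).

(** Each of the [n + 1] gaps in the product [y A ... A s^T] receives [a] twice, once from either
    neighbour, while each factor [A] is replaced by [2 B] once. *)
Lemma angle_state n : a^T = a ->
  y *m a *m A ^+ n *m s^T + y *m dpow A (a *m A + A *m a + (B + B)) n *m s^T
    + y *m A ^+ n *m (s *m a)^T =
  (\sum_(l < n.+1) (y *m A ^+ l) *m a *m (A ^+ (n - l) *m s^T)) *+ 2 +
  (\sum_(l < n) (y *m A ^+ l) *m B *m (A ^+ (n - l.+1) *m s^T)) *+ 2.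
Proof.
move=> aT; pose F l := (y *m A ^+ l) *m a *m (A ^+ (n - l) *m s^T).
have e : y *m dpow A (a *m A + A *m a + (B + B)) n *m s^T = \sum_(l < n) F l + \sum_(l < n) F l.+1 +
    (\sum_(l < n) (y *m A ^+ l) *m B *m (A ^+ (n - l.+1) *m s^T)) *+ 2.
  rewrite /dpow mulmx_sumr mulmx_suml mulr2n -!big_split /=; apply: eq_bigr => l _.
  rewrite /F -(subnSK (ltn_ord l)) (exprS A (n - l.+1)) (exprSr A l) -!mulmxE.
  by rewrite !(mulmxDr, mulmxDl) !mulmxA.
have e1 : \sum_(l < n.+1) F l = \sum_(l < n) F l + F n by rewrite big_ord_recr.
have e2 : \sum_(l < n.+1) F l = F 0%N + \sum_(l < n) F l.+1 by rewrite big_ord_recl.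
have -> : y *m a *m A ^+ n *m s^T = F 0%N by rewrite /F expr0 mulmx1 subn0 !mulmxA.
have -> : y *m A ^+ n *m (s *m a)^T = F n by rewrite /F subnn expr0 mul1mx trmx_mul aT !mulmxA.
rewrite e; set W := _ *+ 2; rewrite [X in _ = X + W](_ : _ = \sum_(l < n.+1) F l + \sum_(l < n.+1) F l) ?mulr2n //.
by rewrite {1}e1 e2 [LHS](@GRing.add _).[AC (1*3*1) (2*5*(1*3)*4)].
Qed.

End AngleVariation.

Section AngleAlgebra.
Variables (R : comNzRingType) (N : nat).
Implicit Types (a d U M W L Li : 'M[R]_N).

Lemma angle_product a d U M W Li : a *m Li = Li *m a -> d *m M = M *m d ->
  ((a *m U + U *m d) *m M *m W + U *m M *m (W *m a + d *m W)) *m Li =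
  a *m (U *m M *m W *m Li) + U *m M *m W *m Li *m a
  + (U *m d *m M *m W *m Li + U *m d *m M *m W *m Li).
Proof.
move=> cL cM; rewrite !(mulmxDl, mulmxDr) !mulmxA -(mulmxA (U *m M *m W) a Li) cL mulmxA.
by rewrite -(mulmxA U M d) -cM mulmxA (@GRing.add _).[AC (2*2) (1*3*(2*4))].
Qed.

Lemma angle_cancel (X : 'rV[R]_N) U d M W Li L (Z : 'cV[R]_N) : Li *m L = 1%:M ->
  X *m (U *m d *m M *m W *m Li) *m (L *m Z) = X *m U *m (d *m M) *m (W *m Z).
Proof.
by move=> e; rewrite !mulmxA -(mulmxA _ Li L) e mulmx1.
Qed.

End AngleAlgebra.

Section ElementaryExtra.
Variables (R : realType) (V : normedModType R) (U : set V).
Variable base : (V -> R) -> Prop.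
Local Notation elem := (elem U base).

Lemma elem_sub (f g : V -> R) : elem f -> elem g -> elem (fun x => f x - g x).
Proof. by move=> hf hg; apply: elem_add => //; exact: elem_opp. Qed.

Lemma elem_sum I (r : seq I) (P : pred I) (F : I -> V -> R) :
  (forall i, elem (F i)) -> elem (fun x => \sum_(i <- r | P i) F i x).
Proof.
move=> h; elim: r => [|i r ih].
  by apply: elem_ext (elem_cst _ _ 0) => x _; rewrite big_nil.
case Pi: (P i).
  by apply: elem_ext (elem_add (h i) ih) => x _; rewrite big_cons Pi.
by apply: elem_ext ih => x _; rewrite big_cons Pi.
Qed.

Lemma elem_prod I (r : seq I) (P : pred I) (F : I -> V -> R) :
  (forall i, elem (F i)) -> elem (fun x => \prod_(i <- r | P i) F i x).
Proof.
move=> h; elim: r => [|i r ih].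
  by apply: elem_ext (elem_cst _ _ 1) => x _; rewrite big_nil.
case Pi: (P i).
  by apply: elem_ext (elem_mul (h i) ih) => x _; rewrite big_cons Pi.
by apply: elem_ext ih => x _; rewrite big_cons Pi.
Qed.

Lemma cD_line_cst (f : V -> R[i]) x v : (forall h : R, f (h *: v + x) = f x) -> cD v f x = 0.
Proof.
move=> e; have h (g : R[i] -> R) : 'D_v (fun y => g (f y)) x = 0.
  rewrite derive_line (_ : (fun h : R => g (f (h *: v + x))) = fun=> g (f x)) ?derive_cst //.
  by apply/funext => h; rewrite e.
by apply: complex_eq; rewrite /= h.
Qed.

Lemma mD_line_cst m n (A : V -> 'M[R[i]]_(m, n)) x v : (forall h : R, A (h *: v + x) = A x) ->
  mD v A x = 0.
Proof. by move=> e; apply/matrixP => i j; rewrite !mxE; apply: cD_line_cst => h; rewrite e. Qed.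

End ElementaryExtra.

Section Coordinates.
Variables (R : realType) (m n : nat).
Local Notation V := 'M[R]_(m, n).

Lemma coord_line (i : 'I_m) (j : 'I_n) (x v : V) :
  derivable (fun y : V => y i j) x v /\ 'D_v (fun y : V => y i j) x = v i j.
Proof.
have e : (fun h : R => (h *: v + x) i j) = (fun h : R => h * v i j + x i j).
  by apply/funext => h; rewrite !mxE.
have d : is_derive (0 : R) (1 : R) (fun h : R => h * v i j + x i j) (v i j).
  have di := @derivable_id R R 0 1; have dc (c : R) := @derivable_cst R R R c 0 1.
  have dm : derivable (fun h : R => h * v i j) 0 1 by apply: derivableM; [exact: di|exact: dc].
  split; first by apply: derivableD; [exact: dm|exact: dc].
  have h1 := deriveD dm (dc (x i j)); have h2 := deriveM di (dc (v i j)).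
  rewrite [LHS]h1 [X in X + _]h2 derive_id !derive_cst scaler0 add0r addr0.
  by rewrite -[_ *: 1]/(_ * 1) mulr1.
split; first by apply/derivable_line; rewrite e; case: d.
by rewrite derive_line e; case: d.
Qed.

Lemma elem_coord (U : set V) base i j : elem U base (fun x : V => x i j).
Proof.
apply: elem_lin.
- by move=> x v; have [] := coord_line i j x v.
- by move=> x v; have [] := coord_line i j x v.
- by move=> a v w; rewrite !mxE.
- exact: coord_continuous.
Qed.

End Coordinates.

(** * The symbol as a function of actions and angles *)

Section ActionAngle.
Variables (R : realType) (n : nat).
Local Notation C := (R[i]).
Local Notation N := n.+1.
Local Notation V := 'M[R]_(4, N).
Implicit Types (x y v w t : V).

Definition Dom : set V := fun x => OmegaN (fun j => x r0 j) (fun j => x r1 j).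
(** In these coordinates the eigenvalues are square roots of half the actions, so no further
    generator occurs and the symmetry lemmas are available. *)
Definition nob : (V -> R) -> Prop := fun=> False.

Lemma nobP : forall f, nob f ->
  [/\ forall x, Dom x -> {for x, continuous f}, forall x v, Dom x -> derivable f x v &
      forall v, exists2 g, elem Dom nob g & forall x, Dom x -> 'D_v f x = g x].
Proof. by []. Qed.

Lemma nobN f : ~ nob f. Proof. by []. Qed.

Lemma near_gt_coord x (i i' : 'I_4) (j j' : 'I_N) : x i j < x i' j' ->
  nbhs x (fun y : V => y i j < y i' j').
Proof.
move=> h; have c : {for x, continuous (fun y : V => y i' j' - y i j)}.
  by apply: continuousB; exact: coord_continuous.
have h' : 0 < x i' j' - x i j by rewrite subr_gt0.
have := @cvgr_gt R V (nbhs x) (nbhs_filter x) (fun y : V => y i' j' - y i j) _ c 0 h'.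
by apply: filterS => y; rewrite subr_gt0.
Qed.

Lemma near_gt0_coord x (i : 'I_4) (j : 'I_N) : 0 < x i j -> nbhs x (fun y : V => 0 < y i j).
Proof.
move=> h; have c : {for x, continuous (fun y : V => y i j)} by exact: coord_continuous.
exact: (@cvgr_gt R V (nbhs x) (nbhs_filter x) (fun y : V => y i j) _ c 0 h).
Qed.

Lemma Dom_open x : Dom x -> nbhs x Dom.
Proof.
move=> [h1 [h2 h3]].
have n1 : nbhs x (fun y : V => forall j, y r1 j < y r0 j).
  by apply: (@filter_forall V _ (fun j (y : V) => y r1 j < y r0 j) (nbhs x) (nbhs_filter x)) => j; apply: near_gt_coord.
have n2 : nbhs x (fun y : V => forall j k : 'I_N, k = j.+1 :> nat -> y r0 k < y r1 j).
  apply: (@filter_forall V _ (fun (j : 'I_N) (y : V) => forall k : 'I_N, k = j.+1 :> nat -> y r0 k < y r1 j) (nbhs x) (nbhs_filter x)) => j.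
  apply: (@filter_forall V _ (fun (k : 'I_N) (y : V) => k = j.+1 :> nat -> y r0 k < y r1 j) (nbhs x) (nbhs_filter x)) => k.
  have [e|ne] := eqVneq (k : nat) j.+1; last by apply: nearW => y e; rewrite e eqxx in ne.
  by apply: filterS (near_gt_coord (h2 j k e)) => y.
have n3 : nbhs x (fun y : V => forall j : 'I_N, j.+1 = N -> 0 < y r1 j).
  apply: (@filter_forall V _ (fun (j : 'I_N) (y : V) => j.+1 = N -> 0 < y r1 j) (nbhs x) (nbhs_filter x)) => j.
  have [e|ne] := eqVneq j.+1 N; last by apply: nearW => y e; rewrite e eqxx in ne.
  by apply: filterS (near_gt0_coord (h3 j e)) => y.
by apply: filterS3 n1 n2 n3 => y; split.
Qed.

Lemma Dom_interlaced x : Dom x -> interlaced (fun j => x r0 j) (fun j => x r1 j).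
Proof. by case=> h1 [h2 _]. Qed.

Lemma Dom_pos1 x j : Dom x -> 0 < x r1 j.
Proof.
move=> dx; have [_ [_ h3]] := dx.
have hm := h3 ord_max erefl.
have [e|ne] := eqVneq j ord_max; first by rewrite e.
apply: lt_trans hm _; apply: (int_bdecr (Dom_interlaced dx)).
by rewrite ltn_neqAle -ltnS ltn_ord andbT; exact: ne.
Qed.

Lemma Dom_pos0 x j : Dom x -> 0 < x r0 j.
Proof. by move=> dx; apply: lt_trans (Dom_pos1 j dx) _; have [h _] := dx; exact: h. Qed.

Definition lamf x j : R := Num.sqrt (x r0 j / 2).
Definition muf x j : R := Num.sqrt (x r1 j / 2).
(* [(1|e_j)] is the conjugate of [Y_0j], whence the sign of the half angles. *)
Definition epf x j : C := expi (- (x r2 j / 2)).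
Definition dlf x j : C := expi (- (x r3 j / 2)).

Lemma lamf_gt0 x : Dom x -> forall j, 0 < lamf x j.
Proof. by move=> dx j; rewrite sqrtr_gt0 divr_gt0 // Dom_pos0. Qed.

Lemma muf_gt0 x : Dom x -> forall j, 0 < muf x j.
Proof. by move=> dx j; rewrite sqrtr_gt0 divr_gt0 // Dom_pos1. Qed.

Lemma sq_lamf x j : Dom x -> sq (lamf x) j = x r0 j / 2.
Proof. by move=> dx; rewrite /sq sqr_sqrtr // ltW // divr_gt0 // Dom_pos0. Qed.

Lemma sq_muf x j : Dom x -> sq (muf x) j = x r1 j / 2.
Proof. by move=> dx; rewrite /sq sqr_sqrtr // ltW // divr_gt0 // Dom_pos1. Qed.

Lemma hintf x : Dom x -> interlaced (sq (lamf x)) (sq (muf x)).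
Proof.
move=> dx; have [h1 h2] := Dom_interlaced dx.
have p : 0 < 2^-1 :> R by rewrite invr_gt0.
split => [j|j k e]; rewrite sq_lamf // sq_muf // ltr_pM2r //.
exact: h2.
Qed.

Lemma expi_norm (a : R) : `|expi a| = 1 :> C.
Proof.
rewrite cabsE; have -> : cabs (expi a) = 1 :> R; last by [].
apply/eqP; rewrite -[_ == _](eqrXn2 (n := 2)) ?cabs_ge0 // expr1n cabs_sqr /= cos2Dsin2 //.
Qed.

Lemma epf_norm x j : `|epf x j| = 1. Proof. exact: expi_norm. Qed.
Lemma dlf_norm x j : `|dlf x j| = 1. Proof. exact: expi_norm. Qed.

Local Notation elem := (elem Dom nob).
Local Notation celem := (celem Dom nob).
Local Notation melem := (melem Dom nob).
Local Notation ss := (ss Dom nob).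

Lemma elem_half i j : elem (fun x => x i j / 2).
Proof. by apply: elem_mul; [exact: elem_coord|exact: elem_cst]. Qed.

Lemma elem_lamf j : elem (fun x => lamf x j).
Proof. by apply: elem_sqrt (elem_half _ _) => x dx; rewrite divr_gt0 // Dom_pos0. Qed.

Lemma elem_muf j : elem (fun x => muf x j).
Proof. by apply: elem_sqrt (elem_half _ _) => x dx; rewrite divr_gt0 // Dom_pos1. Qed.

Lemma celem_expi i j : celem (fun x => expi (- (x i j / 2))).
Proof. by split; [apply: elem_cos|apply: elem_sin]; exact: elem_opp (elem_half _ _). Qed.

Lemma elem_sq_lamf j : elem (fun x => sq (lamf x) j).
Proof. by apply: elem_ext (elem_half r0 j) => x dx; rewrite sq_lamf. Qed.

Lemma elem_sq_muf j : elem (fun x => sq (muf x) j).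
Proof. by apply: elem_ext (elem_half r1 j) => x dx; rewrite sq_muf. Qed.

Lemma elem_sqS j : elem (fun x => sqS (sq (lamf x)) (sq (muf x)) j).
Proof.
apply: elem_mul.
  by apply: elem_prod => m; apply: elem_sub; [exact: elem_sq_lamf|exact: elem_sq_muf].
apply: elem_inv.
  move=> x dx; apply/prodf_neq0 => k kj; rewrite subr_eq0; apply: contra kj => /eqP e.
  by rewrite eq_sym; apply/eqP; apply: (decr_inj (int_adecr (hintf dx)) e).
by apply: elem_prod => k; apply: elem_sub; exact: elem_sq_lamf.
Qed.

Lemma elem_gap j m : elem (fun x => (lamf x j ^+ 2 - muf x m ^+ 2)^-1).
Proof.
apply: elem_inv (elem_sub (elem_sq_lamf j) (elem_sq_muf m)) => x dx.
by rewrite subr_eq0; exact: int_neq (hintf dx) j m.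
Qed.

Lemma elem_ssd j : elem (fun x => ssd (lamf x) (muf x) j).
Proof. by apply: elem_sqrt (elem_sqS j) => x dx; exact: sqS_gt0 (hintf dx) j. Qed.

Lemma elem_kkd m : elem (fun x => kkd (lamf x) (muf x) m).
Proof.
apply: elem_sqrt => [x dx|]; first exact: sqK_gt0 (hintf dx) m.
have hden : elem (fun x => \sum_j sqS (sq (lamf x)) (sq (muf x)) j *
   ((lamf x j ^+ 2 - muf x m ^+ 2)^-1 * (lamf x j ^+ 2 - muf x m ^+ 2)^-1)).
  by apply: elem_sum => j; apply: elem_mul; [exact: elem_sqS|apply: elem_mul; exact: elem_gap].
apply: elem_ext (elem_inv _ hden) => [x dx|x dx].
  by rewrite /sqK; congr (_^-1); apply: eq_bigr => j _; rewrite -expr2 exprVn.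
rewrite -[X in X != 0]invrK invr_eq0 gt_eqF //.
suff -> : (\sum_j sqS (sq (lamf x)) (sq (muf x)) j *
   ((lamf x j ^+ 2 - muf x m ^+ 2)^-1 * (lamf x j ^+ 2 - muf x m ^+ 2)^-1))^-1 = sqK (sq (lamf x)) (sq (muf x)) m.
  exact: sqK_gt0 (hintf dx) m.
by rewrite /sqK; congr (_^-1); apply: eq_bigr => j _; rewrite -expr2 exprVn.
Qed.

Lemma elem_Od j m : elem (fun x => Od (lamf x) (muf x) j m).
Proof. by apply: elem_mul (elem_gap j m); apply: elem_mul; [exact: elem_ssd|exact: elem_kkd]. Qed.

Definition Uf x := Ud (lamf x) (muf x) (epf x) (dlf x).
Definition Af x := Ad (lamf x) (muf x) (epf x) (dlf x).
Definition sf x := sd (lamf x) (muf x) (epf x).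
Definition yf x := yd (lamf x) (muf x) (epf x).
Definition Yf k x := Yd (lamf x) (muf x) (epf x) (dlf x) k.
Definition cf k x := cd (lamf x) (muf x) (epf x) (dlf x) k.

Lemma melem_rdiag (h : V -> 'I_N -> R) : (forall j, elem (fun x => h x j)) ->
  melem (fun x => rdiag (h x)).
Proof.
move=> hh i j; case: (eqVneq i j) => [e|ne].
  by apply: celem_ext (celem_real (hh j)) => x _; rewrite !mxE e eqxx mulr1n.
by apply: celem_ext (celem_cst Dom nob 0) => x _; rewrite !mxE (negbTE ne) mulr0n.
Qed.

Lemma melem_Li : melem (fun x => rdiag (fun j => (lamf x j)^-1)).
Proof.
apply: melem_rdiag => j; apply: elem_inv (elem_lamf j) => x dx.
by rewrite gt_eqF // lamf_gt0.
Qed.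

Lemma melem_Uf : melem Uf.
Proof.
move=> j m; apply: celem_ext (celemM (celemM (celem_expi r2 j) (celem_real (elem_Od j m))) (celem_expi r3 m)) => x _.
by rewrite mxE.
Qed.

Lemma melem_Af : melem Af.
Proof.
apply: melemM melem_Li; apply: melemM (melem_tr melem_Uf); apply: melemM melem_Uf _.
by apply: melem_rdiag; exact: elem_muf.
Qed.

Lemma melem_sf : melem sf.
Proof.
move=> i j; apply: celem_ext (celemM (celem_real (elem_ssd j)) (celem_expi r2 j)) => x _.
by rewrite mxE.
Qed.

Lemma melem_yf : melem yf. Proof. exact: melemM melem_sf melem_Li. Qed.

Lemma Af_geo x : Dom x -> mgeo (fun k => Af x ^+ k).
Proof. by move=> dx; exact: (data_Ageo (lamf_gt0 dx) (hintf dx) (epf_norm x) (dlf_norm x)). Qed.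

Lemma ss_cf : ss cf.
Proof.
exists N, yf, Af, (fun x => (sf x)^T); split => //; [exact: melem_yf|exact: melem_Af| |exact: Af_geo].
exact: melem_tr melem_sf.
Qed.

Lemma mul_delta m (B : 'rV[C]_m) j : (B *m delta_mx j (0 : 'I_1)) 0 0 = B 0 j.
Proof. by rewrite -colE mxE. Qed.

Lemma ss_Yf j : ss (fun k x => Yf k x 0 j).
Proof.
exists N, yf, Af, (fun=> delta_mx j 0); split; [exact: melem_yf|exact: melem_Af|exact: melem_cst|exact: Af_geo|].
by move=> x k _; rewrite mul_delta.
Qed.

Lemma ss_Zf j : ss (fun k x => (Yf k x *m Uf x) 0 j).
Proof.
exists N, yf, Af, (fun x => Uf x *m delta_mx j 0); split; [exact: melem_yf|exact: melem_Af| |exact: Af_geo|].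
  by apply: melemM melem_Uf _; exact: melem_cst.
by move=> x k _; rewrite mulmxA mul_delta.
Qed.

Lemma takagi_f x : Dom x -> takagi (fun k => cf k x) (lamf x) (fun k => Yf k x).
Proof. by move=> dx; exact: (data_takagi (lamf_gt0 dx) (hintf dx) (epf_norm x) (dlf_norm x)). Qed.

Lemma takagi1_f x : Dom x -> takagi (fun k => cf k.+1 x) (muf x) (fun k => Yf k x *m Uf x).
Proof. by move=> dx; exact: (data_takagi1 (lamf_gt0 dx) (hintf dx) (epf_norm x) (dlf_norm x)). Qed.

Section AngleDirection.
Variables (x t : V).
Hypothesis dx : Dom x.
Hypotheses (t0 : forall j, t r0 j = 0) (t1 : forall j, t r1 j = 0).

(** The logarithmic derivative of the half-phases along [t], as they are [e^{- i x / 2}]. *)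
Let ang (i : 'I_4) : 'rV[C]_N := \row_j Complex 0 (- (t i j / 2)).
Let a : 'M[C]_N := diag_mx (ang r2).
Let d : 'M[C]_N := diag_mx (ang r3).

Let lam_line h : lamf (h *: t + x) = lamf x.
Proof. by apply/funext => j; rewrite /lamf !mxE t0 mulr0 add0r. Qed.

Let mu_line h : muf (h *: t + x) = muf x.
Proof. by apply/funext => j; rewrite /muf !mxE t1 mulr0 add0r. Qed.

Lemma cD_expi i j : cD t (fun y => expi (- (y i j / 2))) x = ang i 0 j * expi (- (x i j / 2)).
Proof.
have h := elem_opp (elem_half i j).
have eD : 'D_t (fun y : V => - (y i j / 2)) x = - (t i j / 2).
  rewrite (D_opp Dom_open nobP t (elem_half i j) dx).
  rewrite (D_mul Dom_open nobP t (elem_coord Dom nob i j) (elem_cst Dom nob 2^-1) dx).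
  by rewrite derive_cst mulr0 add0r (proj2 (coord_line i j x t)) mulrC.
rewrite mxE /cD /=.
rewrite (D_comp Dom_open nobP t (g := cos) (@derivable_cos R _) h dx).
rewrite (D_comp Dom_open nobP t (g := sin) (@derivable_sin R _) h dx) eD !derive_val.
apply: complex_eq => /=; rewrite ?mul0r ?add0r ?addr0.
  by rewrite mulNr mulrC.
by rewrite mulrC.
Qed.

Lemma mD_Uf : mD t Uf x = a *m Uf x + Uf x *m d.
Proof.
apply/matrixP => j m; rewrite mul_diag_mx mul_mx_diag !mxE.
have hO := celem_real (elem_Od j m); have he := celem_expi r2 j; have hd := celem_expi r3 m.
rewrite (cD_ext Dom_open t dx (g := fun y => epf y j * (Od (lamf y) (muf y) j m)%:C%C * dlf y m)); last first.
  by move=> y _; rewrite mxE.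
rewrite (cDM Dom_open nobP t (celemM he hO) hd dx) (cDM Dom_open nobP t he hO dx).
have -> : cD t (fun y => (Od (lamf y) (muf y) j m)%:C%C) x = 0.
  by apply: cD_line_cst => h /=; rewrite lam_line mu_line.
rewrite !cD_expi !mxE mulr0 addr0; congr (_ + _); first by rewrite !mulrA.
by rewrite -!mulrA; congr (_ * (_ * _)); rewrite mulrC.
Qed.

Lemma mD_sf : mD t sf x = sf x *m a.
Proof.
apply/matrixP => i j; rewrite mul_mx_diag !mxE.
rewrite (cD_ext Dom_open t dx (g := fun y => (ssd (lamf y) (muf y) j)%:C%C * epf y j)); last first.
  by move=> y _; rewrite mxE.
rewrite (cDM Dom_open nobP t (celem_real (elem_ssd j)) (celem_expi r2 j) dx).
have -> : cD t (fun y => (ssd (lamf y) (muf y) j)%:C%C) x = 0.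
  by apply: cD_line_cst => h /=; rewrite lam_line mu_line.
by rewrite cD_expi !mxE mul0r add0r -mulrA; congr (_ * _); rewrite mulrC.
Qed.

Let Li := rdiag (fun j => (lamf x j)^-1).
Let Mu := rdiag (muf x).

Let diagC (b c : 'rV[C]_N) : diag_mx b *m diag_mx c = diag_mx c *m diag_mx b.
Proof. by apply/matrixP => i j; rewrite !mul_diag_mx !mxE; case: eqP => [->|_]; rewrite ?mulr1n ?mulr0n ?mulr0 // mulrC. Qed.

Lemma mD_yf : mD t yf x = yf x *m a.
Proof.
rewrite (mDM Dom_open nobP t melem_sf melem_Li dx) mD_sf.
have -> : mD t (fun y => rdiag (fun j => (lamf y j)^-1)) x = 0.
  by apply: mD_line_cst => h /=; rewrite lam_line.
rewrite mulmx0 addr0.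
by rewrite /yf /yd -!mulmxA diagC.
Qed.

Lemma mD_Af : mD t Af x = a *m Af x + Af x *m a + (Uf x *m d *m Mu *m (Uf x)^T *m Li + Uf x *m d *m Mu *m (Uf x)^T *m Li).
Proof.
have hM : melem (fun y => rdiag (muf y)) by apply: melem_rdiag; exact: elem_muf.
have hUM := melemM melem_Uf hM; have hUT := melem_tr melem_Uf.
rewrite (mDM Dom_open nobP t (melemM hUM hUT) melem_Li dx).
rewrite (mDM Dom_open nobP t hUM hUT dx) (mDM Dom_open nobP t melem_Uf hM dx).
rewrite (mD_tr Dom_open t Uf dx) mD_Uf.
have -> : mD t (fun y => rdiag (muf y)) x = 0 by apply: mD_line_cst => h /=; rewrite mu_line.
have -> : mD t (fun y => rdiag (fun j => (lamf y j)^-1)) x = 0 by apply: mD_line_cst => h /=; rewrite lam_line.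
rewrite !mulmx0 !addr0 linearD /= !trmx_mul !tr_diag_mx -/Mu -/Li.
have -> : Af x = Uf x *m Mu *m (Uf x)^T *m Li by [].
have cL : a *m Li = Li *m a := diagC _ _.
have cM : d *m Mu = Mu *m d := diagC _ _.
exact: angle_product.
Qed.

Let sT : (sf x)^T = rdiag (lamf x) *m (yf x)^T.
Proof.
have l0 j : lamf x j != 0 by rewrite gt_eqF // lamf_gt0.
by rewrite -[LHS]mul1mx -(rdiagV l0) -mulmxA /yf /yd trmx_mul rdiag_tr.
Qed.

Let AkT k : Af x ^+ k *m (sf x)^T = rdiag (lamf x) *m (Yf k x)^T.
Proof.
have l0 j : lamf x j != 0 by rewrite gt_eqF // lamf_gt0.
rewrite sT mulmxA (symm_pow k (L := rdiag (lamf x))); last first.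
  have e : Af x *m rdiag (lamf x) = Uf x *m Mu *m (Uf x)^T.
    by rewrite /Af /Ad -mulmxA rdiagVl // mulmx1.
  rewrite -[in RHS](rdiag_tr (lamf x)) -trmx_mul e !trmx_mul trmxK rdiag_tr mulmxA //.
by have -> : (Yf k x)^T = (Af x ^+ k)^T *m (yf x)^T; [exact: trmx_mul|rewrite mulmxA].
Qed.

Let conv_diag m (Y : nat -> 'rV[C]_m) (b : 'rV[C]_m) l k :
  (Y l *m diag_mx b *m (Y k)^T) 0 0 = \sum_j b 0 j * (Y l 0 j * Y k 0 j).
Proof.
rewrite mxE; apply: eq_bigr => j _; rewrite mul_mx_diag !mxE.
by rewrite mulrAC mulrC.
Qed.

Let mx2 (A B : 'M[C]_1) : (A *+ 2 + B *+ 2) 0 0 = 2 * A 0 0 + 2 * B 0 0.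
Proof. by rewrite mxE !mulmxnE !mulr_natl. Qed.

(** The symmetry of [A] turns [A^m s^T] into [Lam Y_m^T], so the sums of [angle_state] become Cauchy
    squares. Those of [Z = Y U] start one index later, because the variation of [dl] uses up one
    factor [A]. *)
Lemma angle_cD k : cD t (cf k) x =
  2 * (\sum_j ang r2 0 j * (lamf x j)%:C%C * yconv (fun l => Yf l x) j k) +
  2 * (\sum_m ang r3 0 m * (muf x m)%:C%C *
        (if k is k'.+1 then yconv (fun l => Yf l x *m Uf x) m k' else 0)).
Proof.
have e : cD t (cf k) x = mD t (fun y => yf y *m Af y ^+ k *m (sf y)^T) x 0 0 by rewrite mxE.
rewrite e (mD_state Dom_open nobP melem_yf melem_Af (melem_tr melem_sf) t k dx).
rewrite mD_yf mD_Af (mD_tr Dom_open t sf dx) mD_sf.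
rewrite angle_state; last exact: tr_diag_mx.
rewrite mx2 !summxE; congr (_ * _ + _ * _).
  transitivity (\sum_(l < k.+1) \sum_j (ang r2 0 j * (lamf x j)%:C%C) * (Yf l x 0 j * Yf (k - l)%N x 0 j)).
    apply: eq_bigr => l _; rewrite AkT mulmxA -[X in X *m _]mulmxA mulmx_diag.
    rewrite (conv_diag (fun l => Yf l x)); apply: eq_bigr => j _; by rewrite !mxE.
  by rewrite exchange_big /=; apply: eq_bigr => j _; rewrite mulr_sumr.
transitivity (\sum_(l < k) \sum_m (ang r3 0 m * (muf x m)%:C%C) * ((Yf l x *m Uf x) 0 m * (Yf (k - l.+1)%N x *m Uf x) 0 m)).
  apply: eq_bigr => l _; rewrite AkT.
  have l0 j : lamf x j != 0 by rewrite gt_eqF // lamf_gt0.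
  have -> : yf x *m Af x ^+ l *m (Uf x *m d *m Mu *m (Uf x)^T *m Li) *m (rdiag (lamf x) *m (Yf (k - l.+1) x)^T) =
     (Yf l x *m Uf x) *m diag_mx (\row_m (ang r3 0 m * (muf x m)%:C%C)) *m (Yf (k - l.+1) x *m Uf x)^T.
    have -> : diag_mx (\row_m (ang r3 0 m * (muf x m)%:C%C)) = d *m Mu.
      by rewrite mulmx_diag; congr diag_mx; apply/rowP => j; rewrite !mxE.
    rewrite [(_ *m Uf x)^T]trmx_mul; exact: (angle_cancel (Yf l x) (Uf x) d Mu (Uf x)^T (Yf _ x)^T (rdiagVl l0)).
  rewrite (conv_diag (fun l => Yf l x *m Uf x)); apply: eq_bigr => j _; by rewrite !mxE.
rewrite exchange_big /=; apply: eq_bigr => m _; rewrite -mulr_sumr; congr (_ * _).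
case: k {e} => [|k']; first by rewrite big_ord0.
by apply: eq_bigr => l _; rewrite subSS.
Qed.

End AngleDirection.

Definition angular t := (forall j, t r0 j = 0) /\ (forall j, t r1 j = 0).
Definition radial v := (forall j, v r2 j = 0) /\ (forall j, v r3 j = 0).

Definition omf x v w : C := csum (fun k => cD v (cf k) x * (cD w (cf k) x)^*).

Lemma geo_cD x v : Dom x -> geo (fun k => cD v (cf k) x).
Proof. by move=> dx; exact: (ss_geo (ss_cD Dom_open nobP v ss_cf) dx). Qed.

Lemma geo_omf x v w : Dom x -> geo (fun k => cD v (cf k) x * (cD w (cf k) x)^*).
Proof. by move=> dx; apply: geoM; [exact: geo_cD|apply: geo_conj; exact: geo_cD]. Qed.

Lemma lam_dlam (h : V -> R) i j x w : elem h -> Dom x ->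
  (forall y, Dom y -> h y ^+ 2 = y i j / 2) -> h x * 'D_w h x = w i j / 4.
Proof.
move=> eh dx hsq.
have e := D_mul Dom_open nobP w eh eh dx.
rewrite (derive_ext Dom_open (g := fun y : V => y i j / 2)) // in e.
rewrite (D_mul Dom_open nobP w (elem_coord Dom nob i j) (elem_cst Dom nob 2^-1) dx) in e.
rewrite derive_cst mulr0 add0r (proj2 (coord_line i j x w)) in e.
by lra.
Qed.

(** The constants cancel: [4] from the form, [2] from the variation, [1/2] from the half angle, and
    [lam dlam = dI / 4] because [lam^2 = I / 2]. *)
Lemma om_angle x t w : Dom x -> angular t ->
  4 * complex.Im (omf x t w) = - \sum_j (t r2 j * w r0 j + t r3 j * w r1 j).
Proof.
move=> dx [t0 t1].
pose u' k := (cD w (cf k) x)^*; have gu : geo u' by apply: geo_conj; exact: geo_cD.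
pose P j := csum (fun k => yconv (fun l => Yf l x) j k * u' k).
pose Q m := csum (fun k => yconv (fun l => Yf l x *m Uf x) m k * u' k.+1).
have P_re j : complex.Re (P j) = 'D_w (fun y => lamf y j) x.
  exact: (pairing_deriv Dom_open nobP (lam := fun j y => lamf y j) ss_Yf elem_lamf takagi_f w j dx).
have Q_re m : complex.Re (Q m) = 'D_w (fun y => muf y m) x.
  exact: (pairing_deriv Dom_open nobP (lam := fun j y => muf y j) ss_Zf elem_muf takagi1_f w m dx).
pose ang i j : C := Complex 0 (- (t i j / 2)).
pose yc j k := yconv (fun l => Yf l x) j k.
pose zc m k : C := if k is k'.+1 then yconv (fun l => Yf l x *m Uf x) m k' else 0.
have [gY _ _] := takagi_f dx; have [gZ _ _] := takagi1_f dx.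
have gyc j : geo (fun k => yc j k * u' k) by apply: geoM => //; exact: yconv_geo.
have gzc m : geo (fun k => zc m k * u' k).
  apply: geoM => //; apply: geo_unshift; exact: yconv_geo.
have e : omf x t w = \sum_j 2 * (ang r2 j * (lamf x j)%:C%C) * P j
                   + \sum_m 2 * (ang r3 m * (muf x m)%:C%C) * Q m.
  transitivity (csum (fun k => \sum_j 2 * (ang r2 j * (lamf x j)%:C%C) * (yc j k * u' k)
     + \sum_m 2 * (ang r3 m * (muf x m)%:C%C) * (zc m k * u' k))).
    apply: eq_csum => k; rewrite (angle_cD dx t0 t1) mulrDl -!mulrA !mulr_suml !mulr_sumr.
    by congr (_ + _); apply: eq_bigr => j _; rewrite mxE !mulrA.
  rewrite csumD; [|by apply: geo_sum => j _; apply: geoZ|by apply: geo_sum => j _; apply: geoZ].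
  rewrite !csum_sum; [|by move=> j _; apply: geoZ|by move=> j _; apply: geoZ].
  congr (_ + _); apply: eq_bigr => j _; first by rewrite (csumZ _ (gyc j)).
  have ez : csum (fun k => zc j k * u' k) = Q j.
    by rewrite (csum_recl (gzc j)) mul0r add0r.
  by rewrite (csumZ _ (gzc j)) ez.
clearbody P Q; move: e; move: (omf x t w) => z ->.
have im (a b : R) (z' : C) : complex.Im (2 * (Complex 0 (- (a / 2)) * b%:C%C) * z') =
    - (a * (b * complex.Re z')).
  by case: z' => p q; rewrite !cImM !cReM /=; field.
have eP j : complex.Im (2 * (ang r2 j * (lamf x j)%:C%C) * P j) = - (t r2 j * (w r0 j / 4)).
  by rewrite im P_re (lam_dlam w (elem_lamf j) dx (fun y => @sq_lamf y j)).
have eQ j : complex.Im (2 * (ang r3 j * (muf x j)%:C%C) * Q j) = - (t r3 j * (w r1 j / 4)).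
  by rewrite im Q_re (lam_dlam w (elem_muf j) dx (fun y => @sq_muf y j)).
rewrite cImD !cIm_sum (eq_bigr _ (fun j _ => eP j)) (eq_bigr _ (fun j _ => eQ j)).
by rewrite -big_split mulr_sumr -sumrN; apply: eq_bigr => j _ /=; field.
Qed.

Lemma omf_conj x v w : Dom x -> omf x w v = (omf x v w)^*.
Proof.
move=> dx; rewrite -csum_conj; last exact: geo_omf.
by apply: eq_csum => k; rewrite rmorphM /= conjCK mulrC.
Qed.

Lemma om_anti x v w : Dom x -> complex.Im (omf x w v) = - complex.Im (omf x v w).
Proof. by move=> dx; rewrite omf_conj // cIm_conj. Qed.

Lemma cD_addv x v w k : Dom x -> cD (v + w) (cf k) x = cD v (cf k) x + cD w (cf k) x.
Proof.
move=> dx; have [h1 h2] := ss_celem k ss_cf.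
have e1 := D_linear Dom_open nobP nobN 1 v w h1 dx.
have e2 := D_linear Dom_open nobP nobN 1 v w h2 dx.
rewrite scale1r mul1r in e1; rewrite scale1r mul1r in e2.
by apply: complex_eq; rewrite ?cReD ?cImD /=.
Qed.

Lemma om_addl x v v' w : Dom x ->
  complex.Im (omf x (v + v') w) = complex.Im (omf x v w) + complex.Im (omf x v' w).
Proof.
move=> dx; rewrite -cImD /omf -csumD; [|exact: geo_omf|exact: geo_omf].
by congr complex.Im; apply: eq_csum => k; rewrite cD_addv // mulrDl.
Qed.

Lemma cD_comm x v w k : Dom x -> cD v (cD w (cf k)) x = cD w (cD v (cf k)) x.
Proof.
move=> dx; have [h1 h2] := ss_celem k ss_cf.
apply: complex_eq; rewrite /=.
  exact: (D_sym Dom_open nobP nobN v w h1 dx).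
exact: (D_sym Dom_open nobP nobN v w h2 dx).
Qed.

Lemma cD_omf x t v w : Dom x -> cD t (fun y => omf y v w) x =
  csum (fun k => cD t (cD v (cf k)) x * (cD w (cf k) x)^*) +
  (csum (fun k => cD t (cD w (cf k)) x * (cD v (cf k) x)^*))^*.
Proof.
move=> dx; have sv u := ss_cD Dom_open nobP u ss_cf.
have s2 u u' := ss_cD Dom_open nobP u (sv u').
have s : ss (fun k y => cD v (cf k) y * (cD w (cf k) y)^*) by apply: ssM => //; apply: ss_conj.
have g u u' u'' : geo (fun k => cD u (cD u' (cf k)) x * (cD u'' (cf k) x)^*).
  by apply: geoM; [exact: ss_geo (s2 u u') dx|apply: geo_conj; exact: geo_cD].
rewrite (ss_exchange Dom_open nobP t s dx) -csum_conj // -csumD //; last exact: geo_conj.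
apply: eq_csum => k; have c u := ss_celem k (sv u).
rewrite (cDM Dom_open nobP t (c v) (celem_conj (c w)) dx) (cD_conj Dom_open nobP t (c w) dx).
by rewrite rmorphM /= conjCK [X in _ + X]mulrC.
Qed.

(* The form is closed, and its contraction with an angular field is constant. *)
Lemma om_invariant x t v w : Dom x -> angular t ->
  'D_t (fun y => complex.Im (omf y v w)) x = 0.
Proof.
move=> dx ht.
have cst u u' : 'D_u (fun y => complex.Im (omf y t u')) x = 0.
  rewrite (derive_ext Dom_open (g := fun=> - (\sum_j (t r2 j * u' r0 j + t r3 j * u' r1 j)) / 4)) //.
    exact: derive_cst.
  move=> y dy; have := om_angle u' dy ht.
  by move: (omf y t u') => p; lra.
have cst' u u' : 'D_u (fun y => complex.Im (omf y u' t)) x = 0.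
  rewrite (derive_ext Dom_open (g := fun=> (\sum_j (t r2 j * u' r0 j + t r3 j * u' r1 j)) / 4)) //.
    exact: derive_cst.
  move=> y dy; have := om_angle u' dy ht; have := om_anti t u' dy.
  by move: (omf y t u') (omf y u' t) => p q; lra.
have h u u' u'' : 'D_u (fun y => complex.Im (omf y u' u'')) x =
    complex.Im (csum (fun k => cD u (cD u' (cf k)) x * (cD u'' (cf k) x)^*)) -
    complex.Im (csum (fun k => cD u (cD u'' (cf k)) x * (cD u' (cf k) x)^*)).
  have := congr1 (@complex.Im R) (cD_omf u u' u'' dx); rewrite cImD cIm_conj => <- //.
have sw u u' u'' : csum (fun k => cD u (cD u' (cf k)) x * (cD u'' (cf k) x)^*) =
    csum (fun k => cD u' (cD u (cf k)) x * (cD u'' (cf k) x)^*).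
  by apply: eq_csum => k; rewrite cD_comm.
(* Closedness on constant fields: by symmetry of second derivatives the three cyclic derivatives add
   up to zero, and two of them vanish since they contain [t]. *)
have lin (D a b c d e f : R) : D = a - b -> c - d = 0 -> e - f = 0 -> c = f -> d = a -> e = b ->
  D = 0 by lra.
exact: (lin _ _ _ _ _ _ _ (h t v w) (etrans (esym (h v w t)) (cst' v w))
  (etrans (esym (h w t v)) (cst w v)) (congr1 _ (sw v w t)) (congr1 _ (sw v t w)) (congr1 _ (sw w t v))).
Qed.

Lemma elem_om v w : elem (fun y => complex.Im (omf y v w)).
Proof.
have sv u := ss_cD Dom_open nobP u ss_cf.
have s : ss (fun k y => cD v (cf k) y * (cD w (cf k) y)^*) by apply: ssM => //; apply: ss_conj.
by have [] := ss_csum s.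
Qed.

Lemma Dom_action x y : (forall j, x r0 j = y r0 j) -> (forall j, x r1 j = y r1 j) ->
  Dom x -> Dom y.
Proof.
move=> e0 e1 [h1 [h2 h3]]; split=> [j|]; first by rewrite -e0 -e1.
by split=> [j k e|j e]; rewrite -?e0 -?e1; [exact: h2|exact: h3].
Qed.

(** The segment from [x] to [t + x] changes only angles, so it stays in [Dom], and [om_invariant]
    makes the coefficient constant along it. *)
Lemma om_transport x t v w : Dom x -> angular t ->
  complex.Im (omf (t + x) v w) = complex.Im (omf x v w).
Proof.
move=> dx ht; have [t0 t1] := ht.
pose g (s : R) := complex.Im (omf (s *: t + x) v w).
have dom s : Dom (s *: t + x).
  by apply: Dom_action dx => j; rewrite !mxE ?t0 ?t1 mulr0 add0r.
have dg s : is_derive s (1 : R) g 0.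
  have e : (fun h : R => g (h *: (1 : R) + s)) = (fun h : R => complex.Im (omf (h *: t + (s *: t + x)) v w)).
    by apply/funext => h; rewrite /g addrA -scalerDl -[h *: 1]/(h * 1) mulr1.
  split.
    apply/derivable_line; rewrite e.
    apply: (proj1 (derivable_line (fun y : V => complex.Im (omf y v w)) (s *: t + x) t)).
    exact: (elem_derivable Dom_open nobP (elem_om v w) (dom s)).
  rewrite derive_line e -(derive_line (fun y : V => complex.Im (omf y v w)) (s *: t + x) t).
  exact: om_invariant.
have := is_derive_0_is_cst 1 0 dg; rewrite /g scale1r scale0r add0r; exact.
Qed.

Lemma cf_real k y : radial y -> complex.Im (cf k y) = 0.
Proof.
move=> [y2 y3].
have e1 : epf y = fun=> 1.
  by apply/funext => j; rewrite /epf y2 mul0r oppr0 /expi cos0 sin0.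
have e2 : dlf y = fun=> 1.
  by apply/funext => j; rewrite /dlf y3 mul0r oppr0 /expi cos0 sin0.
have cs : cj (sf y) = sf y.
  by apply/matrixP => i j; rewrite !mxE e1 mulr1 real_conj.
have cU : cj (Uf y) = Uf y.
  by apply/matrixP => i j; rewrite !mxE e1 e2 mulr1 mul1r real_conj.
have cA : cj (Af y) = Af y by rewrite /Af /Ad !cjM !rdiag_cj cj_tr -/(Uf y) cU.
have cY l : cj (Yf l y) = Yf l y.
  elim: l => [|l ih]; first by rewrite /Yf /Yd expr0 mulmx1 /yd cjM rdiag_cj -/(sf y) cs.
  have -> : Yf l.+1 y = Yf l y *m Af y by rewrite /Yf /Yd exprSr -mulmxE mulmxA.
  by rewrite cjM ih cA.
have e : (cf k y)^* = cf k y.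
  rewrite /cf /cd -/(Yf k y) -/(sf y) -[LHS]cjE cjM cY cj_tr cs //.
by have := congr1 (@complex.Im R) e; rewrite cIm_conj; lra.
Qed.

Lemma om_radial x v w : Dom x -> radial x -> radial v -> radial w ->
  complex.Im (omf x v w) = 0.
Proof.
move=> dx [x2 x3] hv hw.
have r u k : radial u -> complex.Im (cD u (cf k) x) = 0.
  move=> [u2 u3] /=; rewrite derive_line.
  rewrite (_ : (fun h : R => complex.Im (cf k (h *: u + x))) = fun=> 0) ?derive_cst //.
  by apply/funext => h; apply: cf_real; split => j; rewrite !mxE ?u2 ?u3 ?x2 ?x3 mulr0 addr0.
transitivity (complex.Im (csum (fun=> 0 : C))); last by rewrite csum0.
rewrite -[LHS]/(rsum (fun k => complex.Im (cD v (cf k) x * (cD w (cf k) x)^*))).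
rewrite -[RHS]/(rsum (fun k : nat => 0)); congr rsum; apply/funext => k.
 have rv := r v k hv; have rw := r w k hw.
move: (cD v (cf k) x) (cD w (cf k) x) rv rw => p q rp rq; rewrite cImM cIm_conj rp rq.
by rewrite oppr0 mulr0 mul0r addr0.
Qed.

Definition apart x : V := \matrix_(i, j) if (i == r0) || (i == r1) then x i j else 0.
Definition tpart x : V := \matrix_(i, j) if (i == r0) || (i == r1) then 0 else x i j.

Lemma part_split x : x = tpart x + apart x.
Proof. by apply/matrixP => i j; rewrite !mxE; case: ifP => _; rewrite ?addr0 ?add0r. Qed.

Lemma apart_radial x : radial (apart x). Proof. by split => j; rewrite mxE. Qed.
Lemma tpart_angular x : angular (tpart x). Proof. by split => j; rewrite mxE. Qed.

(** Both vectors are split into angle and action parts; [om_angle] and antisymmetry handle every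
    term containing an angle part. *)
Lemma om_canonical x v w : Dom x -> 4 * complex.Im (omf x v w) =
  \sum_j ((v r0 j * w r2 j - w r0 j * v r2 j) + (v r1 j * w r3 j - w r1 j * v r3 j)).
Proof.
have lin (z1 z2 z3 z4 z5 z6 S1 S2 T : R) : z1 = z2 + z3 -> z3 = - z4 -> z4 = z5 + z6 ->
  z6 = 0 -> 4 * z2 = - S1 -> 4 * z5 = - S2 -> S2 - S1 = T -> 4 * z1 = T by lra.
move=> dx; have da : Dom (apart x) by apply: Dom_action dx => j; rewrite mxE.
have aa : complex.Im (omf x (apart w) (apart v)) = 0.
  (* The base point is moved to [apart x], with all angles zero, where variations in action
     directions are real. *)
  rewrite (part_split x) om_transport //; last exact: tpart_angular.
  by apply: om_radial => //; exact: apart_radial.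
have s1 : complex.Im (omf x v w) = complex.Im (omf x (tpart v) w) + complex.Im (omf x (apart v) w).
  by have := om_addl (tpart v) (apart v) w dx; rewrite -(part_split v).
have s2 := om_anti w (apart v) dx.
have s3 : complex.Im (omf x w (apart v)) =
    complex.Im (omf x (tpart w) (apart v)) + complex.Im (omf x (apart w) (apart v)).
  by have := om_addl (tpart w) (apart w) (apart v) dx; rewrite -(part_split w).
have h1 := om_angle w dx (tpart_angular v); have h2 := om_angle (apart v) dx (tpart_angular w).
apply: (lin _ _ _ _ _ _ _ _ _ s1 s2 s3 aa h1 h2); rewrite -sumrB; apply: eq_bigr => j _.
by rewrite !mxE /=; ring.
Qed.

Definition psi x : V := psid (Af x) (fun k => cf k x).

Lemma ucoef_psi x : ucoef (psi x) = fun k => cf k x.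
Proof. exact: data_ucoef. Qed.

Lemma psi_Gen x : Dom x -> Gen (psi x).
Proof.
by move=> dx; exact: (data_Gen (lamf_gt0 dx) (muf_gt0 dx) (hintf dx) (epf_norm x) (dlf_norm x)).
Qed.

Lemma expi_conj_sqr (a : R) : (expi (- (a / 2)))^* ^+ 2 = expi a :> C.
Proof.
rewrite expr2; apply: complex_eq; rewrite ?cReM ?cImM ?cRe_conj ?cIm_conj /= cosN sinN opprK.
  by rewrite -[in RHS](divfK (x := 2) _ a) ?mulr_natr ?mulr2n ?cosD // pnatr_eq0.
by rewrite -[in RHS](divfK (x := 2) _ a) ?mulr_natr ?mulr2n ?sinD ?pnatr_eq0 // mulrC [X in _ + X]mulrC addrC.
Qed.

Lemma chi_psi x : Dom x -> chi N (ucoef (psi x)) =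
  ((fun j => x r0 j), (fun j => x r1 j), (fun j => expi (x r2 j)), (fun j => expi (x r3 j))).
Proof.
move=> dx; rewrite ucoef_psi.
rewrite [LHS](data_chi (lamf_gt0 dx) (muf_gt0 dx) (hintf dx) (epf_norm x) (dlf_norm x)).
have h2 (a : R) : 2 * (a / 2) = a by rewrite mulrC divfK // pnatr_eq0.
congr (_, _, _, _); apply/funext => j.
- by rewrite -[lamf x j ^+ 2]/(sq (lamf x) j) sq_lamf.
- by rewrite -[muf x j ^+ 2]/(sq (muf x) j) sq_muf.
- exact: expi_conj_sqr.
- exact: expi_conj_sqr.
Qed.

Lemma psi_smooth a b : smooth_on Dom (fun x => psi x a b).
Proof.
apply: (elem_smooth_on Dom_open nobP).
have hb k : celem (fun x => bco (Af x) k) by exact: pelem_char_poly melem_Af _.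
have ha j : celem (fun x => aco (Af x) (fun k => cf k x) j).
  by apply: celem_sum => k _; apply: celemM => //; exact: ss_celem ss_cf.
have [a1 a2] := ha b; have [b1 b2] := hb b.+1.
have [e|n0] := eqVneq a r0; first by apply: elem_ext a1 => x _; rewrite mxE e.
have [e|n1] := eqVneq a r1; first by apply: elem_ext a2 => x _; rewrite mxE e.
have [e|n2] := eqVneq a r2; first by apply: elem_ext b1 => x _; rewrite mxE e.
by apply: elem_ext b2 => x _; rewrite mxE (negbTE n0) (negbTE n1) (negbTE n2).
Qed.

Lemma psi_symplectic x v w : Dom x -> omega_pull (fun y => ucoef (psi y)) x v w =
  \sum_j ((v r0 j * w r2 j - w r0 j * v r2 j) + (v r1 j * w r3 j - w r1 j * v r3 j)).
Proof.
move=> dx; rewrite -(om_canonical v w dx) /omega_pull; congr (_ * rsum _); apply/funext => k.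
rewrite cImM cRe_conj cIm_conj /= mulrN addrC.
have eR : (fun y : V => complex.Re (ucoef (psi y) k)) = fun y => complex.Re (cf k y).
  by apply/funext => y; rewrite ucoef_psi.
have eI : (fun y : V => complex.Im (ucoef (psi y) k)) = fun y => complex.Im (cf k y).
  by apply/funext => y; rewrite ucoef_psi.
by rewrite eR eI.
Qed.

End ActionAngle.

(** * Smoothness of the action-angle map *)

Section GenericChi.
Variables (R : realType) (n : nat).
Local Notation C := (R[i]).
Local Notation N := n.+1.
Implicit Types p : 'M[R]_(4, N).

(** The phase of the square: unaffected by nonzero real factors, hence by the sign of a Takagi
    vector. *)
Definition ph2 (z : C) : C := z ^+ 2 / `|z| ^+ 2.

Lemma ph2_real (z : C) (r : R) : `|z / r%:C%C| = 1 -> (z / r%:C%C) ^+ 2 = ph2 z.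
Proof.
move=> h; rewrite /ph2 expr_div_n; congr (_ / _).
have r0 : r%:C%C != 0 :> C.
  by apply/eqP => r0; move: h; rewrite r0 invr0 mulr0 normr0 => /esym/eqP; rewrite oner_eq0.
have e : `|z| = `|r%:C%C| by move: h; rewrite normf_div => /divr1_eq.
by rewrite e normCK real_conj expr2.
Qed.

Lemma ph2_norm z : z != 0 -> `|ph2 z| = 1.
Proof.
by move=> z0; rewrite /ph2 normf_div !normrX normr_id divff // expf_neq0 // normr_eq0.
Qed.

Definition factor (G T : 'M[C]_N) (b : 'cV[C]_N) (lam : 'I_N -> R) (V : 'M[C]_N) :=
  [/\ forall j, 0 < lam j, forall i j : 'I_N, (i < j)%N -> lam j < lam i,
      ct V *m G *m V = 1%:M, T = V *m rdiag lam *m V^T & forall j, (invmx V *m b) j 0 != 0].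

Lemma gram_unit (G V : 'M[C]_N) : ct V *m G *m V = 1%:M -> V \in unitmx.
Proof. by move=> h; have [] := mulmx1_unit h. Qed.

Lemma gen_chi p : Gen p -> exists (lam mu : 'I_N -> R) (V V1 : 'M[C]_N) (ep dl : 'I_N -> C),
  [/\ factor (Gp p) (Tp p) (bp p) lam V, factor (Gp p) (T1p p) (bp p) mu V1,
      interlaced (sq lam) (sq mu) /\ ucoef p = cd lam mu ep dl,
      (forall j, (ep j)^* ^+ 2 = ph2 ((invmx V *m bp p) j 0)^*) /\
      (forall j, (dl j)^* ^+ 2 = ph2 ((invmx V1 *m bp p) j 0)) &
      chi N (ucoef p) = (fun j => 2 * lam j ^+ 2, fun m => 2 * mu m ^+ 2,
        fun j => (ep j)^* ^+ 2, fun m => (dl m)^* ^+ 2)].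
Proof.
move=> gp; have [lam [mu [V [V1 [F F1 HY HZ]]]]] := gen_takagi gp.
have [l0 ld hV hT t0] := F; have [m0 md hV1 hT1 t10] := F1.
have uV := gram_unit hV; have uV1 := gram_unit hV1.
(* [V] and [V1] are both orthonormal for the Gram matrix [Gp p], so the transition matrix is
   unitary. *)
pose U := invmx V *m V1.
have eVU : V *m U = V1 by rewrite /U mulKVmx.
have HZ' : takagi (fun m => ucoef p m.+1) mu (fun k => rho p k *m V *m U).
  rewrite (_ : (fun k => rho p k *m V *m U) = fun k => rho p k *m V1) //.
  by apply/funext => k; rewrite -mulmxA eVU.
have UU : ct U *m U = 1%:M.
  have eG : Gp p = ct (invmx V) *m invmx V.
    rewrite -[LHS](mulmxK uV) -[X in X *m invmx V]mul1mx -(ct1 _ N) -(mulmxV uV) ctM -!mulmxA.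
    by rewrite (mulmxA (ct V)) (mulmxA _ V) hV mul1mx.
  by rewrite -hV1 eG /U ctM !mulmxA.
clearbody U.
have es : (rho p 0%N *m V *m rdiag lam)^T = invmx V *m bp p.
  have -> : bp p = V *m (rdiag lam *m (V^T *m (rho p 0%N)^T)) by rewrite bpE hT !mulmxA.
  by rewrite mulKmx // trmx_mul rdiag_tr trmx_mul.
have s0 j : (rho p 0%N *m V *m rdiag lam) 0 j != 0.
  by have := t0 j; rewrite -es mxE.
have eka : (cj (rho p 0%N *m V *m rdiag lam) *m U)^T = cj (invmx V1 *m bp p).
  have -> : invmx V1 *m bp p = ct U *m (invmx V *m bp p).
    rewrite -{1}(mulKVmx uV (bp p)); move: (invmx V *m bp p) => w.
    have -> : V = V1 *m ct U by rewrite -eVU -mulmxA (mulmx1C UU) mulmx1.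
    by rewrite -mulmxA mulKmx.
  by rewrite -es; move: (rho p 0%N *m V *m rdiag lam) => s; rewrite trmx_mul cjM cj_ct cj_tr.
have ka0 m : (cj (rho p 0%N *m V *m rdiag lam) *m U) 0 m != 0.
  have -> : (cj (rho p 0%N *m V *m rdiag lam) *m U) 0 m = (cj (invmx V1 *m bp p)) m 0 by rewrite -eka [RHS]mxE.
  by rewrite cjE conjC_eq0.
have [e1 n1 n2 e2] := pair_cd HY HZ' UU l0 ld m0 md s0 ka0.
have hint := pair_interlaced HY HZ' UU l0 ld m0 md s0 ka0.
pose ep j : C := (rho p 0%N *m V *m rdiag lam) 0 j / (ssd lam mu j)%:C%C.
pose dl m : C := (cj (rho p 0%N *m V *m rdiag lam) *m U) 0 m / (kkd lam mu m)%:C%C.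
exists lam, mu, V, V1, ep, dl; split; [exact: F|exact: F1|by split| |exact: e2]; split => j.
  rewrite -es [X in ph2 X^*]mxE -rmorphXn /= ph2_real; last exact: n1.
  by rewrite /ph2 rmorphM fmorphV !rmorphXn /= norm_conjC conj_normC.
have -> : (invmx V1 *m bp p) j 0 = ((cj (rho p 0%N *m V *m rdiag lam) *m U) 0 j)^*.
  have -> : (cj (rho p 0%N *m V *m rdiag lam) *m U) 0 j = (cj (invmx V1 *m bp p)) j 0 by rewrite -eka [RHS]mxE.
  by rewrite cjE conjCK.
rewrite -rmorphXn /= ph2_real; last exact: n2.
by rewrite /ph2 rmorphM fmorphV !rmorphXn /= norm_conjC conj_normC.
Qed.

End GenericChi.

Section ElementarySymbols.
Variables (R : realType) (n : nat).
Local Notation C := (R[i]).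
Local Notation N := n.+1.
Local Notation V := 'M[R]_(4, N).
Variables (U : set V) (base : (V -> R) -> Prop).
Local Notation celem := (celem U base).
Local Notation melem := (melem U base).

Lemma celem_polyA m : celem (fun p : V => (polyA p)`_m).
Proof.
have [j|h] := insubP 'I_N m.
  move=> _ e; have h : celem (fun p : V => Complex (p r0 j) (p r1 j)) by split; exact: elem_coord.
  apply: celem_ext h => p _; rewrite coef_polyA -e; by rewrite valK.
by apply: celem_ext (celem_cst _ _ 0) => p _; rewrite coef_polyA insubN.
Qed.

Lemma celem_polyB m : celem (fun p : V => (polyB p)`_m).
Proof.
case: m => [|m]; first by apply: celem_ext (celem_cst _ _ 1) => p _; rewrite coef_polyB0.
have [j|h] := insubP 'I_N m.
  move=> _ e; have h : celem (fun p : V => Complex (p r2 j) (p r3 j)) by split; exact: elem_coord.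
  apply: celem_ext h => p _; rewrite coef_polyBS -e; by rewrite valK.
by apply: celem_ext (celem_cst _ _ 0) => p _; rewrite coef_polyBS insubN.
Qed.

Lemma celem_ucoef m : celem (fun p : V => ucoef p m).
Proof.
elim/ltn_ind: m => m ih.
have h : celem (fun p : V => (polyA p)`_m - \sum_(k < m) (polyB p)`_k.+1 * ucoef p (m - k.+1)%N).
  apply: celemB; first exact: celem_polyA.
  apply: celem_sum => k _; apply: celemM; first exact: celem_polyB.
  by apply: ih; rewrite ltn_subrL /= (leq_trans _ (ltn_ord k)).
apply: celem_ext h => p _; rewrite -ucoef_rec big_ord_recl coef_polyB0 mul1r subn0.
by rewrite /bump /= addrK.
Qed.

Lemma celem_Prev m : celem (fun p : V => (Prev p)`_m).
Proof.
have [h|h] := leqP m N.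
  by apply: celem_ext (celem_polyB (N - m)%N) => p _; rewrite coef_Prev.
by apply: celem_ext (celem_cst _ _ 0) => p _; rewrite nth_default // size_Prev.
Qed.

Lemma melem_Mp : melem (fun p => Mp p).
Proof.
move=> i j; case e : (i == n :> nat).
  by apply: celem_ext (celemN (celem_Prev j)) => p _; rewrite mxE /= e.
by apply: celem_ext (celem_cst _ _ (i.+1 == j)%:R) => p _; rewrite mxE /= e.
Qed.

Lemma melem_hankT (c : V -> seqC R) : (forall k, celem (fun p => c p k)) ->
  melem (fun p => hankT n (c p)).
Proof. by move=> h i j; apply: celem_ext (h (i + j)%N) => p _; rewrite mxE. Qed.

Lemma melem_Tp : melem (fun p => Tp p).
Proof. exact: melem_hankT celem_ucoef. Qed.

Lemma melem_T1p : melem (fun p => T1p p).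
Proof. by apply: (melem_hankT (c := fun p m => ucoef p m.+1)) => k; exact: celem_ucoef. Qed.

Lemma melem_bp : melem (fun p => bp p).
Proof. by move=> i j; apply: celem_ext (celem_ucoef i) => p _; rewrite mxE. Qed.

Hypothesis Uschur : forall p, U p -> schur p.

Lemma ss_rho j : ss U base (fun k p => rho p k 0 j).
Proof.
exists N, (fun=> delta_mx 0 0), (fun p => Mp p), (fun=> delta_mx j 0); split.
- exact: melem_cst.
- exact: melem_Mp.
- exact: melem_cst.
- by move=> p Up; apply: Mp_geo; exact: Uschur.
- by move=> p k _; rewrite -colE -rowE !mxE.
Qed.

Lemma melem_Gp : melem (fun p => Gp p).
Proof.
move=> i j; have h := ssM (ss_conj (ss_rho i)) (ss_rho j).
apply: celem_ext (ss_csum h) => p _; rewrite mxE; apply: eq_csum => k.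
by rewrite [RHS]mxE big_ord1 ctE.
Qed.

Lemma melem_hsq (T : V -> 'M[C]_N) : melem T -> melem (fun p => hsq (Gp p) (T p)).
Proof.
move=> hT; rewrite /hsq.
do ?[apply: melemM|apply: melem_cj|exact: hT|exact: melem_Gp].
Qed.

Lemma melem_vp : melem (fun p => vp p).
Proof.
by apply: melemM melem_Tp _; apply: melem_cj; apply: melemM melem_Gp melem_bp.
Qed.

Lemma melem_krylov (A : V -> 'M[C]_N) v : melem A -> melem v -> melem (fun p => krylov (A p) (v p)).
Proof.
move=> hA hv i j; apply: celem_ext (melemM (melem_pow j hA) hv i 0) => p _.
by rewrite [RHS]mxE.
Qed.

End ElementarySymbols.

(** * Openness of the generic set *)

Section GenOpen.
Variables (R : realType) (n : nat).
Local Notation C := (R[i]).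
Local Notation N := n.+1.
Local Notation V := 'M[R]_(4, N).
Local Notation no := (fun _ : V -> R => False).

Lemma noP (U : set V) f : no f ->
  [/\ forall x, U x -> {for x, continuous f}, forall x v, U x -> derivable f x v &
      forall v, exists2 g, elem U no g & forall x, U x -> 'D_v f x = g x].
Proof. by []. Qed.

Lemma near_cabs_lt (U : set V) f p (e : R) : (forall x, U x -> nbhs x U) ->
  celem U no f -> U p -> cabs (f p) < e -> nbhs p (fun q : V => cabs (f q) < e).
Proof.
move=> Uo hf Up h.
have e0 : 0 < e by apply: le_lt_trans h; exact: cabs_ge0.
(* The squared modulus is elementary everywhere, the modulus itself only away from zeros. *)
have c := elem_continuous Uo (@noP U) (elem_cabs2 hf) Up.
have h2 : cabs (f p) ^+ 2 < e ^+ 2 by rewrite ltrXn2r ?cabs_ge0 // ltW.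
have := @cvgr_lt R V (nbhs p) (nbhs_filter p) (fun q : V => cabs (f q) ^+ 2) _ c (e ^+ 2) h2.
apply: filterS => q; apply: contraTT; rewrite -!leNgt => he.
by apply: lerXn2r; rewrite ?nnegrE ?cabs_ge0 ?(ltW e0).
Qed.

Lemma near_neq0 (U : set V) f p : (forall x, U x -> nbhs x U) ->
  celem U no f -> U p -> f p != 0 -> nbhs p (fun q : V => f q != 0).
Proof.
move=> Uo hf Up h.
have c := elem_continuous Uo (@noP U) (elem_cabs2 hf) Up.
have h2 : 0 < cabs (f p) ^+ 2.
  by rewrite lt_def sqr_ge0 andbT sqrf_eq0; apply: contra h => /eqP /cabs_eq0 ->.
have := @cvgr_gt R V (nbhs p) (nbhs_filter p) (fun q : V => cabs (f q) ^+ 2) _ c 0 h2.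
by apply: filterS => q; apply: contraTneq => ->; rewrite cabs0 expr0n ltxx.
Qed.

(** The rows of the power have absolute sum below one; read at the largest component of an
    eigenvector, this gives [|z|^k < 1]. *)
Lemma small_entries_schur (p : V) k : (forall i j, cabs ((Mp p ^+ k) i j) < N%:R^-1) -> schur p.
Proof.
move=> h z; rewrite -Mp_char => /root_char_col [x [x0 ex]].
have exk : Mp p ^+ k *m x = z ^+ k *: x.
  elim: k {h} => [|k ih]; first by rewrite !expr0 mul1mx scale1r.
  by rewrite exprS -mulmxE -mulmxA ih -scalemxAr ex scalerA exprSr.
pose j0 := [arg max_(j > ord0 : 'I_N) cabs (x j 0)]%O.
have jmax j : cabs (x j 0) <= cabs (x j0 0).
  by rewrite /j0; case: Order.TotalTheory.arg_maxP => // i _ hi; exact: hi.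
have xj0 : 0 < cabs (x j0 0).
  rewrite lt_def cabs_ge0 andbT; apply: contra x0 => /eqP e.
  apply/eqP/matrixP => i j; rewrite (ord1 j) mxE; apply: cabs_eq0; apply/eqP.
  by rewrite eq_le cabs_ge0 andbT -e jmax.
have lt1 : cabs z ^+ k < 1.
  rewrite -(ltr_pM2r xj0) mul1r -cabsX -cabsM.
  have -> : z ^+ k * x j0 0 = \sum_j (Mp p ^+ k) j0 j * x j 0.
    by have := congr1 (fun M : 'cV[C]_N => M j0 0) exk; rewrite !mxE => <-.
  apply: le_lt_trans (cabs_sum _ _ _) _.
  apply: (@lt_le_trans _ _ (\sum_(j < N) N%:R^-1 * cabs (x j0 0))).
    apply: ltr_sum; first by apply/hasP; exists ord0; rewrite ?mem_index_enum.
    move=> j _; rewrite cabsM; apply: le_lt_trans (_ : _ <= cabs ((Mp p ^+ k) j0 j) * cabs (x j0 0)) _.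
      by rewrite ler_wpM2l ?cabs_ge0.
    by rewrite ltr_pM2r.
  by rewrite sumr_const card_ord -mulrnAl -(mulr_natl _ N) divff ?mul1r ?pnatr_eq0.
rewrite cabsE ltcR; have [//|] := ltP (cabs z) 1 => hz.
by move: lt1; rewrite ltNge exprn_ege1.
Qed.

(** Stability at [p] makes the entries of one power [Mp ^+ k] small; finitely many continuous
    inequalities persist nearby and imply stability there. *)
Lemma schur_open p : schur p -> nbhs p (@schur R n).
Proof.
move=> hp.
have [k hk] : exists k, forall i j, cabs ((Mp p ^+ k) i j) < N%:R^-1.
  have e0 : 0 < N%:R^-1 :> R by rewrite invr_gt0.
  have hg i j : exists k0, forall k, (k0 <= k)%N -> cabs ((Mp p ^+ k) i j) < N%:R^-1.
    have [K [r [K0 r0' r1' h]]] := Mp_geo hp i j.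
    have c : ((fun k => K * r ^+ k) @ \oo --> (0 : R))%classic.
      have h0 : ((fun k => r ^+ k) @ \oo --> (0 : R))%classic by apply: cvg_expr; rewrite ger0_norm.
      have := cvgM (cvg_cst K) h0; rewrite mulr0; exact.
    have [k0 _ hk0] := @cvgr_lt R nat \oo%classic _ _ _ c _ e0.
    by exists k0 => k le; apply: le_lt_trans (h k) _; exact: hk0.
  have [f hf] := choice (fun ij : 'I_N * 'I_N => hg ij.1 ij.2).
  exists (\max_ij f ij)%N => i j; apply: (hf (i, j)); exact: leq_bigmax.
have To : forall x : V, [set: V]%classic x -> nbhs x [set: V]%classic by move=> x _; exact: filterT.
have h : nbhs p (fun q : V => forall i j, cabs ((Mp q ^+ k) i j) < N%:R^-1).
  apply: (@filter_forall V _ (fun i (q : V) => forall j, cabs ((Mp q ^+ k) i j) < N%:R^-1) (nbhs p) (nbhs_filter p)) => i.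
  apply: (@filter_forall V _ (fun j (q : V) => cabs ((Mp q ^+ k) i j) < N%:R^-1) (nbhs p) (nbhs_filter p)) => j.
  exact: (near_cabs_lt (f := fun q => (Mp q ^+ k) i j) To (melem_pow k (melem_Mp _ _) i j)).
by apply: filterS h => q; exact: small_entries_schur.
Qed.

Lemma Gen_open (p : V) : Gen p -> nbhs p (@Gen R n).
Proof.
have u (M : 'M[C]_N) : \det M != 0 -> M \in unitmx by rewrite unitmxE unitfE.
move=> /genP [h1 h2 h3 h4].
have so := @schur_open; have sx (q : V) : @schur R n q -> schur q by [].
have d2 := near_neq0 so (melem_det (melem_Tp _ _)) h1.
have d3 := near_neq0 so (celem_Prev _ _ 0) h1 h3.
have d4 := near_neq0 so (melem_det (melem_krylov (melem_hsq sx (melem_Tp _ _)) (melem_vp _ sx))) h1.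
rewrite unitmxE unitfE in h2; rewrite unitmxE unitfE in h4.
apply: filterS (filterI (filterI (so p h1) (d2 h2)) (filterI d3 (d4 h4))) => q [[q1 q2] [q3 q4]].
by apply/genP; split; [exact: q1|exact: u q2|exact: q3|exact: u q4].
Qed.

End GenOpen.

(** * Smooth dependence of simple real roots *)

Section SimpleRoots.
Variables (R : realType) (V : normedModType R) (U : set V).
Hypothesis Uopen : forall x, U x -> nbhs x U.
Local Notation no := (fun _ : V -> R => False).
Variables (N : nat) (r : 'I_N -> V -> R).
Hypothesis rdecr : forall x, U x -> forall i j : 'I_N, (i < j)%N -> r j x < r i x.

Definition rpoly x : {poly R} := \prod_j ('X - (r j x)%:P).

Hypothesis rcoef : forall k, elem U no (fun x => (rpoly x)`_k).

Let noP f : no f ->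
  [/\ forall x, U x -> {for x, continuous f}, forall x v, U x -> derivable f x v &
      forall v, exists2 g, elem U no g & forall x, U x -> 'D_v f x = g x].
Proof. by []. Qed.

Let size_rpoly x : size (rpoly x) = N.+1.
Proof. by rewrite /rpoly size_prod_XsubC -[RHS]/N.+1 /index_enum -enumT size_enum_ord. Qed.

Let horner_rpoly x t : (rpoly x).[t] = \prod_j (t - r j x).
Proof. by rewrite /rpoly horner_prod; apply: eq_bigr => j _; rewrite hornerXsubC. Qed.

Let horner_sum x t : (rpoly x).[t] = \sum_(k < N.+1) (rpoly x)`_k * t ^+ k.
Proof. by rewrite horner_coef size_rpoly. Qed.

Let elem_horner t : elem U no (fun x => (rpoly x).[t]).
Proof.
have h : elem U no (fun x => \sum_(k < N.+1) (rpoly x)`_k * t ^+ k).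
  by apply: elem_sum => k; apply: elem_mul => //; exact: elem_cst.
by apply: elem_ext h => x _; rewrite horner_sum.
Qed.

Lemma finite_lower_bound (I : finType) (f : I -> R) : (forall i, 0 < f i) ->
  exists2 d, 0 < d & forall i, d <= f i.
Proof.
move=> f0.
have [d d0 hd] : exists2 d, 0 < d & forall i, i \in enum I -> d <= f i.
  elim: (enum I) => [|i s [d d0 hd]]; first by exists 1.
  exists (Num.min d (f i)); first by rewrite lt_min d0 f0.
  move=> j; rewrite inE => /orP[/eqP ->|js]; first by rewrite ge_min lexx orbT.
  by rewrite ge_min hd.
by exists d => // i; rewrite hd // mem_enum.
Qed.

Lemma gap_bound x0 (e : R) : U x0 -> 0 < e -> exists d, [/\ 0 < d, d <= e &
  forall i j : 'I_N, (i < j)%N -> d + d <= r i x0 - r j x0].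
Proof.
move=> Ux0 e0.
pose f (ij : 'I_N * 'I_N) : R := if (ij.1 < ij.2)%N then (r ij.1 x0 - r ij.2 x0) / 2 else 1.
have f0 ij : 0 < f ij.
  by rewrite /f; case: ifP => // h; rewrite divr_gt0 // subr_gt0 rdecr.
have [d d0 hd] := finite_lower_bound f0.
exists (Num.min e d); split; first by rewrite lt_min e0.
  by rewrite ge_min lexx.
move=> i j ij; have := hd (i, j); rewrite /f /= ij => h.
have : Num.min e d <= d by rewrite ge_min lexx orbT.
by lra.
Qed.

(* For [x] near [x0] the value of the polynomial at each root for [x0] is less
   than [d ^ N], so some root for [x] is [d]-close to it, and the order of the
   roots identifies which one. *)
Lemma root_continuous j x0 : U x0 -> {for x0, continuous (r j)}.
Proof.
move=> Ux0; apply/cvgrPdist_lt => e e0.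
have [d [d0 de gap]] := gap_bound Ux0 e0.
have near1 : nbhs x0 (fun x => forall i, `|(rpoly x).[r i x0]| < d ^+ N).
  apply: (@filter_forall V _ (fun i x => `|(rpoly x).[r i x0]| < d ^+ N) (nbhs x0) (nbhs_filter x0)) => i.
  have c := elem_continuous Uopen noP (elem_horner (r i x0)) Ux0.
  have c' : ((fun x => `|(rpoly x).[r i x0]|) @ nbhs x0 --> `|(rpoly x0).[r i x0]|)%classic by apply: cvg_norm.
  apply: (@cvgr_lt R V (nbhs x0) (nbhs_filter x0) _ _ c').
  by rewrite horner_rpoly (bigD1 i) //= subrr mul0r normr0 exprn_gt0.
apply: filterS (filterI (Uopen Ux0) near1) => x [Ux hx].
have close i : exists k, `|r i x0 - r k x| < d.
  apply: contrapT => /forallNP hk; have := hx i; apply/negP; rewrite -leNgt.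
  rewrite horner_rpoly normr_prod -[in leLHS](card_ord N) -prodr_const.
  by apply: ler_prod => k _; rewrite (ltW d0) /= leNgt; apply/negP; exact: hk.
have [h hh] := choice close.
have hinc (i k : 'I_N) : (i < k)%N -> (h i < h k)%N.
  move=> ik; apply: (decr_lt (f := fun i => r i x)); first exact: rdecr.
  have := gap i k ik; have := hh i; have := hh k; rewrite !ltr_norml => /andP[a _] /andP[_ b] c.
  by lra.
by have := hh j; rewrite (incr_ord_id hinc) => hj; exact: lt_le_trans hj de.
Qed.

Definition rden j x : R := \prod_(k | k != j) (r j x - r k x).

Lemma rden_neq0 j x : U x -> rden j x != 0.
Proof.
move=> Ux; apply/prodf_neq0 => k kj; rewrite subr_eq0; apply: contra kj => /eqP e.
by rewrite eq_sym; apply/eqP; exact: (lam_inj (lam := fun i => r i x) (rdecr Ux) e).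
Qed.

Lemma cvg_bigsum (F : set_system R) (FF : Filter F) I (s : seq I) (P : pred I) (f : I -> R -> R) (l : I -> R) :
  (forall i, (f i @ F --> l i)%classic) ->
  ((fun h => \sum_(i <- s | P i) f i h) @ F --> \sum_(i <- s | P i) l i)%classic.
Proof.
move=> hf; elim: s => [|i s ih].
  rewrite big_nil (_ : (fun h => _) = fun=> 0); first exact: cvg_cst.
  by apply/funext => h; rewrite big_nil.
rewrite big_cons (_ : (fun h => _) = fun h => if P i then f i h + \sum_(j <- s | P j) f j h else \sum_(j <- s | P j) f j h); last first.
  by apply/funext => h; rewrite big_cons.
by case: ifP => _ //; apply: cvgD.
Qed.

Lemma cvg_bigprod (F : set_system R) (FF : Filter F) I (s : seq I) (P : pred I) (f : I -> R -> R) (l : I -> R) :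
  (forall i, (f i @ F --> l i)%classic) ->
  ((fun h => \prod_(i <- s | P i) f i h) @ F --> \prod_(i <- s | P i) l i)%classic.
Proof.
move=> hf; elim: s => [|i s ih].
  rewrite big_nil (_ : (fun h => _) = fun=> 1); first exact: cvg_cst.
  by apply/funext => h; rewrite big_nil.
rewrite big_cons (_ : (fun h => _) = fun h => if P i then f i h * \prod_(j <- s | P j) f j h else \prod_(j <- s | P j) f j h); last first.
  by apply/funext => h; rewrite big_cons.
by case: ifP => _ //; apply: cvgM.
Qed.

(** Evaluating the polynomial of [x0] at the root for [x] and subtracting zero, its own polynomial's
    value there, gives an exact formula for the difference quotient; continuity of the roots passes
    to the limit. *)
Lemma root_derive j x0 v : U x0 -> derivable (r j) x0 v /\
  'D_v (r j) x0 = - (\sum_(k < N.+1) 'D_v (fun x => (rpoly x)`_k) x0 * r j x0 ^+ k) / rden j x0.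
Proof.
move=> Ux0; pose F : set_system R := (0 : R)^'%classic.
have FF : ProperFilter F by exact: Proper_dnbhs_numFieldType.
pose xh (h : R) := h *: v + x0.
have cx : (xh @ F --> x0)%classic.
  have h0 : (xh @ (0 : R) --> xh 0)%classic.
    by apply: cvgD; [apply: cvgZr_tmp; exact: cvg_id|exact: cvg_cst].
  rewrite /xh scale0r add0r in h0.
  apply: cvg_trans h0; apply: cvg_app; exact: nbhs_dnbhs.
have cr : ((fun h => r j (xh h)) @ F --> r j x0)%classic.
  by apply: (cvg_comp _ _ cx); exact: root_continuous.
pose a k x := (rpoly x)`_k.
have ca (k : 'I_N.+1) : ((fun h : R => h^-1 * (a k (xh h) - a k x0)) @ F --> 'D_v (a k) x0)%classic.
  exact: (elem_derivable (v := v) Uopen noP (rcoef k) Ux0).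
(* The moved root against the unmoved others: the cofactor of [r j (xh h) - r j x0] in the
   polynomial of [x0]. *)
pose den h := \prod_(k | k != j) (r j (xh h) - r k x0).
have cden : (den @ F --> rden j x0)%classic.
  by apply: cvg_bigprod => k; apply: cvgB => //; exact: cvg_cst.
have cX (k : nat) : ((fun h => r j (xh h) ^+ k) @ F --> r j x0 ^+ k)%classic.
  elim: k => [|k ih]; first by rewrite expr0 (_ : (fun h => _) = fun=> 1); [exact: cvg_cst|apply/funext].
  rewrite exprS (_ : (fun h => _) = fun h => r j (xh h) * r j (xh h) ^+ k); first exact: cvgM.
  by apply/funext => h; rewrite exprS.
pose num h := \sum_(k < N.+1) (h^-1 * (a k (xh h) - a k x0)) * r j (xh h) ^+ k.
have cnum : (num @ F --> \sum_(k < N.+1) 'D_v (a k) x0 * r j x0 ^+ k)%classic.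
  by apply: cvg_bigsum => k; apply: cvgM.
have dn0 := rden_neq0 j Ux0.
have clim : ((fun h => - num h / den h) @ F --> - (\sum_(k < N.+1) 'D_v (a k) x0 * r j x0 ^+ k) / rden j x0)%classic.
  by apply: cvgM; [exact: cvgN|exact: cvgV].
have FF0 : Filter F by exact: _.
have key : F (fun h => - num h / den h = h^-1 *: ((r j \o shift x0) (h *: v) - r j x0)).
  have n1 : F (fun h => den h != 0) by exact: (@cvgr_neq0 _ _ _ F FF0 _ _ cden dn0).
  have n2 : F (fun h => U (xh h)) by apply: cx; exact: Uopen.
  apply: filterS (filterI n1 n2) => h [hd Uh].
  have e0 : (rpoly (xh h)).[r j (xh h)] = 0.
    by rewrite horner_rpoly (bigD1 j) //= subrr mul0r.
  have e1 : (rpoly x0).[r j (xh h)] = (r j (xh h) - r j x0) * den h.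
    by rewrite horner_rpoly (bigD1 j).
  have e2 : num h = - (h^-1 * (r j (xh h) - r j x0) * den h).
    rewrite -mulrA -e1 -[(rpoly x0).[_]]subr0 -e0 !horner_sum -sumrB -mulrN -sumrN mulr_sumr.
    by apply: eq_bigr => k _; rewrite opprB -mulrBl mulrA.
  by rewrite e2 opprK mulfK.
have lim : ((fun h : R => h^-1 *: ((r j \o shift x0) (h *: v) - r j x0)) @ F -->
    - (\sum_(k < N.+1) 'D_v (a k) x0 * r j x0 ^+ k) / rden j x0)%classic.
  by apply: cvg_trans clim; apply: near_eq_cvg; exact: key.
split; first by apply/cvg_ex; eexists; exact: lim.
exact: (cvg_lim _ lim).
Qed.

Lemma elem_mono (base : (V -> R) -> Prop) f : elem U no f -> elem U base f.
Proof.
elim => {f} [c|f h1 h2 h3 h4|f []|f g _ hf _ hg|f g _ hf _ hg|f f0 _ hf|f f0 _ hf|f _ hf|f _ hf|f g e _ hf].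
- exact: elem_cst.
- exact: elem_lin.
- exact: elem_add.
- exact: elem_mul.
- exact: elem_inv.
- exact: elem_sqrt.
- exact: elem_cos.
- exact: elem_sin.
- exact: elem_ext e hf.
Qed.

(** The roots are admissible generators: their derivatives are rational in the roots themselves and
    in derivatives of the coefficients. *)
Lemma root_base (base : (V -> R) -> Prop) : (forall j, base (r j)) -> forall j,
  [/\ forall x, U x -> {for x, continuous (r j)}, forall x v, U x -> derivable (r j) x v &
      forall v, exists2 g, elem U base g & forall x, U x -> 'D_v (r j) x = g x].
Proof.
move=> hb j; split => [x Ux|x v Ux|v]; [exact: root_continuous|by have [] := root_derive j v Ux|].
exists (fun x0 => - (\sum_(k < N.+1) 'D_v (fun x => (rpoly x)`_k) x0 * r j x0 ^+ k) / rden j x0); last first.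
  by move=> x Ux; have [_ ->] := root_derive j v Ux.
have er k : elem U base (r k) by exact: elem_base.
apply: elem_mul; last first.
  apply: elem_inv; first by move=> x; exact: rden_neq0.
  by apply: elem_prod => k; apply: elem_sub.
apply: elem_opp; apply: elem_sum => k; apply: elem_mul.
  by apply: elem_mono; exact: (elem_derive Uopen noP v (rcoef k)).
elim: (k : nat) => [|m ih].
  by apply: elem_ext (elem_cst _ _ 1) => x _; rewrite expr0.
by apply: elem_ext (elem_mul (er j) ih) => x _; rewrite exprS.
Qed.

End SimpleRoots.

(** * Eigenvalues and phases as elementary functions *)

Section SpectralBranch.
Variables (R : realType) (n : nat).
Local Notation C := (R[i]).
Local Notation N := n.+1.
Local Notation V := 'M[R]_(4, N).
Local Notation no := (fun _ : V -> R => False).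
Local Notation GenS := (@Gen R n).
Variables (T : V -> 'M[C]_N) (r : 'I_N -> V -> R) (ph : 'I_N -> V -> C).
Hypothesis hT : forall base, melem GenS base T.
Hypothesis hF : forall p, Gen p -> exists lam Vm,
  [/\ factor (Gp p) (T p) (bp p) lam Vm, forall j, r j p = lam j ^+ 2 &
      forall j, ph j p = ph2 ((invmx Vm *m bp p) j 0)].

Lemma Gen_schur (p : V) : Gen p -> schur p.
Proof. by move=> /genP []. Qed.

Lemma branch_decr p : Gen p -> forall i j : 'I_N, (i < j)%N -> r j p < r i p.
Proof.
move=> gp i j ij; have [lam [Vm [[l0 ld _ _ _] e _]]] := hF gp.
by rewrite !e ltr_pXn2r ?nnegrE ?ltW // ld.
Qed.

Lemma char_poly_conj (P D : 'M[C]_N) : P \in unitmx ->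
  char_poly (P *m D *m invmx P) = char_poly D.
Proof.
move=> uP; rewrite /char_poly.
have uP' : map_mx polyC P *m map_mx polyC (invmx P) = 1%:M by rewrite -map_mxM mulmxV // map_mx1.
have -> : char_poly_mx (P *m D *m invmx P) = map_mx polyC P *m char_poly_mx D *m map_mx polyC (invmx P).
  by rewrite /char_poly_mx !map_mxM mulmxBr mulmxBl scalar_mxC -[X in _ = X - _]mulmxA uP' mulmx1.
by rewrite !det_mulmx mulrAC -det_mulmx uP' det1 mul1r.
Qed.

Lemma branch_charpoly p : Gen p ->
  char_poly (hsq (Gp p) (T p)) = map_poly (real_complex R) (rpoly r p).
Proof.
move=> gp; have [lam [Vm [[l0 ld hV eT _] e _]]] := hF gp.
have uV := gram_unit hV.
have -> : hsq (Gp p) (T p) = Vm *m rdiag (fun j => lam j ^+ 2) *m invmx Vm.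
  by rewrite -(hsq_diag hV eT) mulmxK.
rewrite char_poly_conj // char_poly_trig; last by apply: diag_mx_is_trig.
rewrite /rpoly rmorph_prod; apply: eq_bigr => j _.
by rewrite rmorphB /= map_polyX map_polyC /= !mxE eqxx mulr1n e.
Qed.

(** These are the real parts of characteristic coefficients of a matrix with elementary entries, so
    they precede the adjunction of the eigenvalues. *)
Lemma branch_coef k : elem GenS no (fun p => (rpoly r p)`_k).
Proof.
have [h _] := pelem_char_poly (melem_hsq Gen_schur (hT no)) k.
by apply: elem_ext h => p gp; rewrite branch_charpoly // coef_map.
Qed.

Section Phase.
Variable base : (V -> R) -> Prop.
Hypothesis hb : forall j, base (r j).

Let Lj j p : {poly C} := map_poly (real_complex R) (lagr (fun k => r k p) j).

Let pelem_Lj j : pelem GenS base (Lj j).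
Proof.
have h1 k : pelem GenS base (fun p => if k != j then 'X - ((r k p)%:C%C)%:P else 1).
  move=> m; case: (k != j); last exact: celem_cst.
  have hc : celem GenS base (fun p => ('X : {poly C})`_m - (r k p)%:C%C * (m == 0%N)%:R).
    apply: celemB; first exact: celem_cst.
    by apply: celemM (celem_cst _ _ _); apply: celem_real; apply: elem_base.
  apply: celem_ext hc => p _; rewrite coefB coefC; congr (_ - _).
  by case: eqP => _; rewrite ?mulr1 ?mulr0.
have h := pelem_prod (index_enum _) h1.
move=> k; apply: celem_ext (h k) => p _; rewrite (_ : \prod_i _ = Lj j p) //.
rewrite /Lj /lagr rmorph_prod [RHS]big_mkcond; apply: eq_bigr => m _; case: (m != j) => //.
by rewrite rmorphB /= map_polyX map_polyC.
Qed.

(** A Takagi vector has an arbitrary sign; [W] is quadratic in it, hence well defined, and has the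
    phase of the squared coordinate. *)
Let W j p : C := (\sum_(k < N) (Lj j p)`_k *
   ((bp p)^T *m invmx (T p) *m hsq (Gp p) (T p) ^+ k *m bp p) 0 0) / (rden r j p)%:C%C.

Let Tunit p : Gen p -> T p \in unitmx.
Proof.
move=> gp; have [lam [Vm [[l0 _ hV -> _] _ _]]] := hF gp; have uV := gram_unit hV.
rewrite !unitmx_mul unitmx_tr uV andbT /= unitmxE det_diag unitfE.
by apply/prodf_neq0 => j _; rewrite mxE fmorph_eq0 gt_eqF.
Qed.

Let celem_W j : celem GenS base (W j).
Proof.
apply: celemM.
  apply: celem_sum => k _; apply: celemM; first exact: pelem_Lj.
  have hb' := melem_bp GenS base.
  have hi := melem_inv Tunit (hT base).
  exact: (melemM (melemM (melemM (melem_tr hb') hi) (melem_pow k (melem_hsq Gen_schur (hT base)))) hb').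
apply: celemV; first by move=> p gp; rewrite fmorph_eq0; exact: rden_neq0 branch_decr j p gp.
apply: celem_real; apply: elem_prod => k; by apply: elem_sub; apply: elem_base.
Qed.

(* [b^T T^-1] is the linear form whose value on the [j]-th Takagi vector is
   [t_j / lam_j]; the Lagrange polynomial projects on that vector. *)
Let W_val j p : Gen p -> exists (l : R) (Vm : 'M[C]_N),
  [/\ 0 < l, (invmx Vm *m bp p) j 0 != 0, ph j p = ph2 ((invmx Vm *m bp p) j 0) &
      W j p = (invmx Vm *m bp p) j 0 ^+ 2 / l%:C%C].
Proof.
move=> gp; have [lam [Vm [[l0 ld hV eT t0] e eph]]] := hF gp.
exists (lam j), Vm; split => //; have uV := gram_unit hV.
set t := invmx Vm *m bp p; pose q := (bp p)^T *m invmx (T p) *m Vm.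
have uT := Tunit gp.
have qE i : q 0 i * (lam i)%:C%C = t i 0.
  have h : q *m rdiag lam = t^T.
    apply: (can_inj (mulmxK (_ : Vm^T \in unitmx))); first by rewrite unitmx_tr.
    have -> : t^T *m Vm^T = (bp p)^T by rewrite -trmx_mul /t mulKVmx.
    by rewrite /q -!mulmxA (mulmxA Vm) -eT mulVmx // mulmx1.
  by have := congr1 (fun M : 'rV[C]_N => M 0 i) h; rewrite mul_mx_diag !mxE.
have rE i : ((lam i ^+ 2)%:C%C : C) = (r i p)%:C%C by rewrite e.
have sE : \sum_(k < N) (Lj j p)`_k * ((bp p)^T *m invmx (T p) *m hsq (Gp p) (T p) ^+ k *m bp p) 0 0
    = \sum_i q 0 i * t i 0 * (Lj j p).[(r i p)%:C%C].
  under eq_bigr do rewrite (hsq_pow hV eT) mulr_sumr.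
  rewrite exchange_big /=; apply: eq_bigr => i _.
  rewrite (@horner_coef_wide _ N); last by rewrite size_map_poly size_lagr.
  by rewrite mulr_sumr; apply: eq_bigr => k _; rewrite rE mulrCA.
have LE i : (Lj j p).[(r i p)%:C%C] = ((lagr (fun k => r k p) j).[r i p])%:C%C.
  by rewrite /Lj horner_map.
have d0 := rden_neq0 branch_decr j gp.
rewrite /W sE (bigD1 j) //= big1 ?addr0; last first.
  by move=> i ij; rewrite LE (lagr_neq (fun k => r k p) ij) mulr0.
rewrite LE horner_lagr -/(rden r j p) mulfK ?fmorph_eq0 //.
have lj : (lam j)%:C%C != 0 :> C by rewrite fmorph_eq0 gt_eqF.
by apply: (mulIf lj); rewrite divfK // mulrAC qE expr2.
Qed.

Let W_neq0 j p : Gen p -> W j p != 0.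
Proof.
move=> gp; have [lam [Vm [l0 t0 _ ->]]] := W_val j gp.
by rewrite mulf_neq0 ?expf_neq0 // invr_eq0 fmorph_eq0 gt_eqF.
Qed.

Lemma branch_phase j : celem GenS base (ph j).
Proof.
have h := celemM (celem_W j) (celem_real (elem_inv _ (elem_cabs (W_neq0 j) (celem_W j)))).
apply: celem_ext (h _) => [p gp|p gp]; last first.
  by apply: contra (W_neq0 j gp) => /eqP /cabs_eq0 ->.
have [l [Vm [l0 t0 -> ->]]] := W_val j gp; set t := (invmx _ *m _) j 0.
have l0' : `|l%:C%C| = l%:C%C :> C by rewrite cabsE cabs_real gtr0_norm.
have lj : l%:C%C != 0 :> C by rewrite fmorph_eq0 gt_eqF.
rewrite fmorphV /= -cabsE normf_div normrX l0' /ph2 invf_div.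
by rewrite mulrA mulfVK.
Qed.

End Phase.
End SpectralBranch.

Section ChiSmooth.
Variables (R : realType) (n : nat).
Local Notation C := (R[i]).
Local Notation N := n.+1.
Local Notation V := 'M[R]_(4, N).
Local Notation GenS := (@Gen R n).

Let rI (j : 'I_N) (p : V) : R := (chi N (ucoef p)).1.1.1 j / 2.
Let rL (j : 'I_N) (p : V) : R := (chi N (ucoef p)).1.1.2 j / 2.
Let phI (j : 'I_N) (p : V) : C := ((chi N (ucoef p)).1.2 j)^*.
Let phL (j : 'I_N) (p : V) : C := (chi N (ucoef p)).2 j.

Let half2 (a : R) : 2 * a / 2 = a. Proof. by rewrite mulrC mulKf. Qed.

Lemma ph2_conj (z : C) : (ph2 z^*)^* = ph2 z.
Proof. by rewrite /ph2 rmorphM fmorphV !rmorphXn /= conjCK conj_normC norm_conjC. Qed.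

Let FI p : Gen p -> exists lam Vm,
  [/\ factor (Gp p) (Tp p) (bp p) lam Vm, forall j, rI j p = lam j ^+ 2 &
      forall j, phI j p = ph2 ((invmx Vm *m bp p) j 0)].
Proof.
move=> gp; have [lam [mu [Vm [V1 [ep [dl [F F1 _ [e1 e2] e]]]]]]] := gen_chi gp.
exists lam, Vm; split; [exact: F|move=> j; rewrite /rI e; exact: half2|move=> j].
by rewrite /phI e /= e1 ph2_conj.
Qed.

Let FL p : Gen p -> exists lam Vm,
  [/\ factor (Gp p) (T1p p) (bp p) lam Vm, forall j, rL j p = lam j ^+ 2 &
      forall j, phL j p = ph2 ((invmx Vm *m bp p) j 0)].
Proof.
move=> gp; have [lam [mu [Vm [V1 [ep [dl [F F1 _ [e1 e2] e]]]]]]] := gen_chi gp.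
exists mu, V1; split; [exact: F1|move=> j; rewrite /rL e; exact: half2|move=> j].
by rewrite /phL e /= e2.
Qed.

Let base (f : V -> R) : Prop := (exists j, f = rI j) \/ (exists j, f = rL j).

Let hTI bs : melem GenS bs (fun p => Tp p). Proof. exact: melem_Tp. Qed.
Let hTL bs : melem GenS bs (fun p => T1p p). Proof. exact: melem_T1p. Qed.
Let bI j : base (rI j). Proof. by left; exists j. Qed.
Let bL j : base (rL j). Proof. by right; exists j. Qed.

Let Hbase f : base f ->
  [/\ forall x, GenS x -> {for x, continuous f}, forall x v, GenS x -> derivable f x v &
      forall v, exists2 g, elem GenS base g & forall x, GenS x -> 'D_v f x = g x].
Proof.
case=> [[j ->]|[j ->]].
  exact: (root_base (@Gen_open R n) (branch_decr FI) (branch_coef hTI FI) bI j).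
exact: (root_base (@Gen_open R n) (branch_decr FL) (branch_coef hTL FL) bL j).
Qed.

Lemma chi_smooth (j : 'I_N) :
  smooth_on GenS (fun p => (chi N (ucoef p)).1.1.1 j) /\
  smooth_on GenS (fun p => (chi N (ucoef p)).1.1.2 j) /\
  smooth_on GenS (fun p => complex.Re ((chi N (ucoef p)).1.2 j)) /\
  smooth_on GenS (fun p => complex.Im ((chi N (ucoef p)).1.2 j)) /\
  smooth_on GenS (fun p => complex.Re ((chi N (ucoef p)).2 j)) /\
  smooth_on GenS (fun p => complex.Im ((chi N (ucoef p)).2 j)).
Proof.
have sm f : elem GenS base f -> smooth_on GenS f by exact: (elem_smooth_on (@Gen_open R n) Hbase).
have two (f : V -> R) : base (fun p => f p / 2) -> elem GenS base f.
  move=> hf; apply: elem_ext (elem_mul (elem_cst _ _ 2) (elem_base _ hf)) => p _.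
  by rewrite mulrC divfK // pnatr_eq0.
have [L1 L2] := branch_phase hTL FL bL j.
have [I1 I2] := celem_conj (branch_phase hTI FI bI j).
split; first by apply: sm; apply: two; exact: bI.
split; first by apply: sm; apply: two; exact: bL.
split; first by apply: sm; apply: elem_ext I1 => p _; rewrite /phI conjCK.
split; first by apply: sm; apply: elem_ext I2 => p _; rewrite /phI conjCK.
by split; apply: sm.
Qed.

End ChiSmooth.

Lemma chi_range (R : realType) (n : nat) (p : 'M[R]_(4, n.+1)) : Gen p ->
  OmegaN (chi n.+1 (ucoef p)).1.1.1 (chi n.+1 (ucoef p)).1.1.2 /\
  (forall j, `|(chi n.+1 (ucoef p)).1.2 j| = 1) /\
  (forall m, `|(chi n.+1 (ucoef p)).2 m| = 1).
Proof.
move=> gp; have [lam [mu [V [V1 [ep [dl [F F1 [hint _] [e1 e2] ->]]]]]]] := gen_chi gp.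
have [l0 ld _ _ t0] := F; have [m0 md _ _ t10] := F1; have [i1 i2] := hint.
split; first split => /= [j|]; first by rewrite ltr_pM2l //; exact: i1.
  by split => /= [j k e|j _]; [rewrite ltr_pM2l //; exact: i2|rewrite mulr_gt0 // exprn_gt0].
split => j /=; first by rewrite e1 ph2_norm // conjC_eq0.
by rewrite e2 ph2_norm.
Qed.

(** Each symbol is [cd] of its own data; [chi] determines [lam], [mu] and the squares of the
    half-phases, and [cd_eq] needs no more. *)
Lemma chi_injective (R : realType) (n : nat) (p q : 'M[R]_(4, n.+1)) : Gen p -> Gen q ->
  chi n.+1 (ucoef p) = chi n.+1 (ucoef q) -> ucoef p = ucoef q.
Proof.
move=> gp gq.
have [lam [mu [V [V1 [ep [dl [F F1 [_ ep1] _ ->]]]]]]] := gen_chi gp.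
have [lam' [mu' [V' [V1' [ep' [dl' [F' F1' [_ ep2] _ ->]]]]]]] := gen_chi gq.
move=> [eI eL eP eT]; rewrite ep1 ep2.
have sq_eq (a b : 'I_n.+1 -> R) : (forall j, 0 < a j) -> (forall j, 0 < b j) ->
    (fun j => 2 * a j ^+ 2) = (fun j => 2 * b j ^+ 2) -> a = b.
  move=> a0 b0 e; apply/funext => j; have := congr1 (@^~ j) e => /= /(mulfI _) h.
  apply/eqP; rewrite -(eqrXn2 (n := 2)) ?ltW //; apply/eqP; apply: h; by rewrite pnatr_eq0.
have [l0 _ _ _ _] := F; have [l0' _ _ _ _] := F'; have [m0 _ _ _ _] := F1; have [m0' _ _ _ _] := F1'.
rewrite (sq_eq _ _ l0 l0' eI) (sq_eq _ _ m0 m0' eL).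
have cj_eq (a b : 'I_n.+1 -> R[i]) : (fun j => (a j)^* ^+ 2) = (fun j => (b j)^* ^+ 2) ->
    forall j, a j ^+ 2 = b j ^+ 2.
  move=> e j; have := congr1 (@^~ j) e => /= h.
  by apply: (can_inj (@conjCK _)); rewrite !rmorphXn.
by apply: cd_eq; apply: cj_eq.
Qed.

Lemma chi_surjective (R : realType) (n : nat) (Iv Lv : 'I_n.+1 -> R) (Phi Theta : 'I_n.+1 -> R[i]) :
  OmegaN Iv Lv -> (forall j, `|Phi j| = 1) -> (forall m, `|Theta m| = 1) ->
  exists p : 'M[R]_(4, n.+1), Gen p /\ chi n.+1 (ucoef p) = (Iv, Lv, Phi, Theta).
Proof.
move=> hO hP hT.
pose x : 'M[R]_(4, n.+1) := \matrix_(i, j) if i == r0 then Iv j else if i == r1 then Lv j else 0.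
have dx : Dom x.
  have -> : Dom x = OmegaN Iv Lv by rewrite /Dom; congr OmegaN; apply/funext => j; rewrite mxE.
  exact: hO.
(* Any square roots serve as half-phases, so no real angle has to be chosen for the given points of
   the circle. *)
pose ep j : R[i] := sqrtC (Phi j)^*; pose dl j : R[i] := sqrtC (Theta j)^*.
have nq (z : R[i]) : `|z| = 1 -> `|sqrtC z^*| = 1.
  move=> hz; apply/eqP; rewrite -(eqrXn2 (n := 2)) ?normr_ge0 // expr1n -normrX sqrtCK norm_conjC hz.
  exact: eqxx.
have ne j : `|ep j| = 1 by exact: nq.
have nd j : `|dl j| = 1 by exact: nq.
have g := data_Gen (lamf_gt0 dx) (muf_gt0 dx) (hintf dx) ne nd.
exists (psid (Ad (lamf x) (muf x) ep dl) (cd (lamf x) (muf x) ep dl)); split; first exact: g.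
rewrite data_ucoef (data_chi (lamf_gt0 dx) (muf_gt0 dx) (hintf dx) ne nd).
congr (_, _, _, _); apply/funext => j.
- by rewrite -[lamf x j ^+ 2]/(sq (lamf x) j) sq_lamf // mulrC divfK ?pnatr_eq0 // mxE.
- by rewrite -[muf x j ^+ 2]/(sq (muf x) j) sq_muf // mulrC divfK ?pnatr_eq0 // mxE.
- by rewrite -rmorphXn /= sqrtCK conjCK.
- by rewrite -rmorphXn /= sqrtCK conjCK.
Qed.

Theorem theorem1 (R : realType) (N : nat) : (1 <= N)%N ->
  let Gen : set 'M[R]_(4, N) := fun p => chartMN p /\ inMNgen N (ucoef p) in
  let Dom : set 'M[R]_(4, N) := fun x => OmegaN (fun j => x r0 j) (fun j => x r1 j) in
  (* chi_N maps M(N)_gen into Omega_N x T^{2N} *)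
  (forall c : seqC R, inMNgen N c ->
     OmegaN (chi N c).1.1.1 (chi N c).1.1.2 /\
     (forall j, `|(chi N c).1.2 j| = 1) /\ (forall m, `|(chi N c).2 m| = 1)) /\
  (* chi_N is injective on M(N)_gen *)
  (forall c1 c2 : seqC R, inMNgen N c1 -> inMNgen N c2 -> chi N c1 = chi N c2 -> c1 = c2) /\
  (* chi_N maps M(N)_gen onto Omega_N x T^{2N} *)
  (forall (Iv Lv : 'I_N -> R) (Phi Theta : 'I_N -> R[i]),
     OmegaN Iv Lv -> (forall j, `|Phi j| = 1) -> (forall m, `|Theta m| = 1) ->
     exists c : seqC R, inMNgen N c /\ chi N c = (Iv, Lv, Phi, Theta)) /\
  (* chi_N is C^oo on M(N)_gen (read in the coordinates (a, b) of M(N)) *)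
  (forall j : 'I_N,
     smooth_on Gen (fun p => (chi N (ucoef p)).1.1.1 j) /\
     smooth_on Gen (fun p => (chi N (ucoef p)).1.1.2 j) /\
     smooth_on Gen (fun p => complex.Re ((chi N (ucoef p)).1.2 j)) /\
     smooth_on Gen (fun p => complex.Im ((chi N (ucoef p)).1.2 j)) /\
     smooth_on Gen (fun p => complex.Re ((chi N (ucoef p)).2 j)) /\
     smooth_on Gen (fun p => complex.Im ((chi N (ucoef p)).2 j))) /\
  (* the inverse of chi_N, lifted to Omega_N x R^{2N} (angles t, e^{it}), is C^oo,
     and chi_N is symplectic: (chi_N^{-1})^* omega = sum dI_j/\dphi_j + sum dL_m/\dtheta_m *)
  (exists psi : 'M[R]_(4, N) -> 'M[R]_(4, N),
     (forall x, Dom x ->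
        Gen (psi x) /\
        chi N (ucoef (psi x)) =
          ((fun j => x r0 j), (fun j => x r1 j),
           (fun j => expi (x r2 j)), (fun j => expi (x r3 j)))) /\
     (forall a b, smooth_on Dom (fun x => psi x a b)) /\
     (forall x v w, Dom x ->
        omega_pull (fun y => ucoef (psi y)) x v w =
        \sum_(j < N) ((v r0 j * w r2 j - w r0 j * v r2 j)
                      + (v r1 j * w r3 j - w r1 j * v r3 j)))).
Proof.
case: N => [//|n] _ GenN DomN.
have lift (c : seqC R) : inMNgen n.+1 c -> exists2 p : 'M[R]_(4, n.+1), Gen p & c = ucoef p.
  by move=> hc; have [[p [cp e]] _] := hc; exists p => //; split => //; rewrite -e.
split; first by move=> c /lift [p gp ->]; exact: chi_range.
split; first by move=> c1 c2 /lift [p gp ->] /lift [q gq ->]; exact: chi_injective.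
split.
  move=> Iv Lv Phi Theta hO hP hT; have [p [[_ gp] e]] := chi_surjective hO hP hT.
  by exists (ucoef p).
split; first exact: chi_smooth.
exists (@psi R n); split; first by move=> x dx; split; [exact: psi_Gen|exact: chi_psi].
by split; [exact: psi_smooth|exact: psi_symplectic].
Qed.
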